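(* Assume in addition that $a\in W^{1,1}_{\mathrm{loc}}(\mathbb R_+)$. Let $X$ be an $H$-valued predictable process on $[0,T]$ with integrable trajectories such that for every $t\in[0,T]$ and every $\xi\in\mathcal D(A^* )$, $$\langle X(t),\xi\rangle_H=\int_0^t\langle a(t-\tau)X(\tau),A^*\xi\rangle_H\,d\tau+\langle Z(t),\xi\rangle_H\quad P\text{-a.s.}$$ Then $X(t)=Z_{\mathcal R}(t):=\int_0^t\mathcal R(t-\tau)\,dZ(\tau)$ $P$-a.s. for every $t\in[0,T]$.
   Context: $H$ is a real separable Hilbert space with inner product $\langle\cdot,\cdot\rangle_H$; $A$ is a closed densely defined linear operator in $H$ with adjoint $A^*$, $a\in L^1_{\mathrm{loc}}(\mathbb R_+)$, and the equation $X(t)=\int_0^t a(t-\tau)AX(\tau)\,d\tau+X_0+Z(t)$ is well-posed with resolvent family $\{\mathcal R(t)\}_{t\ge0}$ of bounded operators, uniformly bounded on compact intervals, strongly continuous, $\mathcal R(0)=I$, satisfying $\mathcal R(t)x=x+\int_0^t a(t-\tau)A\mathcal R(\tau)x\,d\tau$ for $x\in\mathcal D(A)$. $Z$ is an $H$-valued Lévy process (independent stationary increments, continuous in probability, càdlàg, $Z(0)=0$) on a filtered probability space. The stochastic convolution $\int_0^t\mathcal R(t-\tau)\,dZ(\tau)$ is the limit in probability of $\sum_i\mathcal R(s_i)(Z(t-t_{i-1})-Z(t-t_i))$ over partitions $0=t_0<\dots<t_n=t$ with mesh $\to0$, $s_i\in[t_{i-1},t_i]$. *)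

(* Defs.v *)
From HB Require Import structures.
From mathcomp Require Import all_boot all_order all_algebra.
From mathcomp Require Import all_classical all_reals all_analysis.
Set Implicit Arguments. Unset Strict Implicit. Unset Printing Implicit Defensive.
Import Order.TTheory GRing.Theory Num.Theory.
Import numFieldNormedType.Exports.
Local Open Scope classical_set_scope.
Local Open Scope ring_scope.

Section Defs.
Variable R : realType.

Definition is_inner_product (H : normedModType R) (ip : H -> H -> R) : Prop :=
  [/\ (forall x y, ip x y = ip y x),
      (forall x y z, ip (x + y) z = ip x z + ip y z),
      (forall (c : R) x y, ip (c *: x) y = c * ip x y) &
      (forall x, ip x x = `|x| ^+ 2)].

Definition separable_space (H : normedModType R) : Prop :=
  exists u : nat -> H, forall x (e : R), 0 < e -> exists n, `|x - u n| < e.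

Definition closed_densely_defined (H : normedModType R)
    (DA : set H) (A : H -> H) : Prop :=
  [/\ DA 0 /\
      (forall x y, DA x -> DA y -> DA (x + y)),
      (forall (c : R) x, DA x -> DA (c *: x)),
      (forall x y, DA x -> DA y -> A (x + y) = A x + A y) /\
      (forall (c : R) x, DA x -> A (c *: x) = c *: A x),
      (forall (u : nat -> H) x y, (forall n, DA (u n)) ->
         u @ \oo --> x -> (A \o u) @ \oo --> y -> DA x /\ A x = y) &
      (forall x (e : R), 0 < e -> exists y, DA y /\ `|x - y| < e)].

(* xi \in D(A^* ) and A^* xi = eta *)
Definition adjoint_pair (H : normedModType R) (ip : H -> H -> R)
    (DA : set H) (A : H -> H) (xi eta : H) : Prop :=
  forall x, DA x -> ip (A x) xi = ip x eta.

Definition loc_integrable_Rplus (f : R -> R) : Prop :=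
  forall T : R, 0 < T ->
    (@lebesgue_measure R).-integrable `[0, T]
       (fun x => (f x)%:E).

Definition smooth_fun (phi : R -> R) : Prop :=
  forall (n : nat) (x : R), derivable (derive1n n phi) x 1.

Definition test_fun_Rplus (phi : R -> R) : Prop :=
  smooth_fun phi /\
  exists al be : R, [/\ 0 < al, al <= be &
    forall x, (x < al \/ be < x) -> phi x = 0].

Definition W11_loc_Rplus (a : R -> R) : Prop :=
  loc_integrable_Rplus a /\
  exists b : R -> R, loc_integrable_Rplus b /\
    forall phi, test_fun_Rplus phi ->
      Rintegral lebesgue_measure [set x | 0 < x]
        (fun x => a x * derive1 phi x) =
      - Rintegral lebesgue_measure [set x | 0 < x] (fun x => b x * phi x).

Definition resolvent_family (H : normedModType R) (ip : H -> H -> R)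
    (DA : set H) (A : H -> H) (a : R -> R) (Rs : R -> H -> H) : Prop :=
  [/\
      (forall t x y, Rs t (x + y) = Rs t x + Rs t y),
      (forall t (c : R) x, Rs t (c *: x) = c *: Rs t x) /\
      (forall T : R, exists M : R, forall t x, 0 <= t <= T ->
          `|Rs t x| <= M * `|x|),
      (forall x, {within `[0, +oo[, continuous (fun t => Rs t x)}) /\
      (forall x, Rs 0 x = x) /\
      (forall t x, 0 <= t -> DA x -> DA (Rs t x) /\ A (Rs t x) = Rs t (A x)) &
      (* resolvent equation R(t)x = x + int_0^t a(t-s) A R(s) x ds,
         the H-valued integral being taken weakly *)
      (forall t x h, 0 <= t -> DA x ->
         ip (Rs t x) h = ip x h +
           Rintegral lebesgue_measure `[0, t]
             (fun s => ip (a (t - s) *: A (Rs s x)) h))].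

Definition borelH (H : normedModType R) : set (set H) :=
  smallest (sigma_algebra setT) [set U | open U].
Arguments borelH : clear implicits.

Definition H_measurable d (Omega : measurableType d) (H : normedModType R)
    (f : Omega -> H) : Prop :=
  forall B, borelH H B -> measurable (f @^-1` B).

Section Prob.
Context d (Omega : measurableType d) (P : probability Omega R).

Definition cadlag_paths (H : normedModType R) (Z : R -> Omega -> H) : Prop :=
  forall w t, (0 <= t)%R ->
    (forall e : R, (0 < e)%R -> exists2 del : R, (0 < del)%R &
        forall s, (t <= s < t + del)%R -> (`|Z s w - Z t w| < e)%R) /\
    ((0 < t)%R -> exists l : H, forall e : R, (0 < e)%R ->
        exists2 del : R, (0 < del)%R &
        forall s, (t - del < s < t)%R -> (`|Z s w - l| < e)%R).

Definition levy_process (H : normedModType R) (Z : R -> Omega -> H) : Prop :=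
  [/\ (forall w, Z 0%R w = 0%R) /\
      (forall t, (0 <= t)%R -> H_measurable (Z t)),
      (forall (n : nat) (tt : nat -> R) (B : nat -> set H),
         (0 <= tt 0%N)%R ->
         (forall i, (i < n)%N -> (tt i < tt i.+1)%R) ->
         (forall i, (i < n)%N -> borelH H (B i)) ->
         P (\bigcap_(i in [set i | (i < n)%N])
              [set w | B i (Z (tt i.+1) w - Z (tt i) w)]) =
         (\prod_(i < n) P [set w | B i (Z (tt i.+1) w - Z (tt i) w)%R])%E),
      (forall s t B, (0 <= s <= t)%R -> borelH H B ->
         P [set w | B (Z t w - Z s w)] = P [set w | B (Z (t - s)%R w)]),
      (forall t (e eta : R), (0 <= t)%R -> (0 < e)%R -> (0 < eta)%R ->
         exists2 del : R, (0 < del)%R & forall s, (0 <= s)%R ->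
           (`|s - t| < del)%R ->
           (P [set w | (e < `|Z s w - Z t w|)%R] < eta%:E)%E) &
      cadlag_paths Z].

Definition filtration (F : R -> set (set Omega)) : Prop :=
  (forall t, sigma_algebra setT (F t) /\ F t `<=` measurable) /\
  (forall s t, (s <= t)%R -> F s `<=` F t).

Definition predictable_sets (F : R -> set (set Omega)) (T : R)
    : set (set (R * Omega)) :=
  smallest (sigma_algebra (`[0%R, T] `*` setT))
    ([set C | exists A, F 0%R A /\ C = [set 0%R] `*` A] `|`
     [set C | exists s t A, [/\ (0 <= s)%R, (s < t)%R, (t <= T)%R, F s A &
                           C = `]s, t] `*` A]]).

Definition predictable (H : normedModType R) (F : R -> set (set Omega))
    (T : R) (X : R -> Omega -> H) : Prop :=
  forall B, borelH H B ->
    predictable_sets F T [set p | p.1 \in `[0%R, T] /\ B (X p.1 p.2)].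

(* Riemann sum for the stochastic convolution int_0^t Rs(t - tau) dZ(tau)
   over the partition 0 = p 0 < ... < p n = t with tags s i in [p i, p i.+1] *)
Definition conv_riemann_sum (H : normedModType R) (Rs : R -> H -> H)
    (Z : R -> Omega -> H) (t : R) (n : nat) (p s : nat -> R) (w : Omega) : H :=
  (\sum_(i < n) Rs (s i) (Z (t - p i)%R w - Z (t - p i.+1)%R w))%R.

Definition tagged_partition (t : R) (n : nat) (p s : nat -> R) (del : R)
    : Prop :=
  [/\ p 0%N = 0%R, p n = t,
      (forall i, (i < n)%N -> (p i < p i.+1)%R),
      (forall i, (i < n)%N -> (p i <= s i <= p i.+1)%R) &
      (forall i, (i < n)%N -> (p i.+1 - p i < del)%R)].

(* Y is (a.s. equal to) int_0^t Rs(t - tau) dZ(tau): the Riemann sums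
   converge to Y in probability as the mesh tends to 0 *)
Definition is_stoch_conv (H : normedModType R) (Rs : R -> H -> H)
    (Z : R -> Omega -> H) (t : R) (Y : Omega -> H) : Prop :=
  forall e eta : R, (0 < e)%R -> (0 < eta)%R ->
    exists2 del : R, (0 < del)%R &
      forall n p s, tagged_partition t n p s del ->
        (P [set w | (e < `|conv_riemann_sum Rs Z t n p s w - Y w|)%R] < eta%:E)%E.

End Prob.
End Defs.

(* Main.v *)
(** After modification on a null set, [a s = c + int_0^s b]. For an adjoint pair
    [(xi, eta)], i.e. [eta = A^* xi], the form
    [g_s(x, h) = c <R(s)x, h> + int_0^s b(u) <R(s - u)x, h> du] satisfies
    [<R(s)x, xi> = <x, xi> + int_0^s g_u(x, eta) du] and
    [(a * g(x, eta))(s) = g_s(x, xi) - a(s) <x, xi>], and the vectors representing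
    [g_s(., xi)] and [g_s(., eta)] again form an adjoint pair. Testing the weak equation
    at time [tau] with the pair obtained at [t - tau] and integrating over [tau] gives
    [int_0^t a(t - r) <X r, h> dr = int_0^t g_(t - tau)(Z tau, h) dtau] almost surely.
    Summation by parts rewrites the Riemann sums tested against [xi] as
    [<Z t, xi> + int_0^t g_u(Z(t - theta u), eta) du] with [theta u] within the mesh of
    [u]; cadlag paths are continuous almost everywhere, so by dominated convergence they
    converge to [<X t, xi>].

    Convergence of all coordinates along an orthonormal basis inside [D(A^* )] becomes
    convergence in probability once the tails of the Riemann sums are uniformly small.
    Increments over a short interval of length [h] are controlled by repeating them about
    [t / h] times: this random walk stays bounded with large probability, so stopping it
    at its exit time bounds the mean and second moment of a (truncated, discretised)
    increment by multiples of [h]. *)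

Require Import Defs.
From HB Require Import structures.
From mathcomp Require Import all_boot all_order all_algebra.
From mathcomp Require Import all_classical all_reals all_analysis.
From mathcomp Require Import measurable_realfun.
From mathcomp Require Import ring lra.
Import Order.TTheory GRing.Theory Num.Theory.
Import numFieldNormedType.Exports.
Set Implicit Arguments. Unset Strict Implicit. Unset Printing Implicit Defensive.
Local Open Scope classical_set_scope.
Local Open Scope ring_scope.

(** * Hilbert space *)

(** No moment of [Z] is assumed, so an isometry for the Riemann sums is out of reach: neither they
    nor the increments need have a mean. Rounding increments to a finite list of centres turns every
    expectation into a finite sum, at the price of a small probability that no centre is near. Each
    step needs two bounds, one for the norm and one for the part beyond [L] coordinates: the
    resolvent sends only a finite-dimensional space to vectors with uniformly small tails, so the
    rest must already be small in the noise.

    The form [g_s(x, h)] is the time derivative of the convolution of [a] with [<R(.)x, h>]. The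
    regularity of [a] puts this derivative on the kernel, so neither the resolvent nor [X] is ever
    differentiated.

    The null set in the weak equation depends on the time and on the adjoint pair, and the pair used
    at time [tau] varies with [tau]. Hence the equation is used at each time separately, and Fubini
    on the product of time and [Omega] then yields one null set; this is why joint measurability has
    to be established. *)

Lemma cvg_seqP (R : realType) (V : normedModType R) (u : nat -> V) (l : V) :
  u @ \oo --> l <->
  forall e : R, 0 < e -> exists N, forall n, (N <= n)%N -> `|u n - l| < e.
Proof.
split=> [/cvgrPdist_lt ul e e0|ul].
  have [N _ hN] := ul e e0; exists N => n Nn.
  by rewrite distrC; exact: hN.
apply/cvgrPdist_lt => e e0; have [N hN] := ul e e0.
by exists N => // n /= Nn; rewrite distrC; exact: hN.
Qed.

Section semi_inner_product.
Variables (R : realType) (V : lmodType R) (ip : V -> V -> R).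

(** Positivity is only semidefinite and the carrier a bare module: later instances include the sum
    form on [H * H] and the pull-back [ipQ] along a tail projection, which has a kernel. *)
Definition semi_inner_product : Prop :=
  [/\ (forall x y, ip x y = ip y x),
      (forall x y z, ip (x + y) z = ip x z + ip y z),
      (forall (c : R) x y, ip (c *: x) y = c * ip x y) &
      (forall x, 0 <= ip x x)].

Hypothesis ipP : semi_inner_product.

Lemma sipC x y : ip x y = ip y x. Proof. by have [? _ _ _] := ipP. Qed.
Lemma sipDl x y z : ip (x + y) z = ip x z + ip y z.
Proof. by have [_ ? _ _] := ipP. Qed.
Lemma sipZl c x y : ip (c *: x) y = c * ip x y.
Proof. by have [_ _ ? _] := ipP. Qed.
Lemma sip_ge0 x : 0 <= ip x x. Proof. by have [_ _ _ ?] := ipP. Qed.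
Lemma sipDr x y z : ip z (x + y) = ip z x + ip z y.
Proof. by rewrite sipC sipDl !(sipC z). Qed.
Lemma sipZr c x y : ip x (c *: y) = c * ip x y.
Proof. by rewrite sipC sipZl sipC. Qed.
Lemma sipNl x y : ip (- x) y = - ip x y.
Proof. by rewrite -scaleN1r sipZl mulN1r. Qed.
Lemma sipNr x y : ip x (- y) = - ip x y.
Proof. by rewrite sipC sipNl sipC. Qed.
Lemma sipBl x y z : ip (x - y) z = ip x z - ip y z.
Proof. by rewrite sipDl sipNl. Qed.
Lemma sipBr x y z : ip z (x - y) = ip z x - ip z y.
Proof. by rewrite sipDr sipNr. Qed.
Lemma sip0l x : ip 0 x = 0.
Proof. by rewrite -(scale0r x) sipZl mul0r. Qed.
Lemma sip0r x : ip x 0 = 0.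
Proof. by rewrite sipC sip0l. Qed.
Lemma sip_suml (I : Type) (s : seq I) (f : I -> V) y :
  ip (\sum_(i <- s) f i) y = \sum_(i <- s) ip (f i) y.
Proof.
elim: s => [|i s IH]; first by rewrite !big_nil sip0l.
by rewrite !big_cons sipDl IH.
Qed.
Lemma sip_sumr (I : Type) (s : seq I) (f : I -> V) y :
  ip y (\sum_(i <- s) f i) = \sum_(i <- s) ip y (f i).
Proof. by rewrite sipC sip_suml; apply: eq_bigr => i _; rewrite sipC. Qed.

Lemma sip_sqrD x y : ip (x + y) (x + y) = ip x x + 2 * ip x y + ip y y.
Proof. by rewrite sipDl !sipDr (sipC y x); ring. Qed.

Lemma sip_CS x y : ip x y ^+ 2 <= ip x x * ip y y.
Proof.
have h s : 0 <= ip x x + 2 * s * ip x y + s ^+ 2 * ip y y.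
  by have := sip_ge0 (x + s *: y); rewrite sip_sqrD !sipZr sipZl; lra.
have := sip_ge0 y; rewrite le_eqVlt => /predU1P[yy0|yy_gt0].
  (* For a null vector [y] the quadratic in [s] is affine, and this [s] would give it the value [-1]
     unless [ip x y] vanishes. *)
  rewrite -yy0 mulr0; have := h (- (ip x x + 1) / (2 * ip x y)).
  rewrite -yy0 mulr0 addr0.
  have [->|xy0] := eqVneq (ip x y) 0; first by rewrite expr0n.
  have -> : 2 * (- (ip x x + 1) / (2 * ip x y)) * ip x y = - (ip x x + 1).
    by field.
  lra.
have := h (- ip x y / ip y y).
have yy0 : ip y y != 0 by rewrite gt_eqF.
have -> : ip x x + 2 * (- ip x y / ip y y) * ip x y +
   (- ip x y / ip y y) ^+ 2 * ip y y = (ip x x * ip y y - ip x y ^+ 2) / ip y y.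
  by field.
by rewrite pmulr_lge0 ?invr_gt0// subr_ge0.
Qed.

Variable G : set V.
Hypothesis G0 : G 0.
Hypothesis GD : forall x y, G x -> G y -> G (x + y).
Hypothesis GZ : forall (c : R) x, G x -> G (c *: x).
Hypothesis Gcomplete : forall u : nat -> V, (forall n, G (u n)) ->
  (forall e : R, 0 < e -> exists N, forall m n, (N <= m)%N -> (N <= n)%N ->
     ip (u m - u n) (u m - u n) < e) ->
  exists2 y, G y & forall e : R, 0 < e -> exists N, forall n, (N <= n)%N ->
     ip (u n - y) (u n - y) < e.

(* The representing vector is the minimiser of [ip g g - 2 * f g]. *)
Lemma riesz_subspace (f : V -> R) (C : R) : 0 <= C ->
  (forall x y, G x -> G y -> f (x + y) = f x + f y) ->
  (forall (c : R) x, G x -> f (c *: x) = c * f x) ->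
  (forall x, G x -> f x ^+ 2 <= C * ip x x) ->
  exists2 y, G y & forall g, G g -> f g = ip y g.
Proof.
move=> C0 fD fZ fC.
pose J g := ip g g - 2 * f g.
have J_ge g : G g -> - C <= J g.
  move=> Gg; rewrite /J; have := fC _ Gg; have := sip_ge0 g.
  move: (ip g g) (f g) => q z q0 hz; rewrite leNgt; apply/negP => h.
  have h1 : C + q < 2 * z by lra.
  have : (C + q) ^+ 2 < (2 * z) ^+ 2 by rewrite ltr_sqr ?nnegrE; lra.
  by have := sqr_ge0 (C - q); lra.
pose E := [set J g | g in G].
have hE : has_inf E.
  split; first by exists (J 0), 0.
  by exists (- C) => _ [g Gg <-]; exact: J_ge.
have infJ g : G g -> inf E <= J g.
  by move=> Gg; apply: ge_inf; [exact: hE.2 | exists g].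
have /choice[u uP] : forall n : nat, exists g, G g /\ J g < inf E + n.+1%:R^-1.
  move=> n; have /inf_adherent : 0 < n.+1%:R^-1 :> R by [].
  by move=> /(_ _ hE)[_ [g Gg <-] ?]; exists g.
(* Parallelogram law for [J]: the midpoint of two near-minimisers cannot go below the infimum, so
   they are close and the sequence [u] is Cauchy. *)
have par g h : G g -> G h ->
    ip (g - h) (g - h) = 2 * J g + 2 * J h - 4 * J (2^-1 *: (g + h)).
  move=> Gg Gh; rewrite /J fZ ?fD//; last exact: GD.
  rewrite !sipZl !sipZr !sip_sqrD sipNl !sipNr opprK; by field.
have [y Gy uy] : exists2 y, G y & forall e : R, 0 < e -> exists N, forall n,
    (N <= n)%N -> ip (u n - y) (u n - y) < e.
  apply: Gcomplete => [n|e e0]; first exact: (uP n).1.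
  have [N hN] : exists N : nat, 4 / e < N%:R by exists (Num.truncn (4 / e)).+1; exact: truncnS_gt.
  exists N => m n Nm Nn.
  have small k : (N <= k)%N -> k.+1%:R^-1 < e / 4.
    move=> Nk; rewrite -[ltRHS]invrK ltf_pV2 ?posrE ?invr_gt0 ?divr_gt0//.
    by rewrite invf_div (lt_le_trans hN)// ler_nat ltnW.
  have [Gm um] := uP m; have [Gn un] := uP n.
  rewrite par//.
  have := infJ _ (GZ 2^-1 (GD Gm Gn)); have := small _ Nm; have := small _ Nn.
  move: um un; move: (J _) (J _) (J _) (inf E) n.+1%:R^-1 m.+1%:R^-1.
  by move=> *; lra.
exists y => // g Gg.
apply/eqP; rewrite eq_sym -subr_eq0; apply/negP => /negP D0.
set D := ip y g - f g in D0.
set q := ip g g; have q0 : 0 <= q := sip_ge0 g.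
(* If the residual [D] were nonzero, moving by [s] along [g] would lower [J] by a fixed amount [e0],
   contradicting near-minimality. The [+ 1] in [q + 1] covers a null [g]. *)
have [s [e0 e0_gt0 sD]] : exists s : R, exists2 e0 : R, 0 < e0 &
    2 * s * D + s ^+ 2 * q <= - e0.
  exists (- D / (q + 1)), (D ^+ 2 / (q + 1)).
    by rewrite divr_gt0 ?exprn_even_gt0//; lra.
  have -> : 2 * (- D / (q + 1)) * D + (- D / (q + 1)) ^+ 2 * q =
      - (D ^+ 2 / (q + 1)) - D ^+ 2 / (q + 1) ^+ 2 by field; lra.
  by rewrite gerBl divr_ge0// sqr_ge0.
have var n : - n.+1%:R^-1 <= 2 * s * (ip (u n) g - f g) + s ^+ 2 * q.
  have [Gn un] := uP n.
  have := infJ _ (GD Gn (GZ s Gg)).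
  rewrite /J fD ?fZ ?sip_sqrD ?sipZr ?sipZl//; last exact: GZ.
  move: un; rewrite /J -/q; move: n.+1%:R^-1 (inf E) (f _) (f _) (ip _ _) (ip _ _).
  by move: (s) (q) => *; lra.
(* The variation is computed at [u n] instead of [y]; this [d] keeps the resulting error [2 * s * z]
   below [e0 / 2], and the other half of [e0] absorbs the defect of [u n]. *)
pose d := (e0 / 2) ^+ 2 / (4 * s ^+ 2 * q + 1).
have den0 : 0 < 4 * s ^+ 2 * q + 1.
  by have := mulr_ge0 (sqr_ge0 s) q0; lra.
have d0 : 0 < d by rewrite divr_gt0// exprn_gt0// divr_gt0.
have [N1 hN1] := uy _ d0.
have [N2 hN2] : exists N : nat, 2 / e0 < N%:R by exists (Num.truncn (2 / e0)).+1; exact: truncnS_gt.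
pose n := maxn N1 N2.
have small : n.+1%:R^-1 < e0 / 2.
  rewrite -[ltRHS]invrK ltf_pV2 ?posrE ?invr_gt0 ?divr_gt0//.
  by rewrite invf_div (lt_le_trans hN2)// ler_nat ltnW// ltnS leq_maxr.
have hd := hN1 n (leq_maxl _ _).
have cs := sip_CS (u n - y) g.
rewrite -/q in cs.
set z := ip (u n - y) g in cs.
have zE : ip (u n) g - f g = D + z by rewrite /z /D sipBl; lra.
have := var n; rewrite zE mulrDr => vn.
have z2 : (2 * s * z) ^+ 2 < (e0 / 2) ^+ 2.
  have -> : (2 * s * z) ^+ 2 = 4 * s ^+ 2 * z ^+ 2 by ring.
  have h1 : 4 * s ^+ 2 * z ^+ 2 <= 4 * s ^+ 2 * (d * q).
    apply: ler_wpM2l; first by have := sqr_ge0 s; lra.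
    by rewrite (le_trans cs)// ler_wpM2r// ltW.
  have h2 : 4 * s ^+ 2 * (d * q) < d * (4 * s ^+ 2 * q + 1) by lra.
  rewrite (le_lt_trans h1)// (lt_le_trans h2)// /d divfK//; lra.
have : `|2 * s * z| < e0 / 2.
  by rewrite -ltr_sqr ?nnegrE ?real_normK ?num_real//; lra.
move=> /ltr_normlP[h1 h2]; move: small vn h1 h2 sD.
by move: n.+1%:R^-1 => k; lra.
Qed.

End semi_inner_product.

Section hilbert.
Variables (R : realType) (H : completeNormedModType R) (ip : H -> H -> R).
Hypothesis ipP : is_inner_product ip.

Lemma ip_semi : semi_inner_product ip.
Proof. by have [h1 h2 h3 h4] := ipP; split => // x; rewrite h4 sqr_ge0. Qed.
Let sip := ip_semi.

Lemma ip_sqr x : ip x x = `|x| ^+ 2.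
Proof. by have [_ _ _ ->] := ipP. Qed.

Lemma ip_CS x y : `|ip x y| <= `|x| * `|y|.
Proof.
rewrite -ler_sqr ?nnegrE ?mulr_ge0// real_normK ?num_real// exprMn -!ip_sqr.
exact: (sip_CS sip).
Qed.

Lemma ip_nondeg x : ip x x = 0 -> x = 0.
Proof. by rewrite ip_sqr => /eqP; rewrite sqrf_eq0 normr_eq0 => /eqP. Qed.

Lemma ipl_continuous h : continuous (fun x => ip x h).
Proof.
move=> x; apply/cvgrPdist_lt => e e0.
have h1 : 0 < `|h| + 1 by rewrite ltr_wpDl.
have d0 : 0 < e / (`|h| + 1) by rewrite divr_gt0.
near=> y; rewrite -(sipBl ip_semi) (le_lt_trans (ip_CS _ _))//.
have : `|x - y| < e / (`|h| + 1) by near: y; exact: cvgr_dist_lt.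
rewrite ltr_pdivlMr// => /(le_lt_trans _); apply.
by rewrite ler_wpM2l// lerDl.
Unshelve. all: by end_near. Qed.

Lemma sqr_lt_norm (V : normedModType R) (x : V) (e : R) :
  0 < e -> `|x| ^+ 2 < e ^+ 2 -> `|x| < e.
Proof. by move=> e0; rewrite ltr_sqr ?nnegrE ?(ltW e0). Qed.

Lemma ip_cauchy_cvg (u : nat -> H) :
  (forall e : R, 0 < e -> exists N, forall m n, (N <= m)%N -> (N <= n)%N ->
     ip (u m - u n) (u m - u n) < e) ->
  exists l : H, u @ \oo --> l.
Proof.
move=> hu.
suff : cvg (u @ \oo) by move=> h; exists (lim (u @ \oo)).
apply/cauchy_cvgP/cauchyP => e e0.
have [N hN] := hu (e ^+ 2) (exprn_gt0 _ e0).
exists (u N), N => // n /= Nn.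
rewrite -ball_normE /=.
by apply: sqr_lt_norm => //; rewrite -ip_sqr; exact: hN.
Qed.

Lemma riesz (f : H -> R) (C : R) :
  (forall x y, f (x + y) = f x + f y) ->
  (forall (c : R) x, f (c *: x) = c * f x) ->
  (forall x, `|f x| <= C * `|x|) ->
  exists y, forall x, f x = ip x y.
Proof.
move=> fD fZ fC.
have := @riesz_subspace R H ip sip setT I (fun _ _ _ _ => I) (fun _ _ _ => I).
have cpl (u : nat -> H) : (forall n, [set: H] (u n)) ->
  (forall e : R, 0 < e -> exists N, forall m n, (N <= m)%N -> (N <= n)%N ->
     ip (u m - u n) (u m - u n) < e) ->
  exists2 y, [set: H] y & forall e : R, 0 < e -> exists N, forall n, (N <= n)%N ->
     ip (u n - y) (u n - y) < e.
  move=> _ /ip_cauchy_cvg[l /cvg_seqP ul].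
  exists l => // e e0; have se0 : 0 < Num.sqrt e by rewrite sqrtr_gt0.
  have [N hN] := ul _ se0; exists N => n Nn; rewrite ip_sqr.
  by rewrite -[ltRHS]sqr_sqrtr ?(ltW e0)// ltr_sqr ?nnegrE ?(ltW se0)// hN.
move=> /(_ cpl f (C ^+ 2) (sqr_ge0 _)).
case=> [*|*|x _|y _ yP].
- exact: fD.
- exact: fZ.
- rewrite ip_sqr -exprMn -[f x ^+ 2]real_normK ?num_real//.
  rewrite ler_sqr ?nnegrE//; exact: le_trans (normr_ge0 _) (fC x).
- by exists y => x; rewrite yP// (sipC sip).
Qed.

Variables (DA : set H) (A : H -> H).
Hypothesis clA : closed_densely_defined DA A.

Definition dom_adjoint : set H := [set xi | exists eta, adjoint_pair ip DA A xi eta].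

Lemma dom_adjointD x y : dom_adjoint x -> dom_adjoint y -> dom_adjoint (x + y).
Proof.
by move=> [p px] [q qy]; exists (p + q) => z Dz; rewrite !(sipDr sip) px// qy.
Qed.

Lemma dom_adjointZ (c : R) x : dom_adjoint x -> dom_adjoint (c *: x).
Proof. by move=> [p px]; exists (c *: p) => z Dz; rewrite !(sipZr sip) px. Qed.

Let ip2 (x y : (H * H)%type) := ip x.1 y.1 + ip x.2 y.2.

Let ip2_semi : semi_inner_product ip2.
Proof.
split=> [x y|x y z|c x y|x]; rewrite /ip2 /=.
- by rewrite (sipC sip) (sipC sip x.2).
- by rewrite !(sipDl sip); ring.
- by rewrite !(sipZl sip); ring.
- by rewrite addr_ge0// (sip_ge0 sip).
Qed.

Let graph : set (H * H)%type := [set x | DA x.1 /\ x.2 = A x.1].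

(** Closedness makes the graph complete, so the functional sending [(q, A q)] to [ip v (A q)] is
    represented by some [(p, A p)]. Read backwards, the identity puts [v - A p] in the domain of the
    adjoint, with image [p]. *)
Let graph_projection v : exists2 p, DA p &
  forall q, DA q -> ip v (A q) = ip p q + ip (A p) (A q).
Proof.
have [[DA0 DAD] DAZ [AD AZ] Acl _] := clA.
pose C := `|v| ^+ 2.
have A0 : A 0 = 0 by rewrite -[X in A X](scale0r 0) AZ// scale0r.
have := @riesz_subspace R _ ip2 ip2_semi graph.
have g0 : graph 0 by split => //=; rewrite A0.
have gD x y : graph x -> graph y -> graph (x + y).
  by move=> [Dx xE] [Dy yE]; split => /=; [exact: DAD|rewrite AD// xE yE].
have gZ (c : R) x : graph x -> graph (c *: x).
  by move=> [Dx xE]; split => /=; [exact: DAZ|rewrite AZ// xE].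
move=> /(_ g0 gD gZ).
have gC : forall u : nat -> (H * H)%type, (forall n, graph (u n)) ->
  (forall e : R, 0 < e -> exists N, forall m n, (N <= m)%N -> (N <= n)%N ->
     ip2 (u m - u n) (u m - u n) < e) ->
  exists2 y, graph y & forall e : R, 0 < e -> exists N, forall n, (N <= n)%N ->
     ip2 (u n - y) (u n - y) < e.
  move=> u gu hu.
  have [x /[dup] ux /cvg_seqP ux'] : exists l : H, (fst \o u) @ \oo --> l.
    apply: ip_cauchy_cvg => e e0; have [N hN] := hu e e0.
    exists N => m n Nm Nn; apply: le_lt_trans (hN m n Nm Nn).
    by rewrite /ip2 lerDl (sip_ge0 sip).
  have [y /[dup] uy /cvg_seqP uy'] : exists l : H, (snd \o u) @ \oo --> l.
    apply: ip_cauchy_cvg => e e0; have [N hN] := hu e e0.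
    exists N => m n Nm Nn; apply: le_lt_trans (hN m n Nm Nn).
    by rewrite /ip2 lerDr (sip_ge0 sip).
  have [Dx xE] : DA x /\ A x = y.
    apply: (Acl (fst \o u)) => //; first by move=> n; exact: (gu n).1.
    rewrite (_ : A \o (fst \o u) = snd \o u)//.
    by apply/funext => n /=; rewrite (gu n).2.
  exists (x, y) => // e e0.
  have se0 : 0 < Num.sqrt (e / 2) by rewrite sqrtr_gt0 divr_gt0.
  have [N1 hN1] := ux' _ se0; have [N2 hN2] := uy' _ se0.
  have h (z : H) : `|z| < Num.sqrt (e / 2) -> ip z z < e / 2.
    move=> hz; rewrite ip_sqr -[ltRHS]sqr_sqrtr ?divr_ge0 ?(ltW e0)//.
    by rewrite ltr_sqr ?nnegrE ?(ltW se0).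
  exists (maxn N1 N2) => n; rewrite geq_max => /andP[n1 n2].
  by rewrite /ip2 [e]splitr ltrD// h//; [exact: hN1|exact: hN2].
move=> /(_ gC (fun x => ip v x.2) C (sqr_ge0 _)).
case=> [x y _ _|c x _|x _|[p p'] [/= Dp ->] pP].
- by rewrite (sipDr sip).
- by rewrite (sipZr sip).
- rewrite (le_trans (sip_CS sip _ _))// /C ip_sqr ler_wpM2l ?sqr_ge0//.
  by rewrite /ip2 lerDr (sip_ge0 sip).
- by exists p => // q Dq; rewrite (pP (q, A q)).
Qed.

(* Von Neumann: a vector orthogonal to [dom_adjoint] sits in the graph of [A]
   over [0]. *)
Lemma dom_adjoint_dense x (e : R) : 0 < e -> exists2 xi, dom_adjoint xi & `|x - xi| < e.
Proof.
move=> e_gt0; have [[DA0 DAD] DAZ [AD AZ] Acl _] := clA.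
pose Dc : set H := [set x | forall e : R, 0 < e ->
  exists2 xi, dom_adjoint xi & `|x - xi| < e].
have DDc y : dom_adjoint y -> Dc y.
  by move=> Dy d d0; exists y => //; rewrite subrr normr0.
have Dc0 : Dc 0.
  by apply: DDc; exists 0 => z Dz; rewrite !(sip0r sip).
have DcD y z : Dc y -> Dc z -> Dc (y + z).
  move=> Dy Dz d d0; have d2 : 0 < d / 2 by rewrite divr_gt0.
  have [p Dp hp] := Dy _ d2; have [q Dq hq] := Dz _ d2.
  exists (p + q); first exact: dom_adjointD.
  rewrite opprD addrACA (le_lt_trans (ler_normD _ _))// [ltRHS]splitr.
  exact: ltrD.
have DcZ (c : R) y : Dc y -> Dc (c *: y).
  move=> Dy d d0; have d2 : 0 < d / (`|c| + 1) by rewrite divr_gt0// ltr_wpDl.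
  have [p Dp hp] := Dy _ d2.
  exists (c *: p); first exact: dom_adjointZ.
  rewrite -scalerBr normrZ.
  move: hp; rewrite ltr_pdivlMr ?ltr_wpDl// mulrC; apply: le_lt_trans.
  by rewrite ler_wpM2r// lerDl.
have := @riesz_subspace R H ip sip Dc Dc0 DcD DcZ.
have Dcc : forall u : nat -> H, (forall n, Dc (u n)) ->
  (forall e : R, 0 < e -> exists N, forall m n, (N <= m)%N -> (N <= n)%N ->
     ip (u m - u n) (u m - u n) < e) ->
  exists2 y, Dc y & forall e : R, 0 < e -> exists N, forall n, (N <= n)%N ->
     ip (u n - y) (u n - y) < e.
  move=> u Du /ip_cauchy_cvg[l /cvg_seqP ul]; exists l.
    move=> d d0; have d2 : 0 < d / 2 by rewrite divr_gt0.
    have [N hN] := ul _ d2; have [p Dp hp] := Du N _ d2.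
    exists p => //; rewrite -(subrKA (u N)) (le_lt_trans (ler_normD _ _))//.
    by rewrite [ltRHS]splitr ltrD// distrC hN.
  move=> d d0; have sd0 : 0 < Num.sqrt d by rewrite sqrtr_gt0.
  have [N hN] := ul _ sd0; exists N => n Nn; rewrite ip_sqr.
  by rewrite -[ltRHS]sqr_sqrtr ?(ltW d0)// ltr_sqr ?nnegrE ?(ltW sd0)// hN.
move=> /(_ Dcc (ip x) (`|x| ^+ 2) (sqr_ge0 _)).
case=> [y z _ _|c y _|y _|y Dcy yP].
- by rewrite (sipDr sip).
- by rewrite (sipZr sip).
- by rewrite -ip_sqr (sip_CS sip).
pose v := x - y.
have vD g : dom_adjoint g -> ip v g = 0.
  by move=> /DDc Dg; rewrite (sipBl sip) yP// subrr.
have [p Dp pP] := graph_projection v.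
have Dvp : dom_adjoint (v - A p).
  exists p => q Dq; rewrite (sipC sip) (sipBl sip) pP// (sipC sip q); ring.
(* A square equals minus a square, so both vanish: [p = 0], and then [v = A p = 0], that is, [x]
   lies in the closure [Dc]. *)
have h1 : ip (v - A p) (v - A p) = - ip p p.
  by rewrite [LHS](sipBl sip) vD// (sipBr sip) (sipC sip (A p) v) pP//; ring.
have pp : ip p p = 0.
  by apply/eqP; rewrite eq_le (sip_ge0 sip) andbT -oppr_ge0 -h1 (sip_ge0 sip).
have p0 := ip_nondeg pp.
have A0 : A 0 = 0 by rewrite -[X in A X](scale0r 0) AZ// scale0r.
move: h1; rewrite p0 A0 subr0 (sip0l sip) oppr0 => /ip_nondeg /eqP.
by rewrite subr_eq0 => /eqP ->; exact: Dcy.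
Qed.

End hilbert.

(** * Orthonormal expansion along vectors of a dense subspace *)

Section gram_schmidt.
Variables (R : realType) (H : completeNormedModType R) (ip : H -> H -> R).
Hypothesis ipP : is_inner_product ip.
Let sip := ip_semi ipP.

Section projections.
Variable u : nat -> H.

(** The direction [e] is inlined to keep the recursion on [n] alone. A vector that depends on its
    predecessors gives [v = 0] and hence a zero direction, so no independent subfamily has to be
    extracted. *)
Fixpoint gs_proj (n : nat) (x : H) : H :=
  if n is m.+1 then
    let v := u m - gs_proj m (u m) in let e := `|v|^-1 *: v in
    gs_proj m x + ip x e *: e
  else 0.

Definition gs_vec (n : nat) : H :=
  let v := u n - gs_proj n (u n) in `|v|^-1 *: v.

Lemma gs_projS n x : gs_proj n.+1 x = gs_proj n x + ip x (gs_vec n) *: gs_vec n.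
Proof. by []. Qed.

Lemma gs_projE n x : gs_proj n x = \sum_(i < n) ip x (gs_vec i) *: gs_vec i.
Proof. by elim: n => [|n IH]; rewrite ?big_ord0// big_ord_recr gs_projS IH. Qed.

Let projD n x y : gs_proj n (x + y) = gs_proj n x + gs_proj n y.
Proof.
rewrite !gs_projE -big_split; apply: eq_bigr => i _.
by rewrite (sipDl sip) scalerDl.
Qed.

Let projB n x y : gs_proj n (x - y) = gs_proj n x - gs_proj n y.
Proof.
rewrite !gs_projE -sumrB; apply: eq_bigr => i _.
by rewrite (sipBl sip) scalerBl.
Qed.

Let projZ n (c : R) x : gs_proj n (c *: x) = c *: gs_proj n x.
Proof.
rewrite !gs_projE scaler_sumr; apply: eq_bigr => i _.
by rewrite (sipZl sip) scalerA.
Qed.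

Let proj_sym n x y : ip (gs_proj n x) y = ip x (gs_proj n y).
Proof.
rewrite !gs_projE (sip_suml sip) (sip_sumr sip); apply: eq_bigr => i _.
rewrite (sipZl sip _ (gs_vec i)) (sipZr sip _ x (gs_vec i)) (sipC sip (gs_vec i) y); ring.
Qed.

(** Stands in for normalisation, because it also holds for the zero directions. *)
Let vec_idem n : ip (gs_vec n) (gs_vec n) *: gs_vec n = gs_vec n.
Proof.
rewrite /gs_vec; set v := u n - _; rewrite (sipZl sip) (sipZr sip) ip_sqr//.
have [->|v0] := eqVneq v 0; first by rewrite !scaler0.
by rewrite mulrA -expr2 -exprMn mulVf ?normr_eq0// expr1n scale1r.
Qed.

Let proj_idem n x : gs_proj n (gs_proj n x) = gs_proj n x.
Proof.
elim: n x => [//|n IH] x.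
have vec0 : gs_proj n (gs_vec n) = 0.
  by rewrite /gs_vec projZ projB IH subrr scaler0.
rewrite [gs_proj n.+1 x]gs_projS gs_projS projD IH projZ vec0 scaler0 addr0.
by rewrite (sipDl sip) proj_sym vec0 (sip0r sip) add0r (sipZl sip) -scalerA vec_idem.
Qed.

Let proj_vec n : gs_proj n (gs_vec n) = 0.
Proof. by rewrite /gs_vec projZ projB proj_idem subrr scaler0. Qed.

Let pythagoras n x : `|x| ^+ 2 = `|gs_proj n x| ^+ 2 + `|x - gs_proj n x| ^+ 2.
Proof.
rewrite -!(ip_sqr ipP).
have := sip_sqrD sip (gs_proj n x) (x - gs_proj n x); rewrite subrKC => ->.
rewrite [ip _ (x - gs_proj n x)]proj_sym projB proj_idem subrr (sip0r sip).
by rewrite mulr0 addr0.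
Qed.

Lemma gs_proj_contract n x : `|gs_proj n x| <= `|x|.
Proof. by rewrite -ler_sqr ?nnegrE// (pythagoras n x) lerDl sqr_ge0. Qed.

Lemma gs_coproj_contract n x : `|x - gs_proj n x| <= `|x|.
Proof. by rewrite -ler_sqr ?nnegrE// (pythagoras n x) lerDr sqr_ge0. Qed.

Let proj_fix m n : (m < n)%N -> gs_proj n (u m) = u m.
Proof.
elim: n => // n IH; rewrite ltnS leq_eqVlt => /predU1P[->|/IH mn].
  rewrite gs_projS; set v := u n - gs_proj n (u n).
  have -> : ip (u n) (gs_vec n) = ip v (gs_vec n).
    by rewrite /v (sipBl sip) proj_sym proj_vec (sip0r sip) subr0.
  rewrite /gs_vec -/v (sipZr sip) ip_sqr// scalerA.
  have [v0|v0] := eqVneq v 0.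
    by move/eqP: (v0); rewrite subr_eq0 => /eqP <-; rewrite v0 scaler0 addr0.
  rewrite (_ : _ * _ * _ = 1) ?scale1r ?subrKC//.
  by rewrite mulrAC -expr2 -exprMn mulVf ?normr_eq0// expr1n.
by rewrite gs_projS -{2}mn proj_sym proj_vec (sip0r sip) scale0r addr0.
Qed.

(** Projections of index above [m] fix [u m], so [x] and [x - u m] have the same remainder, and
    remainders are contractions. No series has to be summed. *)
Lemma gs_proj_cvg x (e : R) : 0 < e ->
  (forall y (d : R), 0 < d -> exists m, `|y - u m| < d) ->
  exists N, forall n, (N <= n)%N -> `|x - gs_proj n x| < e.
Proof.
move=> e0 /(_ x e e0)[m hm]; exists m.+1 => n mn.
rewrite (_ : x - gs_proj n x = (x - u m) - gs_proj n (x - u m)).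
  exact: le_lt_trans (gs_coproj_contract _ _) hm.
by rewrite projB proj_fix// opprB addrA subrK.
Qed.

Lemma gs_vec_sub (D : set H) n : (forall k, D (u k)) -> D 0 ->
  (forall x y, D x -> D y -> D (x + y)) ->
  (forall (c : R) x, D x -> D (c *: x)) -> D (gs_vec n).
Proof.
move=> Du D0 DD DZ; rewrite /gs_vec; apply: (DZ); apply: (DD) => //.
rewrite -scaleN1r; apply: (DZ).
suff h x : D (gs_proj n x) by [].
elim: n x => //= n IH x; apply: (DD) => //; apply: (DZ); apply: (DZ).
by apply: (DD) => //; rewrite -scaleN1r; exact: DZ.
Qed.

End projections.

Definition coproj (e : nat -> H) (n : nat) (x : H) : H :=
  x - \sum_(i < n) ip x (e i) *: e i.

(** An orthonormal basis seen only through its partial sums and remainders, a form insensitive to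
    the zero vectors that Gram-Schmidt may leave. *)
Definition basis_in (D : set H) (e : nat -> H) : Prop :=
  [/\ forall n, D (e n),
      forall n x, `|x - coproj e n x| <= `|x|,
      forall n x, `|coproj e n x| <= `|x| &
      forall x (d : R), 0 < d -> exists N, forall n, (N <= n)%N ->
        `|coproj e n x| < d].

Lemma basis_in_exists (D : set H) : separable_space H -> D 0 ->
  (forall x y, D x -> D y -> D (x + y)) ->
  (forall (c : R) x, D x -> D (c *: x)) ->
  (forall x (d : R), 0 < d -> exists2 y, D y & `|x - y| < d) ->
  exists e, basis_in D e.
Proof.
move=> [v vP] D0 DD DZ Ddense.
have /choice[w wP] : forall nk : nat * nat, exists y,
    D y /\ `|v nk.1 - y| < nk.2.+1%:R^-1.
  move=> [n k]; have /(Ddense (v n))[y ? ?] : 0 < k.+1%:R^-1 :> R by [].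
  by exists y.
(* [pickle] enumerates the pairs [(n, k)]; [odflt] fills in at the numbers that code no pair. *)
pose u n := w (odflt (0, 0)%N (unpickle n)).
have Du n : D (u n) by exact: (wP _).1.
have uP y (d : R) : 0 < d -> exists m, `|y - u m| < d.
  move=> d0; have d2 : 0 < d / 2 by rewrite divr_gt0.
  have [n hn] := vP y _ d2.
  have [k hk] : exists k : nat, k.+1%:R^-1 < d / 2.
    exists (Num.truncn (d / 2)^-1).
    by rewrite -[ltRHS]invrK ltf_pV2 ?posrE ?invr_gt0// truncnS_gt.
  exists (pickle (n, k)); rewrite /u pickleK /=.
  rewrite -(subrKA (v n)) (le_lt_trans (ler_normD _ _))// [ltRHS]splitr ltrD//.
  exact: lt_trans (wP (n, k)).2 hk.
exists (gs_vec u); split => [n|n x|n x|x d d0].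
- exact: gs_vec_sub.
- by rewrite /coproj -gs_projE subKr gs_proj_contract.
- by rewrite /coproj -gs_projE gs_coproj_contract.
- have [N hN] := gs_proj_cvg x d0 uP.
  by exists N => n /hN; rewrite /coproj -gs_projE.
Qed.

Lemma coprojD e n x y : coproj e n (x + y) = coproj e n x + coproj e n y.
Proof.
rewrite /coproj addrACA -opprD -big_split; congr (_ - _).
by apply: eq_bigr => i _; rewrite (sipDl sip) scalerDl.
Qed.

Lemma coprojZ e n (c : R) x : coproj e n (c *: x) = c *: coproj e n x.
Proof.
rewrite /coproj scalerBr scaler_sumr; congr (_ - _).
by apply: eq_bigr => i _; rewrite (sipZl sip) scalerA.
Qed.

End gram_schmidt.

(** * Random walks with finitely many step values *)

Section finite_expectation.
Variables (R : realType) (K : finType).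
Implicit Types (q : K -> R) (p : seq (K -> R)) (f g : seq K -> R).

Definition is_law q : Prop := (forall k, 0 <= q k) /\ \sum_k q k = 1.

(* The entries of the sequence are independent [K]-valued variables with laws [p]. *)
Fixpoint EX p f : R :=
  if p is q :: p' then \sum_k q k * EX p' (fun s => f (k :: s)) else f [::].

Lemma EX_le p f g : (forall q, List.In q p -> is_law q) ->
  (forall s, f s <= g s) -> EX p f <= EX p g.
Proof.
elim: p f g => [|q p IH] f g /= lp fg; first exact: fg.
apply: ler_sum => k _; apply: ler_wpM2l; first exact: (lp q (or_introl erefl)).1.
by apply: IH => [q' hq'|s]; [apply: lp; right|exact: fg].
Qed.

Lemma EX_cst p (c : R) : (forall q, List.In q p -> is_law q) ->
  EX p (fun=> c) = c.
Proof.
elim: p => [//|q p IH] /= lp; rewrite -mulr_suml (lp q (or_introl erefl)).2.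
by rewrite mul1r IH// => q' hq'; apply: lp; right.
Qed.

Lemma EXZ p (c : R) f : EX p (fun s => c * f s) = c * EX p f.
Proof.
elim: p f => [//|q p IH] f /=; rewrite mulr_sumr; apply: eq_bigr => k _.
by rewrite IH; ring.
Qed.

Lemma eq_EX p f g : f =1 g -> EX p f = EX p g.
Proof.
elim: p f g => [|q p IH] f g fg /=; first exact: fg.
by apply: eq_bigr => k _; rewrite (IH _ (fun s => g (k :: s))).
Qed.

Variables (V : lmodType R) (ip : V -> V -> R).
Hypothesis sip : semi_inner_product ip.

Definition mean (l : (K -> R) * (K -> V)) : V := \sum_k l.1 k *: l.2 k.
Definition msq (l : (K -> R) * (K -> V)) : R := \sum_k l.1 k * ip (l.2 k) (l.2 k).

Fixpoint rsum (c : seq (K -> V)) (s : seq K) : V :=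
  match c, s with v :: c', k :: s' => v k + rsum c' s' | _, _ => 0 end.

(** The deviation from the mean averages to zero, so the cross term disappears and the variance is
    what is added. *)
Lemma mean_sqrE (l : (K -> R) * (K -> V)) y : is_law l.1 ->
  \sum_k l.1 k * ip (y + l.2 k) (y + l.2 k) =
  ip (y + mean l) (y + mean l) + (msq l - ip (mean l) (mean l)).
Proof.
move=> [_ l1]; rewrite (sip_sqrD sip) /msq.
have -> : ip y (mean l) = \sum_k l.1 k * ip y (l.2 k).
  by rewrite (sip_sumr sip); apply: eq_bigr => k _; rewrite (sipZr sip).
have yE : ip y y = \sum_k l.1 k * ip y y by rewrite -mulr_suml l1 mul1r.
rewrite [in RHS]yE mulr_sumr.
transitivity (\sum_k l.1 k * ip y y + \sum_k 2 * (l.1 k * ip y (l.2 k)) +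
  \sum_k l.1 k * ip (l.2 k) (l.2 k)); last by ring.
rewrite -!big_split /=; apply: eq_bigr => k _; rewrite (sip_sqrD sip); ring.
Qed.

Lemma mean_sqr_le_msq l : is_law l.1 -> ip (mean l) (mean l) <= msq l.
Proof.
move=> ll; have := mean_sqrE (- mean l) ll.
rewrite addNr (sip0l sip) add0r => h; rewrite -subr_ge0 -h.
by apply: sumr_ge0 => k _; rewrite mulr_ge0 ?(sip_ge0 sip) ?ll.1.
Qed.

(** Independence is the nesting of the sums in [EX]: means add inside the square and variances add
    outside. The offset [y] carries the steps already drawn through the induction. *)
Lemma EX_sqr (L : seq ((K -> R) * (K -> V))) y :
  (forall l, List.In l L -> is_law l.1) ->
  EX (map fst L) (fun s => ip (y + rsum (map snd L) s) (y + rsum (map snd L) s)) =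
  ip (y + \sum_(l <- L) mean l) (y + \sum_(l <- L) mean l) +
  \sum_(l <- L) (msq l - ip (mean l) (mean l)).
Proof.
elim: L y => [|l L IH] y lL /=; first by rewrite !big_nil !addr0.
have ll : is_law l.1 by apply: lL; left.
have lL' l' : List.In l' L -> is_law l'.1 by move=> ?; apply: lL; right.
pose S := \sum_(l' <- L) mean l'.
pose W := \sum_(l' <- L) (msq l' - ip (mean l') (mean l')).
transitivity (\sum_k (l.1 k * ip (y + S + l.2 k) (y + S + l.2 k) + l.1 k * W)).
  apply: eq_bigr => k _; rewrite -mulrDr [y + S + _]addrAC -IH//; congr (_ * _).
  by apply: eq_EX => s; rewrite addrA.
rewrite big_split /= -mulr_suml ll.2 mul1r mean_sqrE// !big_cons -/S -/W.
by rewrite -[y + S + _]addrA [S + _]addrC !addrA.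
Qed.

Variables (q : K -> R) (v : K -> V) (b ell : R).
Hypothesis lq : is_law q.
Hypothesis b0 : 0 <= b.
Hypothesis ell0 : 0 <= ell.
Hypothesis vb : forall k, ip (v k) (v k) <= b ^+ 2.

Fixpoint exitb (y : V) (s : seq K) : bool :=
  if s is k :: s' then
    (ell ^+ 2 < ip (y + v k) (y + v k)) || exitb (y + v k) s'
  else false.

Definition exitp n y : R := EX (nseq n q) (fun s => (exitb y s)%:R).

Let in_nseq n q' : List.In q' (nseq n q) -> is_law q'.
Proof. by elim: n => //= n IH [<-|/IH]. Qed.

Let exitpS n y : exitp n.+1 y =
  \sum_k q k * (if ell ^+ 2 < ip (y + v k) (y + v k) then 1 else exitp n (y + v k)).
Proof.
rewrite /exitp /=; apply: eq_bigr => k _; congr (_ * _).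
case: ifPn => // h; by rewrite EX_cst//; exact: in_nseq.
Qed.

Let m := mean (q, v).
Let sg := msq (q, v).
(** Closed form of the second moment of [y] plus [n] independent copies of the step; [e2S] is
    conditioning on the first of them. *)
Let e2 n y : R := ip (y + m *+ n) (y + m *+ n) + n%:R * (sg - ip m m).

Let e2S n y : e2 n.+1 y = \sum_k q k * e2 n (y + v k).
Proof.
rewrite /e2; under eq_bigr do rewrite mulrDr.
rewrite big_split /= -mulr_suml lq.2 mul1r.
under eq_bigr do rewrite addrAC.
rewrite (mean_sqrE (l := (q, v)))// -/m -/sg mulrS addrA [y + m + _]addrAC -natr1.
ring.
Qed.

Let var_ge0 : 0 <= sg - ip m m.
Proof. by rewrite subr_ge0; exact: (mean_sqr_le_msq (l := (q, v))). Qed.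

Let e2E n : e2 n 0 = n%:R ^+ 2 * ip m m + n%:R * (sg - ip m m).
Proof. by rewrite /e2 !add0r -(scaler_nat n m) (sipZl sip) (sipZr sip) mulrA. Qed.

Let e2_mono n N : (n <= N)%N -> e2 n 0 <= e2 N 0.
Proof.
move=> nN; rewrite !e2E.
have nN' : n%:R <= N%:R :> R by rewrite ler_nat.
apply: lerD; last exact: ler_wpM2r.
by rewrite ler_wpM2r ?(sip_ge0 sip)// ler_sqr ?nnegrE ?ler0n.
Qed.

Let e2_shift n y : e2 n y <= 2 * ip y y + 2 * e2 n 0.
Proof.
rewrite /e2 add0r (sip_sqrD sip).
have := sip_ge0 sip (y - m *+ n).
rewrite (sip_sqrD sip) (sipNr sip) (sipNl sip) (sipNr sip).
have := mulr_ge0 (ler0n R n) var_ge0; lra.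
Qed.

Let exit_bound N n y : (n <= N)%N -> ip y y <= ell ^+ 2 ->
  e2 n y <= ell ^+ 2 + exitp n y * (2 * (ell + b) ^+ 2 + 2 * e2 N 0).
Proof.
have e2N : 0 <= e2 N 0.
  by rewrite /e2 add0r addr_ge0 ?(sip_ge0 sip)// mulr_ge0.
have D0 : 0 <= 2 * (ell + b) ^+ 2 + 2 * e2 N 0.
  by have := sqr_ge0 (ell + b); lra.
elim: n y => [|n IH] y nN yl.
  by rewrite /e2 /exitp /= mulr0n addr0 !mul0r !addr0.
rewrite e2S exitpS mulr_suml.
set T := fun k => if ell ^+ 2 < ip (y + v k) (y + v k) then 1 else exitp n (y + v k).
set C := 2 * _ + _.
have -> : ell ^+ 2 + \sum_k q k * T k * C = \sum_k (q k * ell ^+ 2 + q k * T k * C).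
  by rewrite [RHS]big_split; congr (_ + _); rewrite -mulr_suml lq.2 mul1r.
apply: ler_sum => k _; rewrite -mulrA -mulrDr ler_wpM2l ?lq.1// /T /C.
case: ifPn => [h|]; last by rewrite -leNgt => h; exact: IH (ltnW nN) h.
have yv : ip (y + v k) (y + v k) <= (ell + b) ^+ 2.
  rewrite (sip_sqrD sip).
  have h2 : ip y (v k) <= ell * b.
    rewrite (le_trans (ler_norm _))// -ler_sqr ?nnegrE ?mulr_ge0//.
    rewrite real_normK ?num_real// exprMn (le_trans (sip_CS sip _ _))//.
    by rewrite ler_pM ?(sip_ge0 sip).
  by have := vb k; lra.
have := e2_shift n (y + v k); have := e2_mono (ltnW nN); have := sqr_ge0 ell.
by move: (e2 n 0) (e2 n (y + v k)) (e2 N 0) yv => *; lra.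
Qed.

(* Stop the walk when it leaves the ball of radius [ell]. *)
Lemma walk_second_moment n : exitp n 0 <= 4^-1 ->
  n%:R ^+ 2 * ip m m <= 2 * ell ^+ 2 + (ell + b) ^+ 2 /\
  n%:R * sg <= 2 * ell ^+ 2 + (ell + b) ^+ 2.
Proof.
move=> hex.
have h0 : ip 0 0 <= ell ^+ 2 by rewrite (sip0l sip) sqr_ge0.
have := exit_bound (leqnn n) h0.
have e2N : 0 <= e2 n 0.
  by rewrite /e2 add0r addr_ge0 ?(sip_ge0 sip)// mulr_ge0.
set C := 2 * (ell + b) ^+ 2 + 2 * e2 n 0 => h1.
have C0 : 0 <= C by have := sqr_ge0 (ell + b); rewrite /C; lra.
(* With exit probability at most [4^-1] the term containing [2 * e2 n 0] costs at most half of
   [e2 n 0], which the left-hand side absorbs. *)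
have h2 : exitp n 0 * C <= 4^-1 * C by rewrite ler_wpM2r.
have h3 : e2 n 0 <= 2 * ell ^+ 2 + (ell + b) ^+ 2.
  by move: h1 h2; rewrite /C; lra.
have mm := sip_ge0 sip m.
have nv := mulr_ge0 (ler0n R n) var_ge0.
have nn : n%:R * ip m m <= n%:R ^+ 2 * ip m m.
  rewrite ler_wpM2r// -natrX ler_nat; case: (n) => // n'.
  by rewrite expnS expn1 leq_pmulr.
by split; move: h3; rewrite e2E; lra.
Qed.

End finite_expectation.

(** * Real-valued probabilities and the law of a discretised independent sequence *)

Section real_probability.
Context (R : realType) d (Omega : measurableType d) (P : probability Omega R).

Definition pr (S : set Omega) : R := fine (P S).

Lemma prE S : measurable S -> P S = (pr S)%:E.
Proof. by move=> mS; rewrite /pr fineK// fin_num_measure. Qed.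

Lemma pr_ge0 S : 0 <= pr S.
Proof. by rewrite /pr fine_ge0. Qed.

Lemma le_pr S S' : measurable S -> measurable S' -> S `<=` S' -> pr S <= pr S'.
Proof.
by move=> mS mS' SS'; rewrite -lee_fin -!prE//; apply: le_measure; rewrite ?inE.
Qed.

Lemma prT : pr setT = 1.
Proof. by rewrite /pr probability_setT. Qed.

Lemma pr0 : pr set0 = 0.
Proof. by rewrite /pr measure0. Qed.

Lemma prU S S' : measurable S -> measurable S' -> pr (S `|` S') <= pr S + pr S'.
Proof.
move=> mS mS'; rewrite -lee_fin EFinD -!prE//; last exact: measurableU.
exact: measureU2.
Qed.

Lemma pr_split (K : finType) (kap : Omega -> K) S : measurable S ->
  (forall k, measurable [set w | kap w = k]) ->
  pr S = \sum_k pr (S `&` [set w | kap w = k]).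
Proof.
move=> mS mk.
have SE : S = \bigcup_(k in [set` index_enum K]) (S `&` [set w | kap w = k]).
  apply/seteqP; split => [w Sw|w [k _ []]//].
  by exists (kap w) => //=; rewrite mem_index_enum.
apply: EFin_inj; rewrite -prE// [in LHS]SE measure_fin_bigcup//.
- rewrite -fsbig_seq ?index_enum_uniq// -sumEFin.
  by apply: eq_bigr => k _; apply: prE; exact: measurableI.
- move=> i j _ _ [w [[_ <-] [_ <-]]] //.
- by move=> k _; exact: measurableI.
Qed.

Lemma pr_bigcup_le (S : nat -> set Omega) n : (forall i, measurable (S i)) ->
  pr (\bigcup_(i in [set i | (i < n)%N]) S i) <= \sum_(i < n) pr (S i).
Proof.
move=> mS; elim: n => [|n IH].
  by rewrite big_ord0 (_ : \bigcup_(_ in _) _ = set0) ?pr0// -subset0 => w [].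
rewrite big_ord_recr /= (_ : \bigcup_(_ in _) _ =
  (\bigcup_(i in [set i | (i < n)%N]) S i) `|` S n); last first.
  apply/seteqP; split => [w [i /= + Si]|w [[i /= ii Si]|Sn]].
  - by rewrite ltnS leq_eqVlt => /predU1P[<-|ii]; [right|left; exists i].
  - by exists i => //=; rewrite ltnS ltnW.
  - by exists n => /=.
have mB : measurable (\bigcup_(i in [set i | (i < n)%N]) S i).
  exact: bigcup_measurable.
by rewrite (le_trans (prU mB (mS n)))// lerD2r.
Qed.

Variables (H : normedModType R).

Definition independent_seq (n : nat) (xi : nat -> Omega -> H) : Prop :=
  forall m (B : nat -> set H), (m <= n)%N -> (forall i, (i < m)%N -> borelH (B i)) ->
  pr (\bigcap_(i in [set i | (i < m)%N]) [set w | B i (xi i w)]) =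
  \prod_(i < m) pr [set w | B i (xi i w)].

Section transfer.
Variables (n : nat) (xi : nat -> Omega -> H) (K : finType) (kap : H -> K).
Hypothesis xi_meas : forall i, (i < n)%N -> H_measurable (xi i).
Hypothesis xi_ind : independent_seq n xi.
Hypothesis kap_meas : forall k, borelH [set x | kap x = k].

Definition cell_law (i : nat) (k : K) : R := pr [set w | kap (xi i w) = k].

Let cell_meas i k : (i < n)%N -> measurable [set w | kap (xi i w) = k].
Proof. by move=> ni; exact: (xi_meas ni (kap_meas k)). Qed.

Lemma event_meas i m (f : seq K -> bool) : (i + m <= n)%N ->
  measurable [set w | f [seq kap (xi j w) | j <- iota i m]].
Proof.
elim: m i f => [|m IH] i f inm /=.
  case: (f [::]); first by rewrite (_ : [set _ | _] = setT)// -subTset.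
  by rewrite (_ : [set _ | _] = set0)// -subset0.
have iN : (i < n)%N by rewrite (leq_trans _ inm)// addnS ltnS leq_addr.
rewrite (_ : [set _ | _] = \bigcup_(k in [set: K]) ([set w | kap (xi i w) = k] `&`
   [set w | f (k :: [seq kap (xi j w) | j <- iota i.+1 m])])); last first.
  by apply/seteqP; split => [w fw|w [k _ [<-]]//]; exists (kap (xi i w)).
apply: fin_bigcup_measurable; first exact: finite_finset.
move=> k _; apply: measurableI; first exact: cell_meas.
by apply: (IH i.+1 (fun s => f (k :: s))); rewrite addSnnS.
Qed.

(** Letters are moved one at a time from the word into the Borel conditions: fixing letter [i] to be
    [k] is the condition that [xi i] lies in the cell of [k]. When no letter is left, the product
    formula of [xi_ind] applies. *)
Let claim m i (B : nat -> set H) (f : seq K -> bool) : (i + m = n)%N ->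
  (forall j, (j < i)%N -> borelH (B j)) ->
  pr ((\bigcap_(j in [set j | (j < i)%N]) [set w | B j (xi j w)]) `&`
     [set w | f [seq kap (xi j w) | j <- iota i m]]) =
  (\prod_(j < i) pr [set w | B j (xi j w)]) *
  EX [seq cell_law j | j <- iota i m] (fun s => (f s)%:R).
Proof.
elim: m i B f => [|m IH] i B f inm bB /=.
  rewrite addn0 in inm.
  case: (f [::]).
    have -> : [set _ : Omega | true] = setT by rewrite -subTset.
    by rewrite setIT mulr1; apply: xi_ind => //; rewrite inm.
  have -> : [set _ : Omega | false] = set0 by rewrite -subset0.
  by rewrite setI0 pr0 mulr0.
have iN : (i < n)%N by rewrite -inm addnS ltnS leq_addr.
rewrite (@pr_split K (fun w => kap (xi i w))); first last.
- by move=> k; exact: cell_meas.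
- apply: measurableI.
    apply: bigcap_measurableType => // j /= ji.
    by apply: (xi_meas _ (bB _ ji)); exact: ltn_trans ji iN.
  by apply: (@event_meas i m.+1); rewrite inm.
rewrite mulr_sumr; apply: eq_bigr => k _.
pose B' j := if j == i then [set x | kap x = k] else B j.
have B'j j : (j < i)%N -> B' j = B j by move=> ji; rewrite /B' ltn_eqF.
have := IH i.+1 B' (fun s => f (k :: s)).
have bB' j : (j < i.+1)%N -> borelH (B' j).
  rewrite ltnS leq_eqVlt => /predU1P[->|ji]; first by rewrite /B' eqxx.
  by rewrite B'j//; exact: bB.
rewrite addSnnS => /(_ inm bB').
rewrite big_ord_recr /= (_ : B' i = [set x | kap x = k]); last by rewrite /B' eqxx.
rewrite (_ : \prod_(j < i) pr [set w | B' j (xi j w)] =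
             \prod_(j < i) pr [set w | B j (xi j w)]); last first.
  by apply: eq_bigr => j _; rewrite B'j.
rewrite -mulrA => <-; congr pr; apply/seteqP; split => [w [[h1 h2] /= h3]|w [h1 h2]].
  split; last by rewrite /= -h3.
  move=> j /=; rewrite ltnS leq_eqVlt => /predU1P[->|ji]; first by rewrite /B' eqxx.
  by rewrite B'j//; exact: h1.
have h3 : kap (xi i w) = k by have := h1 i (ltnSn i); rewrite /= /B' eqxx.
split => //; split; last by rewrite /= h3.
by move=> j /= ji; have := h1 j (ltnW ji); rewrite /= B'j.
Qed.

Lemma pr_EX (f : seq K -> bool) :
  pr [set w | f [seq kap (xi j w) | j <- iota 0 n]] =
  EX [seq cell_law j | j <- iota 0 n] (fun s => (f s)%:R).
Proof.
have := @claim n 0 (fun=> setT) f (add0n n).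
rewrite big_ord0 mul1r (_ : \bigcap_(_ in _) _ = setT) ?setTI; last first.
  by rewrite -subTset.
by apply.
Qed.

End transfer.
End real_probability.

(** * Cadlag paths and weak measurability *)

Section cadlag.
Variables (R : realType).

(** Compactness of the interval by a supremum argument: the good neighbourhood of the supremum of
    the endpoints reached so far pushes the endpoint further, unless it already covers [t]. *)
Lemma cover_itv (t : R) (Pr : set R -> Prop) : 0 <= t ->
  (forall A B, A `<=` B -> Pr B -> Pr A) ->
  (forall A B, Pr A -> Pr B -> Pr (A `|` B)) ->
  (forall tau : R, 0 <= tau <= t -> exists2 del : R, 0 < del &
     Pr [set s | tau - del < s < tau + del /\ 0 <= s <= t]) ->
  Pr [set s | 0 <= s <= t].
Proof.
move=> t0 mono un loc.
pose S := [set s | 0 <= s <= t /\ Pr [set r | 0 <= r <= s]].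
have S0 : S 0.
  split; first by rewrite lexx.
  have [|del del0] := loc 0; first by rewrite lexx.
  by apply: mono => s /= hs; split; lra.
have hS : has_sup S by split; [exists 0|exists t => s [/andP[]]].
set sg := sup S.
have sg0 : 0 <= sg by apply: sup_upper_bound.
have sgt : sg <= t by apply: sup_le_ub; [exists 0|move=> s [/andP[]]].
have [|del del0 Pdel] := loc sg; first by rewrite sg0.
have [s Ss sgs] := sup_adherent del0 hS; rewrite -/sg in sgs.
have key r : r < sg + del -> r <= t -> Pr [set x | 0 <= x <= r].
  move=> r1 r2; apply: mono (un _ _ Ss.2 Pdel) => x /= hx.
  by have [xs|xs] := leP x s; [left|right]; rewrite /=; lra.
have [st|st] := leP (sg + del / 2) t.
  have : S (sg + del / 2) by split; [lra|apply: key; lra].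
  by move=> /(sup_upper_bound hS); rewrite -/sg; lra.
by apply: key; lra.
Qed.

Definition cadlag (V : normedModType R) (z : R -> V) : Prop :=
  forall t, 0 <= t ->
    (forall e : R, 0 < e -> exists2 del : R, 0 < del &
        forall s, t <= s < t + del -> `|z s - z t| < e) /\
    (0 < t -> exists l : V, forall e : R, 0 < e ->
        exists2 del : R, 0 < del &
        forall s, t - del < s < t -> `|z s - l| < e).

Variables (V : normedModType R) (z : R -> V).
Hypothesis cz : cadlag z.

(** Near [tau] the path stays close to just two points, its left limit and its value. At [tau = 0]
    there is no left side and [l] is arbitrary. *)
Let local_values (tau e : R) : 0 <= tau -> 0 < e ->
  exists l, exists2 del : R, 0 < del & forall s : R, 0 <= s -> tau - del < s < tau + del ->
    (s < tau -> `|z s - l| < e) /\ (tau <= s -> `|z s - z tau| < e).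
Proof.
move=> tau0 e0; have [/(_ e e0)[d1 d10 h1] lf] := cz tau0.
move: tau0; rewrite le_eqVlt => /predU1P[tauE|tau0].
  by exists 0, d1 => // s s0 sd; split => ?; [lra|apply: h1; lra].
have [l /(_ e e0)[d2 d20 h2]] := lf tau0.
exists l, (Num.min d1 d2) => [|s s0]; first by rewrite lt_min d10.
have : Num.min d1 d2 <= d1 by rewrite ge_min lexx.
have : Num.min d1 d2 <= d2 by rewrite ge_min lexx orbT.
by move=> m1 m2 sd; split => ?; [apply: h2|apply: h1]; lra.
Qed.

(** The range of a cadlag path over a compact interval is totally bounded, which makes a pointwise
    eventual bound uniform. The margin [d] pays for the distance to the two local points.
    Boundedness of paths and uniform smallness of tails are both of this form. *)
Lemma cadlag_uniform (t : R) (phi : nat -> V -> R) (d : R) : 0 <= t -> 0 < d ->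
  (forall n x y, phi n x <= phi n y + `|x - y|) ->
  (forall x, exists N, forall n, (N <= n)%N -> phi n x <= - d) ->
  exists N, forall n s, (N <= n)%N -> 0 <= s <= t -> phi n (z s) <= 0.
Proof.
move=> t0 d0 lip ev.
have := @cover_itv t (fun A => exists N, forall n s, (N <= n)%N -> A s -> phi n (z s) <= 0).
apply => //.
- by move=> A B AB [N hN]; exists N => n s Nn As; exact: hN (AB _ As).
- move=> A B [N hN] [N' hN']; exists (maxn N N') => n s.
  by rewrite geq_max => /andP[n1 n2] [As|Bs]; [exact: hN|exact: hN'].
- move=> tau /andP[tau0 taut]; have [l [del del0 hl]] := local_values tau0 d0.
  exists del => //; have [N1 h1] := ev l; have [N2 h2] := ev (z tau).
  exists (maxn N1 N2) => n s; rewrite geq_max => /andP[/h1 n1 /h2 n2] [sd /andP[s0 _]].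
  have [hs1 hs2] := hl s s0 sd.
  have [st|st] := ltP s tau.
    by have := hs1 st; have := lip n (z s) l; lra.
  by have := hs2 st; have := lip n (z s) (z tau); lra.
Qed.

Lemma cadlag_bounded (t : R) : 0 <= t -> exists C, forall s, 0 <= s <= t -> `|z s| <= C.
Proof.
move=> t0; have [|||N hN] := @cadlag_uniform t (fun n x => `|x| - n%:R) 1 t0.
- by [].
- move=> n x y; have := ler_normB x (x - y); have := ler_normD (x - y) y.
  by rewrite subrK; lra.
- move=> x; exists (Num.truncn (`|x| + 1)).+1 => n nN.
  have : `|x| + 1 < n%:R.
    by apply: lt_le_trans (truncnS_gt _) _; rewrite ler_nat.
  lra.
- by exists N%:R => s hs; have := hN N s (leqnn N) hs; lra.
Qed.

Definition continuous_at_pt (s : R) : Prop := forall e : R, 0 < e ->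
  exists2 del : R, 0 < del & forall r, 0 <= r -> `|r - s| < del -> `|z r - z s| < e.

(** Oscillations of size at least [n.+1%:R^-1] are isolated: on either side of [tau] the path stays
    within half of that of one point, so only [tau] itself can belong to [D n] nearby. *)
Lemma cadlag_countable_disc (t : R) : 0 <= t ->
  countable [set s | 0 <= s <= t /\ ~ continuous_at_pt s].
Proof.
move=> t0.
pose D n := [set s : R | 0 <= s <= t /\ forall del : R, 0 < del ->
  exists r : R, [/\ 0 <= r, `|r - s| < del & n.+1%:R^-1 <= `|z r - z s|]].
apply: (@sub_countable _ _ _ (\bigcup_n D n)).
  apply: subset_card_le => s [st /existsNP[e /not_implyP[e0 he]]].
  exists (Num.truncn e^-1) => //; split => // del del0.
  have : ~ forall r, 0 <= r -> `|r - s| < del -> `|z r - z s| < e.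
    by move=> h; apply: he; exists del.
  move=> /existsNP[r /not_implyP[r0 /not_implyP[rs /negP]]].
  rewrite -leNgt => er; exists r; split => //; rewrite (le_trans _ er)//.
  rewrite -[leRHS]invrK lef_pV2 ?posrE ?invr_gt0//.
  by rewrite ltW// truncnS_gt.
apply: bigcup_countable => // n _; apply: finite_set_countable.
have := @cover_itv t (fun A => finite_set (D n `&` A)) t0.
have DE : D n `&` [set s | 0 <= s <= t] = D n by rewrite setIidl// => s [].
rewrite DE; apply.
- by move=> A B AB; apply: sub_finite_set; exact: setIS.
- by move=> A B fA fB; rewrite setIUr finite_setU.
- move=> tau /andP[tau0 taut].
  have e0 : 0 < n.+1%:R^-1 / 2 :> R by [].
  have [l [del del0 hl]] := local_values tau0 e0.
  exists del => //; apply: (@sub_finite_set _ _ [set tau]); last exact: finite_set1.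
  move=> s [[/andP[s0 st] hs] [sd _]] /=; have [//|stau] := eqVneq s tau.
  exfalso.
  (* This radius keeps [r] inside the neighbourhood and on the same side of [tau] as [s]. *)
  pose dd : R := Num.min `|s - tau| (Num.min (s - (tau - del)) (tau + del - s)).
  have dd0 : 0 < dd by rewrite !lt_min normr_gt0 subr_eq0 stau /=; lra.
  have [r [r0 rs]] := hs _ dd0; rewrite leNgt => /negP; apply.
  move: rs; rewrite !lt_min !ltr_distl => /andP[h1 /andP[h2 h3]].
  have [hs1 hs2] := hl s s0 sd.
  have rd : tau - del < r < tau + del by lra.
  have [hr1 hr2] := hl r r0 rd.
  rewrite (splitr n.+1%:R^-1).
  have tri c : `|z r - c| < n.+1%:R^-1 / 2 -> `|z s - c| < n.+1%:R^-1 / 2 ->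
      `|z r - z s| < n.+1%:R^-1 / 2 + n.+1%:R^-1 / 2.
    move=> a1 a2; rewrite -(subrKA c) (le_lt_trans (ler_normD _ _))//.
    by rewrite ltrD// distrC.
  have [lt1|lt1] := ltP s tau.
    apply: (tri l); last exact: hs1.
    by apply: hr1; move: h1; rewrite (ltr0_norm (_ : s - tau < 0)); lra.
  apply: (tri (z tau)); last exact: hs2.
  by apply: hr2; move: h1; rewrite (ger0_norm (_ : 0 <= s - tau)); lra.
Qed.

End cadlag.

(** * Weakly measurable vector-valued maps *)

Section weak_measurability.
Variables (R : realType) (H : completeNormedModType R) (ip : H -> H -> R).
Hypothesis ipP : is_inner_product ip.
Let sip := ip_semi ipP.
Variables (D0 : set H) (e : nat -> H).
Hypothesis eP : basis_in ip D0 e.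

Lemma linear_expansion (f : H -> R) (C : R) x :
  (forall x y, f (x + y) = f x + f y) -> (forall (c : R) x, f (c *: x) = c * f x) ->
  (forall x, `|f x| <= C * `|x|) ->
  (fun n => \sum_(i < n) ip x (e i) * f (e i)) @ \oo --> f x.
Proof.
move=> fD fZ fC; apply/cvg_seqP => d d0.
have [_ _ _ ecvg] := eP.
have C0 : 0 <= `|C| by [].
have d1 : 0 < d / (`|C| + 1) by rewrite divr_gt0// ltr_wpDl.
have [N hN] := ecvg x _ d1; exists N => n Nn.
have -> : \sum_(i < n) ip x (e i) * f (e i) = f (\sum_(i < n) ip x (e i) *: e i).
  elim/big_rec2 : _ => [|i y z _ ->]; last by rewrite fD fZ.
  by rewrite -[X in f X](scale0r 0) fZ mul0r.
rewrite -normrN opprB.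
have -> : f x - f (\sum_(i < n) ip x (e i) *: e i) = f (coproj ip e n x).
  by rewrite /coproj fD -[X in _ = _ + f X]scaleN1r fZ mulN1r.
have := hN n Nn; rewrite ltr_pdivlMr ?ltr_wpDl// => h.
rewrite (le_lt_trans (fC _))// (le_lt_trans _ h)// mulrC ler_wpM2l//.
by rewrite (le_trans (ler_norm _))// lerDl.
Qed.

(** Testing against vectors makes stability under sums and limits immediate; in the separable case
    [wmeas_H_measurable] returns to Borel sets. *)
Definition wmeas d (T : measurableType d) (D : set T) (f : T -> H) : Prop :=
  forall h, measurable_fun D (fun w => ip (f w) h).

Section wmeas.
Context d (T : measurableType d) (D : set T).

(** Expanding [f w] along the basis exhibits the composite as a limit of finite sums of products of
    measurable functions. *)
Lemma wmeas_kernel (k : T -> H -> R) (f : T -> H) :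
  (forall w x y, D w -> k w (x + y) = k w x + k w y) ->
  (forall w (c : R) x, D w -> k w (c *: x) = c * k w x) ->
  (forall w, D w -> exists C, forall x, `|k w x| <= C * `|x|) ->
  (forall x, measurable_fun D (k^~ x)) ->
  wmeas D f -> measurable_fun D (fun w => k w (f w)).
Proof.
move=> kD kZ kC mk mf.
apply: (@measurable_fun_cvg _ _ _ D (fun n w => \sum_(i < n) ip (f w) (e i) * k w (e i))).
- move=> n; apply: measurable_sum => i.
  by apply: measurable_funM; [exact: mf|exact: mk].
- move=> w Dw; have [C hC] := kC w Dw.
  by apply: (@linear_expansion _ C) => [x y|c x|x]; [exact: kD|exact: kZ|exact: hC].
Qed.

Lemma wmeas_ip f g : wmeas D f -> wmeas D g -> measurable_fun D (fun w => ip (f w) (g w)).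
Proof.
move=> mf mg; apply: (@wmeas_kernel (fun w x => ip x (g w))) => //.
- by move=> w x y _; rewrite (sipDl sip).
- by move=> w c x _; rewrite (sipZl sip).
- move=> w _; exists `|g w| => x; rewrite mulrC; exact: ip_CS.
- by move=> x; under eq_fun do rewrite (sipC sip); exact: mg.
Qed.

Lemma wmeas_norm f : wmeas D f -> measurable_fun D (fun w => `|f w|).
Proof.
move=> mf; rewrite (_ : (fun w => `|f w|) = Num.sqrt \o (fun w => ip (f w) (f w))).
  apply: measurableT_comp; last exact: wmeas_ip.
  by apply: continuous_measurable_fun; exact: sqrt_continuous.
by apply/funext => w /=; rewrite ip_sqr// sqrtr_sqr normr_id.
Qed.

Lemma wmeasD f g : wmeas D f -> wmeas D g -> wmeas D (fun w => f w + g w).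
Proof.
move=> mf mg h; under eq_fun do rewrite (sipDl sip).
exact: measurable_funD.
Qed.

Lemma wmeasZ (c : T -> R) f : measurable_fun D c -> wmeas D f ->
  wmeas D (fun w => c w *: f w).
Proof.
move=> mc mf h; under eq_fun do rewrite (sipZl sip).
exact: measurable_funM.
Qed.

Lemma wmeas_cst x : wmeas D (fun=> x).
Proof. by move=> h; exact: measurable_cst. Qed.

Lemma wmeasB f g : wmeas D f -> wmeas D g -> wmeas D (fun w => f w - g w).
Proof.
move=> mf mg; under [X in wmeas _ X]eq_fun do rewrite -scaleN1r.
by apply: wmeasD => //; apply: wmeasZ.
Qed.

Lemma wmeas_sum (I : Type) (s : seq I) (f : I -> T -> H) :
  (forall i, wmeas D (f i)) -> wmeas D (fun w => \sum_(i <- s) f i w).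
Proof.
move=> mf h; under eq_fun do rewrite (sip_suml sip).
by apply: measurable_sum => i; exact: mf.
Qed.

Lemma wmeas_linear (L : H -> H) (C : R) f :
  (forall x y, L (x + y) = L x + L y) -> (forall (c : R) x, L (c *: x) = c *: L x) ->
  (forall x, `|L x| <= C * `|x|) -> wmeas D f -> wmeas D (fun w => L (f w)).
Proof.
move=> LD LZ LC mf h.
apply: (@wmeas_kernel (fun w x => ip (L x) h)) => //.
- by move=> w x y _; rewrite LD (sipDl sip).
- by move=> w c x _; rewrite LZ (sipZl sip).
- move=> w _; exists (C * `|h|) => x.
  by rewrite (le_trans (ip_CS ipP _ _))// mulrAC ler_wpM2r.
Qed.

End wmeas.

Lemma open_borelH (U : set H) : open U -> borelH U.
Proof. by move=> oU; apply: sub_gen_smallest. Qed.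

Lemma H_measurable_wmeas d (T : measurableType d) (f : T -> H) :
  H_measurable f -> wmeas setT f.
Proof.
move=> mf h; apply: (measurability _ (RGenOInfty.measurableE R)).
move=> _ [_ [a ->] <-]; rewrite setTI.
rewrite (_ : _ @^-1` _ = f @^-1` [set x | a < ip x h]); last first.
  by apply/seteqP; split => w /=; rewrite in_itv /= andbT.
apply: mf; apply: open_borelH; apply: (@open_comp _ _ (fun x => ip x h) [set y | a < y]).
  by move=> x _; exact: ipl_continuous.
exact: open_gt.
Qed.

(** Pettis: by separability an open set is a countable union of balls around the points [u n], and
    the norm distance to such a point is measurable. *)
Lemma wmeas_H_measurable d (T : measurableType d) (f : T -> H) :
  separable_space H -> wmeas setT f -> H_measurable f.
Proof.
move=> [u uP] mf B bB.
apply: (bB [set B | measurable (f @^-1` B)]); split.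
  split.
  - by rewrite /= preimage_set0.
  - move=> C mC /=; rewrite setTD preimage_setC; exact: measurableC.
  - by move=> F mF /=; rewrite preimage_bigcup; apply: bigcupT_measurable => i; exact: mF.
move=> U oU /=.
pose G (nk : nat * nat) := [set x | `|x - u nk.1| < nk.2.+1%:R^-1].
have UE : U = \bigcup_(nk in [set nk | G nk `<=` U]) G nk.
  apply/seteqP; split => [x Ux|x [nk nkU /nkU//]].
  have [r r0 rU] : exists2 r : R, 0 < r & ball x r `<=` U.
    by move: oU; rewrite openE => /(_ _ Ux) /nbhs_ballP[r /= r0 rU]; exists r.
  have [k hk] : exists k : nat, k.+1%:R^-1 < r / 2.
    exists (Num.truncn (r / 2)^-1).
    by rewrite -[ltRHS]invrK ltf_pV2 ?posrE ?invr_gt0 ?divr_gt0// truncnS_gt.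
  have [n hn] := uP x k.+1%:R^-1 (ltac:(by [])).
  exists (n, k) => // y; rewrite /G /= => hy; apply: rU; rewrite -ball_normE /=.
  rewrite -(subrKA (u n)) (le_lt_trans (ler_normD _ _))// [ltRHS]splitr.
  by rewrite ltrD//; [exact: lt_trans hn hk|rewrite distrC; exact: lt_trans hy hk].
rewrite UE preimage_bigcup.
rewrite bigcup_mkcond; apply: countable_bigcupT_measurable => // nk.
case: ifPn => // _.
rewrite (_ : _ @^-1` _ = setT `&` (fun w => `|f w - u nk.1|) @^-1` `]-oo, nk.2.+1%:R^-1[).
  have mB : measurable_fun setT (fun w => `|f w - u nk.1|).
    by apply: wmeas_norm => //; apply: wmeasB => //; exact: wmeas_cst.
  exact: mB.
by rewrite setTI; apply/seteqP; split => w; rewrite /G /= in_itv.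
Qed.

End weak_measurability.

(** * Tightness of the Riemann sums *)

Section tightness.
Context (R : realType) (H : completeNormedModType R) (ip : H -> H -> R).
Hypothesis ipP : is_inner_product ip.
Let sip := ip_semi ipP.
Variables (D0 : set H) (e : nat -> H).
Hypothesis eP : basis_in ip D0 e.
Context d (Omega : measurableType d) (P : probability Omega R).
Variable Z : R -> Omega -> H.
Hypothesis lZ : levy_process P Z.
Hypothesis sepH : separable_space H.

(** Continuity from above along the tail unions [F N], whose intersection is empty. *)
Lemma pr_eventually (S : nat -> set Omega) : (forall n, measurable (S n)) ->
  (forall w, exists N, forall n, (N <= n)%N -> ~ S n w) ->
  forall eta, 0 < eta -> exists N, forall n, (N <= n)%N -> pr P (S n) <= eta.
Proof.
move=> mS ev eta eta0.
pose F N := \bigcup_(n in [set n | (N <= n)%N]) S n.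
have mF N : measurable (F N) by exact: bigcup_measurable.
have F0 : \bigcap_N F N = set0.
  rewrite -subset0 => w Fw; have [N hN] := ev w.
  by have [n /= Nn Sn] := Fw N I; exact: hN Nn Sn.
have : P \o F @ \oo --> P (\bigcap_N F N).
  apply: nonincreasing_cvg_mu => //.
  - by rewrite (le_lt_trans (probability_le1 _ _))// ltry.
  - by rewrite F0.
  - move=> m n mn; apply/subsetPset => w [k /= nk Sk]; exists k => //=.
    exact: leq_trans mn nk.
rewrite F0 measure0 => /fine_cvgP[_ /cvg_seqP /(_ eta eta0)[N hN]].
exists N => n Nn; rewrite (@le_trans _ _ (pr P (F n)))//.
  by apply: le_pr => // w Sw; exists n => /=.
have := hN n Nn; rewrite /= subr0 ger0_norm ?fine_ge0//; exact: ltW.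
Qed.

Lemma levy_cadlag w : cadlag (Z^~ w).
Proof. by have [_ _ _ _ cz] := lZ; exact: cz. Qed.

Lemma levy_wmeas t : 0 <= t -> wmeas ip setT (Z t).
Proof.
by have [[_ mZ] _ _ _ _] := lZ => t0; apply: H_measurable_wmeas => //; exact: mZ.
Qed.

(** On each path [cadlag_uniform] excludes an excursion for all large [n]; [pr_eventually] makes
    this uniform up to a set of small probability. *)
Lemma levy_excursion_small (t : R) (phi : nat -> H -> R) (c : R) : 0 <= t -> 0 < c ->
  (forall n x y, phi n x <= phi n y + `|x - y|) ->
  (forall x, exists N, forall n, (N <= n)%N -> phi n x <= - c) ->
  (forall n s, 0 <= s -> measurable [set w | 0 < phi n (Z s w)]) ->
  forall eta, 0 < eta -> exists N, exists2 B : set Omega, measurable B &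
    pr P B <= eta /\ forall w, ~ B w -> forall s, 0 <= s <= t -> phi N (Z s w) <= 0.
Proof.
move=> t0 c0 lip ev mphi.
pose bad n := [set w | exists2 s, 0 <= s <= t & 0 < phi n (Z s w)].
have mbad n : measurable (bad n).
  (* Right continuity and the Lipschitz bound move an excursion to a nearby rational time. The
     endpoint [t] is kept apart, having no room to its right inside the interval. *)
  pose F (q : rat) := if 0 <= (ratr q : R) <= t then [set w | 0 < phi n (Z (ratr q) w)]
    else set0.
  rewrite (_ : bad n = \bigcup_q F q `|` [set w | 0 < phi n (Z t w)]).
    apply: measurableU; last exact: mphi.
    apply: bigcupT_measurable_rat => q; rewrite /F; case: ifPn => // /andP[q0 _].
    exact: mphi.
  apply/seteqP; split => [w [s /andP[s0]]|w [[q _]|]].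
  - rewrite le_eqVlt => /predU1P[->|st] hs; first by right.
    have [/(_ _ hs)[del del0 hdel] _] := levy_cadlag w s0.
    have lt1 : s < Num.min t (s + del) by rewrite lt_min st; lra.
    have [q] := rat_in_itvoo lt1; rewrite in_itv /= lt_min => /andP[sq /andP[qt qd]].
    left; exists q => //; rewrite /F (le_trans s0 (ltW sq)) (ltW qt) /=.
    have := lip n (Z s w) (Z (ratr q) w).
    have : `|Z (ratr q) w - Z s w| < phi n (Z s w) by apply: hdel; lra.
    rewrite distrC; lra.
  - by rewrite /F; case: ifPn => // hq h; exists (ratr q).
  - by move=> h; exists t; rewrite ?t0 ?lexx.
have evb w : exists N, forall n, (N <= n)%N -> ~ bad n w.
  have [N hN] := cadlag_uniform (levy_cadlag w) t0 c0 lip ev.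
  exists N => n Nn [s st]; apply/negP; rewrite -leNgt; exact: hN.
move=> eta eta0; have [N hN] := pr_eventually mbad evb eta0.
exists N, (bad N) => //; split; first exact: hN.
by move=> w nb s st; rewrite leNgt; apply/negP => h; apply: nb; exists s.
Qed.

Lemma coproj_norm_lip n x y : `|coproj ip e n x| <= `|coproj ip e n y| + `|x - y|.
Proof.
have [_ _ Qc _] := eP.
have -> : x = y + (x - y) by rewrite subrKC.
rewrite coprojD// (le_trans (ler_normD _ _))// lerD2l.
by rewrite [in leRHS](_ : _ - y = x - y) ?subrKC//.
Qed.

Lemma wmeas_coproj d' (T : measurableType d') (D : set T) n f :
  wmeas ip D f -> wmeas ip D (fun w => coproj ip e n (f w)).
Proof.
move=> mf; apply: (@wmeas_linear _ _ _ ipP D0 e eP _ _ _ (coproj ip e n) 1) => //.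
- exact: coprojD.
- exact: coprojZ.
- by move=> x; have [_ _ Qc _] := eP; rewrite mul1r.
Qed.

Lemma measurable_gt d' (T : measurableType d') (f : T -> R) (r : R) :
  measurable_fun setT f -> measurable [set w | r < f w].
Proof.
move=> mf; rewrite (_ : [set _ | _] = setT `&` f @^-1` `]r, +oo[); first exact: mf.
by rewrite setTI; apply/seteqP; split => w /=; rewrite in_itv /= andbT.
Qed.

Lemma levy_bounded (t : R) : 0 <= t -> forall eta, 0 < eta ->
  exists2 lam : R, 0 < lam & exists2 B : set Omega, measurable B &
    pr P B <= eta /\ forall w, ~ B w -> forall s, 0 <= s <= t -> `|Z s w| <= lam.
Proof.
move=> t0 eta eta0.
have [|||||N [B mB [pB hB]]] :=
  @levy_excursion_small t (fun n x => `|x| - n%:R) 1 t0 _ _ _ _ eta => //.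
- move=> n x y; have := ler_normD (x - y) y; rewrite subrK; lra.
- move=> x; exists (Num.truncn (`|x| + 1)).+1 => n nN.
  have : `|x| + 1 < n%:R.
    by apply: lt_le_trans (truncnS_gt _) _; rewrite ler_nat.
  lra.
- move=> n s s0; apply: measurable_gt; apply: measurable_funB => //.
  by apply: (wmeas_norm ipP eP) => //; exact: levy_wmeas.
exists N.+1%:R => //; exists B => //; split => // w nB s st.
have := hB w nB s st; rewrite -natr1; lra.
Qed.

Lemma levy_coproj_small (t mu : R) : 0 <= t -> 0 < mu -> forall eta, 0 < eta ->
  exists L, exists2 B : set Omega, measurable B &
    pr P B <= eta /\
    forall w, ~ B w -> forall s, 0 <= s <= t -> `|coproj ip e L (Z s w)| <= mu.
Proof.
move=> t0 mu0 eta eta0.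
have mu2 : 0 < mu / 2 by rewrite divr_gt0.
have [_ _ _ ecvg] := eP.
have [||||N [B mB [pB hB]]] :=
  @levy_excursion_small t (fun n x => `|coproj ip e n x| - mu) (mu / 2) t0 mu2 _ _ _ eta => //.
- by move=> n x y; have := coproj_norm_lip n x y; lra.
- by move=> x; have [N hN] := ecvg x _ mu2; exists N => n /hN; lra.
- move=> n s s0; apply: measurable_gt; apply: measurable_funB => //.
  by apply: (wmeas_norm ipP eP) => //; apply: wmeas_coproj => //; exact: levy_wmeas.
exists N, B => //; split => // w nB s st.
by have := hB w nB s st; lra.
Qed.

Lemma coprojB n x y : coproj ip e n (x - y) = coproj ip e n x - coproj ip e n y.
Proof. by rewrite coprojD// -scaleN1r coprojZ// scaleN1r. Qed.

Lemma levy_incr_meas a b : 0 <= a -> 0 <= b -> H_measurable (fun w => Z b w - Z a w).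
Proof.
move=> a0 b0; apply: (wmeas_H_measurable ipP eP sepH).
by apply: wmeasB => //; exact: levy_wmeas.
Qed.

Lemma levy_independent n (tt : nat -> R) : 0 <= tt 0%N ->
  (forall i, (i < n)%N -> tt i < tt i.+1) ->
  independent_seq P n (fun i w => Z (tt i.+1) w - Z (tt i) w).
Proof.
move=> tt0 ttS m B mn bB; have [_ ind _ _ _] := lZ.
have tt_ge0 i : (i <= n)%N -> 0 <= tt i.
  elim: i => // i IH ni; rewrite (le_trans (IH (ltnW ni)))//.
  by rewrite ltW// ttS.
rewrite {1}/pr ind//; last by move=> i im; apply: ttS; exact: leq_trans im mn.
rewrite (eq_bigr (fun i : 'I_m => (pr P [set w | B i (Z (tt i.+1) w - Z (tt i) w)])%:E)).
  by rewrite prodEFin.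
move=> i _; apply: prE.
have i_n : (i < n)%N by exact: leq_trans (ltn_ord i) mn.
by apply: levy_incr_meas; [exact: tt_ge0 (ltnW i_n)|exact: tt_ge0|exact: bB].
Qed.

Lemma levy_stationary a b (B : set H) : 0 <= a <= b -> borelH B ->
  pr P [set w | B (Z b w - Z a w)] = pr P [set w | B (Z (b - a) w)].
Proof. by move=> ab bB; have [_ _ st _ _] := lZ; rewrite /pr st. Qed.

Variable u : nat -> H.
Hypothesis uP : forall x (r : R), 0 < r -> exists n, `|x - u n| < r.

(** * Rounding increments to finitely many centres *)

Section cells.
Variables (L K : nat) (eps lam mu : R).
Hypothesis eps0 : 0 < eps.
Hypothesis lam0 : 0 <= lam.
Hypothesis mu0 : 0 <= mu.
Notation Q := (coproj ip e L).

(** The factor [3] is [2 + 1]: an increment of a path bounded by [lam] has size at most [2 * lam],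
    and its centre is off by at most [eps <= lam]; likewise for the tails and [mu]. Both bounds are
    imposed so that the rounded step is bounded in either seminorm. *)
Definition good k : bool := (`|u k| <= 3 * lam) && (`|Q (u k)| <= 3 * mu).
Definition hit (x : H) (k : nat) : bool := (`|x - u k| < eps) && good k.
(** [find] returns [K] when no listed centre is hit, so [K] is the overflow cell, and [cval] sends
    it to zero. *)
Definition kap (x : H) : 'I_K.+1 := inord (find (hit x) (iota 0 K)).
Definition cval (k : 'I_K.+1) : H := if (k < K)%N && good k then u k else 0.
Definition far (x : H) : Prop := forall k, (k < K)%N -> eps <= `|x - u k|.

Let HB := g_sigma_algebraType [set U : set H | open U].

Let open_near k : open [set x | `|x - u k| < eps].
Proof.
rewrite (_ : [set _ | _] = ball (u k) eps); first exact: ball_open.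
by rewrite -ball_normE; apply/seteqP; split => x /=; rewrite distrC.
Qed.

Let hit_borel k : borelH [set x | hit x k].
Proof.
rewrite /hit; case: (good k); last first.
  rewrite (_ : [set _ | _] = set0); first exact: (@measurable0 _ HB).
  by rewrite -subset0 => x /=; rewrite andbF.
apply: open_borelH; rewrite (_ : [set _ | _] = [set x | `|x - u k| < eps])//.
by apply/seteqP; split => x /=; rewrite andbT.
Qed.

Lemma kap_borel k : borelH [set x | kap x = k].
Proof.
have fb (s : seq nat) j : borelH [set x | find (hit x) s = j].
  elim: s j => [|i s IH] j /=.
    have [->|j0] := eqVneq j 0%N.
      rewrite (_ : [set _ | _] = setT); first exact: (@measurableT _ HB).
      by rewrite -subTset.
    rewrite (_ : [set _ | _] = set0); first exact: (@measurable0 _ HB).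
    by rewrite -subset0 => x /= /esym/eqP; apply/negP.
  case: j => [|j].
    rewrite (_ : [set _ | _] = [set x | hit x i])//.
    by apply/seteqP; split => x /=; case: ifP.
  rewrite (_ : [set _ | _] = ~` [set x | hit x i] `&` [set x | find (hit x) s = j]).
    apply: (@measurableI _ HB); last exact: IH.
    by apply: (@measurableC _ HB); exact: hit_borel.
  apply/seteqP; split => x /=; first by case: ifP => // _ [].
  by move=> [/negP/negbTE -> ->].
rewrite (_ : [set _ | _] = [set x | find (hit x) (iota 0 K) = k :> nat])//.
have fK x : (find (hit x) (iota 0 K) < K.+1)%N.
  by rewrite ltnS -{2}(size_iota 0 K) find_size.
apply/seteqP; split => x /=; first by move=> <-; rewrite /kap inordK.
by move=> h; apply/val_inj; rewrite /kap /= h inord_val.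
Qed.

Lemma far_borel : borelH [set x | far x].
Proof.
rewrite (_ : [set _ | _] = ~` \bigcup_(k in [set k | (k < K)%N]) [set x | `|x - u k| < eps]).
  apply: (@measurableC _ HB); apply: open_borelH.
  by apply: bigcup_open => k _; exact: open_near.
apply/seteqP; split => [x fx [k /= /fx]|x nx k kK]; first by rewrite leNgt => /negP.
by rewrite leNgt; apply/negP => h; apply: nx; exists k.
Qed.

Lemma cval_bound k : `|cval k| <= 3 * lam /\ `|Q (cval k)| <= 3 * mu.
Proof.
rewrite /cval; case: ifPn => [/andP[_ /andP[]]//|_].
have -> : Q 0 = 0 by rewrite -[X in Q X](scale0r 0) coprojZ// scale0r.
by rewrite normr0 !mulr_ge0.
Qed.

Lemma kap_close x : `|x| <= 2 * lam -> `|Q x| <= 2 * mu -> eps <= lam -> eps <= mu ->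
  ~ far x -> `|cval (kap x) - x| < eps.
Proof.
move=> xl xm el em /existsNP[k /not_implyP[kK /negP]]; rewrite -ltNge => xk.
have hk : hit x k.
  rewrite /hit xk /good /=; apply/andP; split.
    have := ler_normB x (x - u k); rewrite opprB addrC subrK; lra.
  by have := coproj_norm_lip L (u k) x; rewrite [`|u k - _|]distrC; lra.
have hs : has (hit x) (iota 0 K) by apply/hasP; exists k => //; rewrite mem_iota.
have fK : (find (hit x) (iota 0 K) < K)%N by rewrite -[ltnRHS](size_iota 0 K) -has_find.
have := nth_find 0%N hs; rewrite nth_iota// add0n => /andP[h1 h2].
have kE : kap x = find (hit x) (iota 0 K) :> nat by rewrite inordK// ltnS ltnW.
by rewrite /cval kE fK h2 /= distrC.
Qed.

Definition hlaw (h : R) (k : 'I_K.+1) : R := pr P [set w | kap (Z h w) = k].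

Lemma hlaw_is_law h : 0 <= h -> is_law (hlaw h).
Proof.
move=> h0; split => [k|]; first exact: pr_ge0.
rewrite -(prT P) (@pr_split _ _ _ P _ (fun w => kap (Z h w)) setT)//.
  by apply: eq_bigr => k _; rewrite setTI.
move=> k; have [[_ mZ] _ _ _ _] := lZ; exact: (mZ h h0 _ (kap_borel k)).
Qed.

Section step.
Variables (t h : R) (n : nat) (B : set Omega) (Q' : H -> H) (c : R).
Hypothesis h0 : 0 < h.
Hypothesis nh : n%:R * h <= t.
Hypothesis mB : measurable B.
Hypothesis pB : pr P B <= 8^-1.
Hypothesis hB : forall w, ~ B w -> forall s, 0 <= s <= t ->
  `|Z s w| <= lam /\ `|Q (Z s w)| <= mu.
Hypothesis pfar : n%:R * pr P [set w | far (Z h w)] <= 8^-1.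
Hypothesis el : eps <= lam.
Hypothesis em : eps <= mu.
Hypothesis Q'D : forall x y, Q' (x + y) = Q' x + Q' y.
Hypothesis Q'Z : forall (a : R) x, Q' (a *: x) = a *: Q' x.
Hypothesis Q'c : forall x, `|Q' x| <= `|x|.
Hypothesis c0 : 0 <= c.
Hypothesis nc : n%:R * eps <= c.
Hypothesis Qc : forall x, `|x| <= lam -> `|Q x| <= mu -> `|Q' x| <= c.
Hypothesis vc : forall k, `|Q' (cval k)| <= 3 * c.

(** The walk is measured through [Q'], later the identity with [c = lam] and the tail [Q] with
    [c = mu], so one argument yields both families of bounds. *)
Let ipQ x y := ip (Q' x) (Q' y).

Let sipQ : semi_inner_product ipQ.
Proof.
split => [x y|x y z|a x y|x]; rewrite /ipQ.
- exact: (sipC sip).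
- by rewrite Q'D (sipDl sip).
- by rewrite Q'Z (sipZl sip).
- exact: (sip_ge0 sip).
Qed.

Let xi j w := Z (j.+1%:R * h) w - Z (j%:R * h) w.

Let xi_law j (S : set H) : borelH S ->
  pr P [set w | S (xi j w)] = pr P [set w | S (Z h w)].
Proof.
move=> bS; rewrite levy_stationary//; last first.
  by rewrite mulr_ge0 ?(ltW h0)//= ler_wpM2r ?(ltW h0)// ler_nat.
by rewrite -mulrBl -natrB// subSnn mul1r.
Qed.

(** Off the exceptional sets the rounded walk follows [Z] with an error of [eps] per step, at most
    [c] in total, while [Z] itself has size at most [c] in the seminorm. Hence the radius [2 * c] is
    never exceeded. *)
Let no_exit w : ~ B w -> (forall j, (j < n)%N -> ~ far (xi j w)) ->
  forall m i y, (i + m = n)%N -> `|Q' (y - Z (i%:R * h) w)| <= i%:R * eps ->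
  ~~ exitb ipQ cval (2 * c) y [seq kap (xi j w) | j <- iota i m].
Proof.
move=> nB nf; elim=> [//|m IH] i y inm hy /=.
have iN : (i < n)%N by rewrite -inm addnS ltnS leq_addr.
have tin j : (j <= n)%N -> 0 <= j%:R * h <= t.
  move=> jn; rewrite mulr_ge0 ?(ltW h0)//= (le_trans _ nh)// ler_wpM2r ?(ltW h0)//.
  by rewrite ler_nat.
have [a1 a2] := hB nB (tin _ (ltnW iN)); have [b1 b2] := hB nB (tin _ iN).
have close : `|cval (kap (xi i w)) - xi i w| < eps.
  apply: kap_close => //; last exact: nf.
    by rewrite /xi (le_trans (ler_normB _ _))//; lra.
  by rewrite /xi coprojB (le_trans (ler_normB _ _))//; lra.
set y' := y + _.
have hy' : `|Q' (y' - Z (i.+1%:R * h) w)| <= i.+1%:R * eps.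
  have -> : y' - Z (i.+1%:R * h) w = (y - Z (i%:R * h) w) + (cval (kap (xi i w)) - xi i w).
    rewrite /y' /xi opprB addrACA [- _ + (_ - _)]addrC -!addrA; congr (_ + (_ + _)).
    by rewrite addrCA subrr addr0.
  rewrite Q'D (le_trans (ler_normD _ _))// -natr1 mulrDl mul1r lerD//.
  by rewrite (le_trans (Q'c _))// ltW.
rewrite negb_or IH ?andbT -?leNgt//; last by rewrite addSnnS.
rewrite /ipQ (ip_sqr ipP) ler_sqr ?nnegrE ?mulr_ge0//.
have -> : y' = (y' - Z (i.+1%:R * h) w) + Z (i.+1%:R * h) w by rewrite subrK.
rewrite Q'D (le_trans (ler_normD _ _))//.
have : i.+1%:R * eps <= n%:R * eps by rewrite ler_wpM2r ?(ltW eps0)// ler_nat.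
move=> h1; have := le_trans hy' (le_trans h1 nc); have := Qc b1 b2.
by move: `|_| `|_| => r1 r2; lra.
Qed.

Let map_cst (T T' : Type) (s : seq T) (x : T') : [seq x | _ <- s] = nseq (size s) x.
Proof. by elim: s => //= _ s ->. Qed.

(** The exit probability is at most [8^-1] from [B] plus [8^-1] from the far events, the [4^-1] that
    [walk_second_moment] needs. With radius [2 * c] and step bound [3 * c], its right-hand side is
    [33 * c ^+ 2]. *)
Lemma step_bound :
  n%:R ^+ 2 * `|Q' (mean (hlaw h, cval))| ^+ 2 <= 33 * c ^+ 2 /\
  n%:R * (\sum_k hlaw h k * `|Q' (cval k)| ^+ 2) <= 33 * c ^+ 2.
Proof.
have c3 : 0 <= 3 * c by rewrite mulr_ge0.
have c2 : 0 <= 2 * c by rewrite mulr_ge0.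
have vb k : ipQ (cval k) (cval k) <= (3 * c) ^+ 2.
  by rewrite /ipQ (ip_sqr ipP) ler_sqr ?nnegrE.
have := @walk_second_moment _ _ _ _ sipQ _ _ _ _ (hlaw_is_law (ltW h0)) c3 c2 vb n.
have -> : 2 * (2 * c) ^+ 2 + (2 * c + 3 * c) ^+ 2 = 33 * c ^+ 2 by ring.
rewrite /msq /= {2 3}/ipQ (ip_sqr ipP).
have -> : \sum_k hlaw h k * ip (Q' (cval k)) (Q' (cval k)) =
  \sum_k hlaw h k * `|Q' (cval k)| ^+ 2 by apply: eq_bigr => k _; rewrite (ip_sqr ipP).
apply; rewrite /exitp.
have tt0 : 0 <= 0%:R * h by rewrite mul0r.
have ttS i : (i < n)%N -> i%:R * h < i.+1%:R * h by move=> _; rewrite ltr_pM2r// ltr_nat.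
have ind := levy_independent tt0 ttS.
have mxi i : H_measurable (xi i).
  by apply: levy_incr_meas; rewrite mulr_ge0 ?(ltW h0).
have lawE : [seq cell_law P xi kap j | j <- iota 0 n] = nseq n (hlaw h).
  rewrite -[in RHS](size_iota 0 n) -map_cst; apply: eq_map => j.
  by apply/funext => k; exact: (xi_law j (kap_borel k)).
rewrite -lawE -(pr_EX (fun i _ => mxi i) ind kap_borel).
set E := [set w | _].
have mE : measurable E by apply: (event_meas (fun i _ => mxi i) kap_borel).
pose F j := [set w | far (xi j w)].
have mF j : measurable (F j) by exact: (mxi j _ far_borel).
have mbF : measurable (\bigcup_(j in [set j | (j < n)%N]) F j).
  exact: bigcup_measurable.
have sub : E `<=` B `|` \bigcup_(j in [set j | (j < n)%N]) F j.
  move=> w Ew; apply: contrapT => /not_orP[nB nF].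
  have := @no_exit w nB _ n 0%N 0 (add0n n).
  have [[Z0 _] _ _ _ _] := lZ.
  rewrite !mul0r Z0 subrr -[X in Q' X](scale0r 0) Q'Z scale0r normr0 lexx.
  have nf j : (j < n)%N -> ~ far (xi j w) by move=> jn fj; apply: nF; exists j.
  by move=> /(_ nf isT) /negP; apply.
rewrite (le_trans (le_pr P mE _ sub))//; first exact: measurableU.
rewrite (le_trans (prU P mB mbF))//.
have := pr_bigcup_le P n mF.
under eq_bigr do rewrite (xi_law _ far_borel).
rewrite sumr_const card_ord => h1; rewrite -[_ *+ n]mulr_natl in h1.
by apply: le_trans (lerD pB (le_trans h1 pfar)) _; lra.
Qed.

(** Rounding [t / h] down costs at most a factor [2]. As [33 <= 6 ^+ 2], the mean gets [2 * 6 = 12]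
    and the second moment [2 * 33 = 66]. *)
Lemma step_moments : 0 < t -> h <= t -> n = Num.truncn (t / h) ->
  `|Q' (mean (hlaw h, cval))| <= 12 * c * (h / t) /\
  \sum_k hlaw h k * `|Q' (cval k)| ^+ 2 <= 66 * c ^+ 2 * (h / t).
Proof.
move=> t0 ht nE; have [b1 b2] := step_bound.
have th0 : 0 <= t / h by rewrite divr_ge0// ltW.
have n1 : (1 <= n)%N by rewrite nE truncn_gt0 ler_pdivlMr// mul1r.
have nt : t < (n%:R + 1) * h by rewrite -ltr_pdivrMr// natr1 nE truncnS_gt.
have n1' : 1 <= n%:R :> R by rewrite ler1n.
have n0 : 0 < n%:R :> R by lra.
have nht : t <= 2 * n%:R * h by have := ler_wpM2r (ltW h0) n1'; lra.
have hn : n%:R^-1 <= 2 * (h / t).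
  by rewrite mulrA ler_pdivlMr// mulrC ler_pdivrMr//; lra.
split.
  have b3 : n%:R * `|Q' (mean (hlaw h, cval))| <= 6 * c.
    rewrite -ler_sqr ?nnegrE ?mulr_ge0// exprMn (le_trans b1)// exprMn.
    by rewrite ler_wpM2r ?sqr_ge0//; lra.
  rewrite (@le_trans _ _ (6 * c * n%:R^-1))//; first by rewrite ler_pdivlMr// mulrC.
  by have := @ler_wpM2l _ (6 * c) (mulr_ge0 (ler0n _ _) c0) _ _ hn; lra.
rewrite (@le_trans _ _ (33 * c ^+ 2 * n%:R^-1))//; first by rewrite ler_pdivlMr// mulrC.
by have := @ler_wpM2l _ (33 * c ^+ 2) (mulr_ge0 (ler0n _ _) (sqr_ge0 c)) _ _ hn; lra.
Qed.

End step.
End cells.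

Lemma rsum_map (K : finType) (V : lmodType R) (c : nat -> K -> V) (k : nat -> K) l :
  rsum [seq c j | j <- l] [seq k j | j <- l] = \sum_(j <- l) c j (k j).
Proof. by elim: l => [|j l IH] /=; rewrite ?big_nil// big_cons IH. Qed.

Lemma In_map (A B : Type) (f : A -> B) (l : seq A) y :
  List.In y [seq f x | x <- l] -> exists2 x, List.In x l & y = f x.
Proof.
elim: l => //= x l IH [<-|/IH[z zl ->]]; first by exists x; [left|].
by exists z => //; right.
Qed.

Lemma In_iota n j : List.In j (iota 0 n) -> (j < n)%N.
Proof.
have h m : List.In j (iota m n) -> (m <= j < m + n)%N.
  elim: n m => //= n IH m [<-|/IH]; first by rewrite leqnn addnS ltnS leq_addr.
  by rewrite addSnnS => /andP[/ltnW -> ->].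
by move=> /h.
Qed.

Lemma ex_uniform_index (Pr : nat -> nat -> Prop) (L : nat) :
  (forall i, (i < L)%N -> exists N, forall n, (N <= n)%N -> Pr n i) ->
  exists N, forall n i, (N <= n)%N -> (i < L)%N -> Pr n i.
Proof.
elim: L => [|L IH] h; first by exists 0%N.
have [|N hN] := IH; first by move=> i iL; apply: h; rewrite ltnS ltnW.
have [N' hN'] := h L (ltnSn L).
exists (maxn N N') => n i; rewrite geq_max => /andP[n1 n2].
by rewrite ltnS leq_eqVlt => /predU1P[->|iL]; [exact: hN'|exact: hN].
Qed.

(** * Uniform smallness of the tails of the Riemann sums *)

Section riemann_sums.
Variables (Rs : R -> H -> H) (t M : R).
Hypothesis t0 : 0 < t.
Hypothesis RsD : forall s x y, Rs s (x + y) = Rs s x + Rs s y.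
Hypothesis RsZ : forall s (c : R) x, Rs s (c *: x) = c *: Rs s x.
Hypothesis M0 : 0 < M.
Hypothesis RsM : forall s x, 0 <= s <= t -> `|Rs s x| <= M * `|x|.
Hypothesis Rs_cadlag : forall x, cadlag (fun s => Rs s x).

Let CN N s x := coproj ip e N (Rs s x).

Let CND N s x y : CN N s (x + y) = CN N s x + CN N s y.
Proof. by rewrite /CN RsD coprojD. Qed.
Let CNZ N s (c : R) x : CN N s (c *: x) = c *: CN N s x.
Proof. by rewrite /CN RsZ coprojZ. Qed.
Let CNB N s x y : CN N s (x - y) = CN N s x - CN N s y.
Proof. by rewrite CND -scaleN1r CNZ scaleN1r. Qed.
Let CN0 N s : CN N s 0 = 0.
Proof. by rewrite -[X in CN _ _ X](scale0r 0) CNZ scale0r. Qed.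
Let CN_sum N s (I : Type) (r : seq I) (f : I -> H) :
  CN N s (\sum_(i <- r) f i) = \sum_(i <- r) CN N s (f i).
Proof. by elim: r => [|i r IH]; rewrite ?big_nil ?CN0// !big_cons CND IH. Qed.

Let CN_M N s x : 0 <= s <= t -> `|CN N s x| <= M * `|x|.
Proof. by move=> st; have [_ _ Qc _] := eP; rewrite (le_trans (Qc _ _)) ?RsM. Qed.

(* Strong continuity makes [s |-> Rs s x] have compact range, so the tails
   [coproj ip e N] are uniformly small on [Rs s] of a finite-dimensional space. *)
Let CN_small L (kappa : R) : 0 < kappa -> exists N0, forall N, (N0 <= N)%N ->
  forall s x, 0 <= s <= t -> `|CN N s x| <= kappa * `|x| + M * `|coproj ip e L x|.
Proof.
move=> k0; have [_ _ Qc ecvg] := eP.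
pose S := \sum_(i < L) `|e i|; have S0 : 0 <= S by apply: sumr_ge0.
pose k' := kappa / (S + 1).
have k'0 : 0 < k' by rewrite divr_gt0//; lra.
have [N hN] : exists N, forall n i, (N <= n)%N -> (i < L)%N ->
    forall s, 0 <= s <= t -> `|CN n s (e i)| <= k'.
  apply: ex_uniform_index => i _.
  have [||N hN] := @cadlag_uniform _ _ _ (Rs_cadlag (e i)) t
     (fun n x => `|coproj ip e n x| - k') (k' / 2) (ltW t0) (divr_gt0 k'0 (ltr0Sn _ _)).
  - by move=> n x y; have := coproj_norm_lip n x y; lra.
  - move=> x; have [N hN] := ecvg x _ (divr_gt0 k'0 (ltr0Sn _ 1)).
    by exists N => n /hN; lra.
  - by exists N => n Nn s st; have := hN n s Nn st; rewrite /CN; lra.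
exists N => n Nn s x st.
have -> : x = \sum_(i < L) ip x (e i) *: e i + coproj ip e L x.
  by rewrite /coproj subrKC.
rewrite CND (le_trans (ler_normD _ _))//.
rewrite [in leRHS](_ : _ + coproj ip e L x = x); last by rewrite /coproj subrKC.
rewrite lerD//; last exact: CN_M.
rewrite CN_sum (le_trans (ler_norm_sum _ _ _))//.
apply: (@le_trans _ _ (\sum_(i < L) (k' * `|x|) * `|e i|)).
  apply: ler_sum => i _; rewrite CNZ normrZ -[leRHS]mulrA [leRHS]mulrC.
  by rewrite ler_pM// ?ip_CS// hN.
rewrite -mulr_sumr -/S mulrAC ler_wpM2r// /k' mulrAC ler_pdivrMr; last lra.
by rewrite mulrDr mulr1 lerDl ltW.
Qed.

(** The centres [u] are dense, so each vector is eventually near one of the first [K], and the far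
    events shrink to nothing. *)
Let far_small (n : nat) (hh : nat -> R) (eps del : R) : 0 < eps -> 0 < del ->
  (forall j, (j < n)%N -> 0 <= hh j) ->
  exists K, forall j, (j < n)%N -> pr P [set w | far K eps (Z (hh j) w)] <= del.
Proof.
move=> eps0 del0 hh0.
have [|K hK] := @ex_uniform_index
  (fun K j => pr P [set w | far K eps (Z (hh j) w)] <= del) n; last by exists K => j; exact: hK.
move=> j jn; apply: pr_eventually => // [K|w].
  by have [[_ mZ] _ _ _ _] := lZ; exact: (mZ _ (hh0 _ jn) _ (far_borel _ _)).
have [k hk] := uP (Z (hh j) w) eps0.
by exists k.+1 => K kK /(_ k kK); apply/negP; rewrite -ltNge.
Qed.

(** The partition runs backwards in the time of [Z]; reversing the sum lists the increments in
    increasing time, the order in which independence is available. *)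
Let conv_sum_rev (n : nat) (p s : nat -> R) w :
  conv_riemann_sum Rs Z t n p s w =
  \sum_(j <- iota 0 n) Rs (s (n - j.+1)%N)
    (Z (t - p (n - j.+1)%N) w - Z (t - p (n - j)%N) w).
Proof.
rewrite /conv_riemann_sum (reindex_inj rev_ord_inj) /=.
rewrite (_ : iota 0 n = index_iota 0 n); last by rewrite /index_iota subn0.
rewrite big_mkord; apply: eq_bigr => j _.
by rewrite subnSK.
Qed.

Section fixed_partition.
Variables (L N : nat) (kappa lam mu e0 eta : R) (B : set Omega).
Hypothesis kappa0 : 0 <= kappa.
Hypothesis lam0 : 0 < lam.
Hypothesis mu0 : 0 < mu.
Hypothesis e00 : 0 < e0.
Hypothesis eta0 : 0 < eta.
Hypothesis hC : forall s x, 0 <= s <= t ->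
  `|CN N s x| <= kappa * `|x| + M * `|coproj ip e L x|.
Hypothesis mB : measurable B.
Hypothesis pB : pr P B <= 8^-1.
Hypothesis hB : forall w, ~ B w -> forall s, 0 <= s <= t ->
  `|Z s w| <= lam /\ `|coproj ip e L (Z s w)| <= mu.
Variables (n : nat) (p s : nat -> R) (del : R).
Hypothesis part : tagged_partition t n p s del.

Let tt j := t - p (n - j)%N.
Let hh j := p (n - j)%N - p (n - j.+1)%N.
Let sg j := s (n - j.+1)%N.
Let xi j w := Z (tt j.+1) w - Z (tt j) w.

Let p_mono i j : (i <= j)%N -> (j <= n)%N -> p i <= p j.
Proof.
have [_ _ pS _ _] := part.
move=> ij; elim: j ij => [|j IH]; first by rewrite leqn0 => /eqP ->.
rewrite leq_eqVlt => /predU1P[-> //|]; rewrite ltnS => ij jn.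
by rewrite (le_trans (IH ij (ltnW jn)))// ltW// pS.
Qed.

Let p_itv j : (j <= n)%N -> 0 <= p j <= t.
Proof.
have [p0 pn _ _ _] := part.
by move=> jn; rewrite -{1}p0 -pn !p_mono.
Qed.

Let tt_itv j : (j <= n)%N -> 0 <= tt j <= t.
Proof. by move=> jn; rewrite /tt; have := p_itv (leq_subr j n); lra. Qed.

Let hh_gt0 j : (j < n)%N -> 0 < hh j.
Proof.
have [_ _ pS _ _] := part => jn; rewrite /hh subr_gt0 -(subnSK jn); apply: pS.
by rewrite (subnSK jn) leq_subr.
Qed.

Let hh_le j : (j < n)%N -> hh j <= t.
Proof.
move=> jn; rewrite /hh; have := p_itv (leq_subr j n); have := p_itv (leq_subr j.+1 n).
lra.
Qed.

Let hhE j : tt j.+1 - tt j = hh j.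
Proof. by rewrite /tt /hh; lra. Qed.

Let sum_hh : \sum_(j <- iota 0 n) hh j = t.
Proof.
have [p0 pn _ _ _] := part.
have -> : \sum_(j <- iota 0 n) hh j = \sum_(0 <= j < n) (tt j.+1 - tt j).
  by rewrite /index_iota subn0; apply: eq_bigr => j _; rewrite hhE.
by rewrite telescope_sumr// /tt subnn subn0 p0 pn; lra.
Qed.

Let sg_itv j : (j < n)%N -> 0 <= sg j <= t.
Proof.
move=> jn; have [_ _ _ ps _] := part.
have i_n : (n - j.+1 < n)%N by rewrite -subn_gt0 subKn// (leq_trans _ jn).
have := ps _ i_n; have := p_itv i_n; have := p_itv (ltnW i_n); rewrite /sg; lra.
Qed.

Let tt0 : 0 <= tt 0%N. Proof. by have /andP[] := tt_itv (leq0n n). Qed.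
Let ttS i : (i < n)%N -> tt i < tt i.+1.
Proof. by move=> /hh_gt0; rewrite -hhE subr_gt0. Qed.

Let xi_ind : independent_seq P n xi. Proof. exact: levy_independent. Qed.

Let xi_meas i : (i < n)%N -> H_measurable (xi i).
Proof.
move=> ni; apply: levy_incr_meas.
- by have /andP[] := tt_itv (ltnW ni).
- by have /andP[] := tt_itv ni.
Qed.

Let xi_law j (S : set H) : (j < n)%N -> borelH S ->
  pr P [set w | S (xi j w)] = pr P [set w | S (Z (hh j) w)].
Proof.
move=> jn bS; rewrite levy_stationary ?hhE//.
by have /andP[-> _] := tt_itv (ltnW jn); rewrite ltW// ttS.
Qed.

Lemma conv_sum_wmeas : wmeas ip setT (conv_riemann_sum Rs Z t n p s).
Proof.
apply: wmeas_sum => // i; have [_ _ _ ps _] := part.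
apply: (@wmeas_linear _ _ _ ipP D0 e eP _ _ _ (Rs (s i)) M) => // [x|].
  apply: RsM; have := ps _ (ltn_ord i); have := p_itv (ltn_ord i).
  have := p_itv (ltnW (ltn_ord i)); lra.
apply: wmeasB => //; apply: levy_wmeas.
- by have := p_itv (ltnW (ltn_ord i)); lra.
- by have := p_itv (ltn_ord i); lra.
Qed.

(** Chebyshev at level [e0 / 2] for the rounded sum gives [4 / e0 ^+ 2]. With [x1 = kappa * lam] and
    [x2 = M * mu], the squared mean is at most [144 * (x1 + x2) ^+ 2], hence [288] times the sum of
    squares, and the variance at most [132] times it: together [420]. *)
Lemma conv_sum_tail :
  pr P [set w | e0 < `|coproj ip e N (conv_riemann_sum Rs Z t n p s w)|] <=
  pr P B + eta + 4 / e0 ^+ 2 * (420 * (kappa ^+ 2 * lam ^+ 2 + M ^+ 2 * mu ^+ 2)).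
Proof.
pose nn j := Num.truncn (t / hh j).
(* [Nm] dominates both the number of intervals and every repetition count [nn j], so one scale [eps]
   and one list length [K] serve all walks. *)
pose Nm := (n + \sum_(j < n) nn j).+1.
have nnN j : (j < n)%N -> (nn j <= Nm)%N.
  move=> jn; rewrite /Nm ltnW// ltnS (bigD1 (Ordinal jn))//= addnCA leq_addr//.
have nN : (n <= Nm)%N by rewrite /Nm ltnW// ltnS leq_addr.
have Nm0 : 0 < Nm%:R :> R by [].
(* Total rounding error allowed: at most [lam] and [mu] along the auxiliary walks, and at most
   [e0 / 2] for the Riemann sum once multiplied by [M]. *)
pose m3 := Num.min lam (Num.min mu (e0 / (2 * M))).
have m30 : 0 < m3 by rewrite !lt_min lam0 mu0 divr_gt0// mulr_gt0.
pose eps := m3 / Nm%:R.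
have eps0 : 0 < eps by rewrite divr_gt0.
have epsN k : (k <= Nm)%N -> k%:R * eps <= m3.
  move=> kN; rewrite /eps mulrA ler_pdivrMr// mulrC ler_wpM2l ?(ltW m30)//.
  by rewrite ler_nat.
have m3l : m3 <= lam by rewrite ge_min lexx.
have m3m : m3 <= mu by rewrite !ge_min lexx orbT.
have m3e : m3 <= e0 / (2 * M) by rewrite !ge_min lexx !orbT.
have eps3 : eps <= m3 by have := epsN 1%N isT; rewrite mul1r.
(* Total probability allowed to far increments: [8^-1] along each auxiliary walk and [eta] over the
   partition. *)
pose m2 : R := Num.min 8^-1 eta.
have m20 : 0 < m2 by rewrite lt_min eta0 andbT; lra.
have dl0 : 0 < m2 / Nm%:R by rewrite divr_gt0.
have [K hK] := far_small eps0 dl0 (fun j jn => ltW (hh_gt0 jn)).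
have farN k j : (k <= Nm)%N -> (j < n)%N ->
    k%:R * pr P [set w | far K eps (Z (hh j) w)] <= m2.
  move=> kN jn; rewrite (@le_trans _ _ (k%:R * (m2 / Nm%:R)))//.
    by rewrite ler_wpM2l// hK.
  by rewrite mulrA ler_pdivrMr// mulrC ler_wpM2l ?(ltW m20)// ler_nat.
set cv := @cval L K lam mu; set hl := fun h => hlaw L (K := K) eps lam mu h.
set kp := kap L K eps lam mu.
have el : eps <= lam by exact: le_trans eps3 m3l.
have em : eps <= mu by exact: le_trans eps3 m3m.
have cb k : `|cv k| <= 3 * lam /\ `|coproj ip e L (cv k)| <= 3 * mu.
  by apply: cval_bound; exact: ltW.
have lw j : (j < n)%N -> is_law (hl (hh j)).
  by move=> jn; apply: hlaw_is_law; exact/ltW/hh_gt0.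
have moments j : (j < n)%N ->
  (`|mean (hl (hh j), cv)| <= 12 * lam * (hh j / t) /\
   \sum_k hl (hh j) k * `|cv k| ^+ 2 <= 66 * lam ^+ 2 * (hh j / t)) /\
  (`|coproj ip e L (mean (hl (hh j), cv))| <= 12 * mu * (hh j / t) /\
   \sum_k hl (hh j) k * `|coproj ip e L (cv k)| ^+ 2 <= 66 * mu ^+ 2 * (hh j / t)).
  move=> jn.
  have nht : (nn j)%:R * hh j <= t.
    by rewrite -ler_pdivlMr ?hh_gt0// truncn_le// divr_ge0 ?(ltW t0)// ltW// hh_gt0.
  have pf : (nn j)%:R * pr P [set w | far K eps (Z (hh j) w)] <= 8^-1.
    by rewrite (le_trans (farN _ _ (nnN _ jn) jn))// ge_min lexx.
  have [_ _ Qc _] := eP.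
  have nl := le_trans (epsN _ (nnN _ jn)) m3l.
  have nm := le_trans (epsN _ (nnN _ jn)) m3m.
  split.
    by apply: (@step_moments L K eps lam mu eps0 t (hh j) (nn j) B (fun x => x) lam
      (hh_gt0 jn) nht mB pB hB pf el em) => //; [exact: ltW|move=> k; exact: (cb k).1|exact: hh_le].
  apply: (@step_moments L K eps lam mu eps0 t (hh j) (nn j) B (coproj ip e L) mu
      (hh_gt0 jn) nht mB pB hB pf el em) => //.
  - by move=> x y; rewrite coprojD.
  - by move=> x y; rewrite coprojZ.
  - exact: ltW.
  - by move=> k; exact: (cb k).2.
  - exact: hh_le.
pose Lst := [seq (hl (hh j), fun k => CN N (sg j) (cv k)) | j <- iota 0 n].
pose W sq := rsum [seq i.2 | i <- Lst] sq.
pose E := [set w | e0 / 2 < `|W [seq kp (xi j w) | j <- iota 0 n]|].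
pose F j := [set w | far K eps (xi j w)].
have mF j : (j < n)%N -> measurable (F j) by move=> jn; exact: (xi_meas jn (far_borel _ _)).
pose F' j := if (j < n)%N then F j else set0.
have mF' j : measurable (F' j) by rewrite /F'; case: ifPn => // /mF.
have mE : measurable E.
  exact: (@event_meas _ _ _ _ n xi _ kp xi_meas (kap_borel L eps lam mu) 0 n
           (fun sq => e0 / 2 < `|W sq|)).
have mbF : measurable (\bigcup_(j in [set j | (j < n)%N]) F' j).
  exact: bigcup_measurable.
set S := [set w | e0 < _].
(* Off [B] and the far events, rounding moves the sum by at most [M * (n%:R * eps) <= e0 / 2], so a
   tail above [e0] leaves the rounded one above [e0 / 2]. *)
have sub : S `<=` (B `|` \bigcup_(j in [set j | (j < n)%N]) F' j) `|` E.
  move=> w Sw; apply: contrapT => /not_orP[/not_orP[nB nF]].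
  apply; rewrite /E /=.
  have nf j : (j < n)%N -> ~ far K eps (xi j w).
    by move=> jn fj; apply: nF; exists j => //; rewrite /F' jn.
  rewrite /W /Lst -map_comp rsum_map /=.
  move: Sw; rewrite /S /= conv_sum_rev.
  have -> : coproj ip e N (\sum_(j <- iota 0 n)
      Rs (s (n - j.+1)%N) (Z (t - p (n - j.+1)%N) w - Z (t - p (n - j)%N) w)) =
      \sum_(j <- iota 0 n) CN N (sg j) (xi j w).
    rewrite (big_morph _ (coprojD ipP e N) (_ : coproj ip e N 0 = 0))//.
    by rewrite -[X in coproj _ _ _ X](scale0r 0) coprojZ// scale0r.
  set a1 := \sum_(j <- _) _; set a2 := \sum_(j <- _) _ => a1e.
  have : `|a1 - a2| <= e0 / 2.
    rewrite /a1 /a2 -sumrB (le_trans (ler_norm_sum _ _ _))//.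
    rewrite (@le_trans _ _ (\sum_(j <- iota 0 n) M * eps))//.
      rewrite !big_seq; apply: ler_sum => j; rewrite mem_iota add0n => /= jn.
      rewrite -CNB (le_trans (CN_M _ _ (sg_itv jn)))// ler_wpM2l ?(ltW M0)//.
      rewrite distrC ltW//; apply: kap_close => //; last exact: nf.
        have [b1 _] := hB nB (tt_itv jn); have [b2 _] := hB nB (tt_itv (ltnW jn)).
        by rewrite (le_trans (ler_normB _ _))//; lra.
      have [_ b1] := hB nB (tt_itv jn); have [_ b2] := hB nB (tt_itv (ltnW jn)).
      by rewrite /xi coprojB (le_trans (ler_normB _ _))//; lra.
    have -> : \sum_(j <- iota 0 n) M * eps = M * (n%:R * eps).
      by rewrite big_const_seq count_predT size_iota iter_addr_0 mulr_natl mulrnAr.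
    rewrite (@le_trans _ _ (M * (e0 / (2 * M))))//.
      by rewrite ler_wpM2l ?(ltW M0)// (le_trans (epsN _ nN)).
    by rewrite le_eqVlt; apply/orP; left; apply/eqP; field; rewrite gt_eqF.
  have := ler_normD (a1 - a2) a2; rewrite subrK; lra.
have mS : measurable S.
  rewrite /S; under eq_set do rewrite -subr_gt0.
  apply: measurable_gt; apply: measurable_funB => //; apply: (wmeas_norm ipP eP).
  exact/wmeas_coproj/conv_sum_wmeas.
rewrite (le_trans (le_pr P mS _ sub))//; first by apply: measurableU => //; exact: measurableU.
rewrite (le_trans (prU P _ mE))//; first exact: measurableU.
apply: lerD.
  rewrite (le_trans (prU P mB mbF))// lerD2l.
  rewrite (le_trans (pr_bigcup_le P n mF'))//.
  rewrite (@le_trans _ _ (\sum_(j < n) (m2 / Nm%:R)))//.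
    apply: ler_sum => j _; rewrite /F' ltn_ord /F (xi_law (ltn_ord j) (far_borel K eps)).
    exact: hK.
  rewrite sumr_const card_ord -[_ *+ n]mulr_natl mulrA ler_pdivrMr// mulrC.
  by rewrite ler_pM ?ler_nat ?(ltW m20)// ge_min lexx orbT.
have lawE : [seq i.1 | i <- Lst] = [seq cell_law P xi kp j | j <- iota 0 n].
  rewrite /Lst -map_comp; apply/eq_in_map => j; rewrite mem_iota add0n => /= jn.
  by apply/funext => k; rewrite /cell_law (xi_law jn (kap_borel L eps lam mu k)).
rewrite /E (pr_EX xi_meas xi_ind (kap_borel L eps lam mu)
   (fun sq => e0 / 2 < `|W sq|)) -/kp -lawE.
have lawL l : List.In l Lst -> is_law l.1.
  by move=> h; have [j /In_iota jn ->] := In_map h; exact: lw.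
have lawL1 q : List.In q [seq i.1 | i <- Lst] -> is_law q.
  by move=> h; have [l lL ->] := In_map h; exact: lawL.
rewrite (@le_trans _ _ (EX [seq i.1 | i <- Lst]
   (fun sq => 4 / e0 ^+ 2 * ip (0 + W sq) (0 + W sq))))//.
  apply: EX_le => // sq; rewrite add0r (ip_sqr ipP).
  case: (boolP (e0 / 2 < `|W sq|)) => [h|_] /=; last first.
    by rewrite !mulr_ge0 ?invr_ge0 ?sqr_ge0.
  rewrite mulrAC ler_pdivlMr ?exprn_gt0// mul1r.
  have : (e0 / 2) ^+ 2 <= `|W sq| ^+ 2.
    by rewrite ler_sqr ?nnegrE ?divr_ge0 ?(ltW e00)// ltW.
  lra.
rewrite EXZ ler_wpM2l ?divr_ge0 ?sqr_ge0//.
rewrite (EX_sqr (ip_semi ipP) 0 lawL) add0r (ip_sqr ipP) /Lst !big_map.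
pose x1 := kappa * lam; pose x2 := M * mu.
have x10 : 0 <= x1 by rewrite mulr_ge0// ltW.
have x20 : 0 <= x2 by rewrite mulr_ge0// ltW.
(* The moments are proportional to the lengths [hh j], which add up to [t]: this is what removes the
   dependence on the partition, here and in [b2]. *)
have b1 : `|\sum_(j <- iota 0 n) mean (hl (hh j), fun k => CN N (sg j) (cv k))| <=
    12 * (x1 + x2).
  rewrite (le_trans (ler_norm_sum _ _ _))//.
  rewrite (@le_trans _ _ (\sum_(j <- iota 0 n) 12 * (x1 + x2) / t * hh j))//; last first.
    by rewrite -mulr_sumr sum_hh divfK ?gt_eqF.
  rewrite !big_seq; apply: ler_sum => j; rewrite mem_iota add0n => /= jn.
  have -> : mean (hl (hh j), fun k => CN N (sg j) (cv k)) =
      CN N (sg j) (mean (hl (hh j), cv)).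
    by rewrite /mean CN_sum; apply: eq_bigr => k _; rewrite CNZ.
  have [[m1 _] [m2' _]] := moments j jn.
  rewrite (le_trans (hC _ (sg_itv jn)))//.
  have := ler_wpM2l kappa0 m1; have := ler_wpM2l (ltW M0) m2'.
  rewrite /x1 /x2; lra.
have b2 : \sum_(j <- iota 0 n) (msq ip (hl (hh j), fun k => CN N (sg j) (cv k)) -
    ip (mean (hl (hh j), fun k => CN N (sg j) (cv k)))
       (mean (hl (hh j), fun k => CN N (sg j) (cv k)))) <= 132 * (x1 ^+ 2 + x2 ^+ 2).
  rewrite (@le_trans _ _ (\sum_(j <- iota 0 n) 132 * (x1 ^+ 2 + x2 ^+ 2) / t * hh j))//; last first.
    by rewrite -mulr_sumr sum_hh divfK ?gt_eqF.
  rewrite !big_seq; apply: ler_sum => j; rewrite mem_iota add0n => /= jn.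
  rewrite (@le_trans _ _ (msq ip (hl (hh j), fun k => CN N (sg j) (cv k))))//.
    by rewrite gerBl (sip_ge0 (ip_semi ipP)).
  rewrite (@le_trans _ _ (\sum_k (2 * kappa ^+ 2 * (hl (hh j) k * `|cv k| ^+ 2) +
     2 * M ^+ 2 * (hl (hh j) k * `|coproj ip e L (cv k)| ^+ 2))))//.
    apply: ler_sum => k _ /=; rewrite (ip_sqr ipP).
    have q0 := (lw j jn).1 k.
    have h1 := hC (cv k) (sg_itv jn).
    have h2 : `|CN N (sg j) (cv k)| ^+ 2 <=
        2 * kappa ^+ 2 * `|cv k| ^+ 2 + 2 * M ^+ 2 * `|coproj ip e L (cv k)| ^+ 2.
      have := sqr_ge0 (kappa * `|cv k| - M * `|coproj ip e L (cv k)|).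
      have : `|CN N (sg j) (cv k)| ^+ 2 <= (kappa * `|cv k| + M * `|coproj ip e L (cv k)|) ^+ 2.
        by rewrite ler_sqr ?nnegrE ?addr_ge0 ?mulr_ge0 ?(ltW M0).
      lra.
    by have := ler_wpM2l q0 h2; lra.
  rewrite big_split /= -!mulr_sumr.
  have [[_ m1] [_ m2']] := moments j jn.
  have := @ler_wpM2l _ (2 * kappa ^+ 2) (mulr_ge0 (ler0n _ _) (sqr_ge0 _)) _ _ m1.
  have := @ler_wpM2l _ (2 * M ^+ 2) (mulr_ge0 (ler0n _ _) (sqr_ge0 _)) _ _ m2'.
  rewrite /x1 /x2 !exprMn; lra.
have b3 : `|\sum_(j <- iota 0 n) mean (hl (hh j), fun k => CN N (sg j) (cv k))| ^+ 2 <=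
    (12 * (x1 + x2)) ^+ 2.
  by rewrite ler_sqr ?nnegrE// mulr_ge0// addr_ge0.
have := sqr_ge0 (x1 - x2).
rewrite -!exprMn -/x1 -/x2; lra.
Qed.

End fixed_partition.

(** Order of choice: [lam], then [mu] and [kappa], then [L] from [mu], then [N] from [L] and
    [kappa], none of them depending on the partition. The [120] turns the Chebyshev term into
    [7 / 30 * eta1 ^+ 2]; with [eta1 ^+ 2 <= eta], [pr P B <= eta / 4] and the [eta / 8] for far
    increments, the total stays below [eta]. *)
Lemma conv_sum_tight (e0 eta : R) : 0 < e0 -> 0 < eta ->
  exists N0, forall N, (N0 <= N)%N -> forall n p s del, tagged_partition t n p s del ->
  pr P [set w | e0 < `|coproj ip e N (conv_riemann_sum Rs Z t n p s w)|] <= eta.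
Proof.
move=> e00 eta0.
pose eta' : R := Num.min 16^-1 (eta / 8).
have eta'0 : 0 < eta' by rewrite lt_min divr_gt0// andbT; lra.
have eta'1 : eta' <= 16^-1 by rewrite ge_min lexx.
have eta'2 : eta' <= eta / 8 by rewrite ge_min lexx orbT.
have [lam lam0 [B1 mB1 [pB1 hB1]]] := levy_bounded (ltW t0) eta'0.
pose eta1 : R := Num.min 1 eta.
have eta10 : 0 < eta1 by rewrite lt_min eta0 ltr01.
have eta1s : eta1 ^+ 2 <= eta.
  have h1 : eta1 <= 1 by rewrite ge_min lexx.
  have h2 : eta1 <= eta by rewrite ge_min lexx orbT.
  by rewrite expr2 (le_trans _ h2)// ler_piMl// ltW.
pose mu := e0 * eta1 / (120 * M).
have mu0 : 0 < mu by rewrite !divr_gt0 ?mulr_gt0.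
pose kappa := e0 * eta1 / (120 * lam).
have kappa0 : 0 < kappa by rewrite !divr_gt0 ?mulr_gt0.
have [L [B2 mB2 [pB2 hB2]]] := levy_coproj_small (ltW t0) mu0 eta'0.
have [N hN] := CN_small L kappa0.
exists N => m Nm n p s del part.
pose B := B1 `|` B2.
have mB : measurable B by exact: measurableU.
have pB : pr P B <= 2 * eta' by have := prU P mB1 mB2; rewrite -/B; lra.
have hB w : ~ B w -> forall r, 0 <= r <= t ->
    `|Z r w| <= lam /\ `|coproj ip e L (Z r w)| <= mu.
  by move=> /not_orP[n1 n2] r rt; split; [exact: hB1|exact: hB2].
have pB8 : pr P B <= 8^-1 by lra.
have eta8 : 0 < eta / 8 by rewrite divr_gt0.
have := conv_sum_tail (ltW kappa0) lam0 mu0 e00 eta8 (hN m Nm) mB pB8 hB part.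
have -> : kappa ^+ 2 * lam ^+ 2 = (e0 * eta1 / 120) ^+ 2.
  by rewrite -exprMn /kappa; congr (_ ^+ 2); field; rewrite gt_eqF.
have -> : M ^+ 2 * mu ^+ 2 = (e0 * eta1 / 120) ^+ 2.
  by rewrite -exprMn /mu; congr (_ ^+ 2); field; rewrite gt_eqF.
have -> : 4 / e0 ^+ 2 * (420 * ((e0 * eta1 / 120) ^+ 2 + (e0 * eta1 / 120) ^+ 2)) =
  (7 / 30) * eta1 ^+ 2 by field; rewrite gt_eqF.
lra.
Qed.

End riemann_sums.
End tightness.

(** * Integrals and convolutions on the line *)

Lemma ae_imp (R : realType) d (T : measurableType d) (m : {measure set T -> \bar R})
    (A B : T -> Prop) : (forall x, A x -> B x) ->
  {ae m, forall x, A x} -> {ae m, forall x, B x}.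
Proof. by move=> AB; apply: negligibleS => x /= nB /AB. Qed.

Section lebesgue_tools.
Context {R : realType}.
Notation mu := (@lebesgue_measure R).
Implicit Types (f g : R -> R).

Definition L1 f : Prop := mu.-integrable setT (EFin \o f).
Definition intR f : R := Rintegral mu setT f.
(** Integrals over [[0, s]] are taken over the whole line with this factor, so that reflections,
    translations and Fubini act on one fixed domain. *)
Definition chi (s u : R) : R := (0 <= u <= s)%R%:R.

Lemma chi_ge0 s u : 0 <= chi s u. Proof. by rewrite /chi; case: (_ && _). Qed.
Lemma chiE s u : 0 <= u <= s -> chi s u = 1. Proof. by rewrite /chi => ->. Qed.
Lemma chi_reflect s u : chi s (s - u) = chi s u.
Proof.
rewrite /chi; congr (nat_of_bool _)%:R.
by rewrite subr_ge0 gerBl andbC.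
Qed.

Let restrict_chi s f : f \_ `[0, s] = fun u => chi s u * f u.
Proof.
apply/funext => u; rewrite patchE /chi mem_setE in_itv /=.
by case: ifP; rewrite ?mul1r ?mul0r.
Qed.

Lemma Rintegral_chi s f : Rintegral mu `[0, s] f = intR (fun u => chi s u * f u).
Proof. by rewrite Rintegral_mkcond restrict_chi. Qed.

Lemma integrable_chi s f : mu.-integrable `[0, s] (EFin \o f) <->
  L1 (fun u => chi s u * f u).
Proof.
rewrite /L1 -restrict_chi.
rewrite integrable_mkcond ?restrict_EFin//.
Qed.

Lemma measurable_chi d (T : measurableType d) (s u : T -> R) :
  measurable_fun setT s -> measurable_fun setT u ->
  measurable_fun setT (fun x => chi (s x) (u x)).
Proof.
move=> ms mu'.
have -> : (fun x => chi (s x) (u x)) =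
    \1_([set x | 0 <= u x] `&` [set x | 0 <= s x - u x]).
  apply/funext => x; rewrite indicE /chi; congr (nat_of_bool _)%:R.
  by apply/idP/idP; rewrite inE /= subr_ge0 => /andP.
apply: measurable_indic; apply: measurableI.
- rewrite (_ : [set _ | _] = setT `&` u @^-1` `[0, +oo[); first exact: mu'.
  by rewrite setTI; apply/seteqP; split => w /=; rewrite in_itv /= andbT.
- rewrite (_ : [set _ | _] = setT `&` (fun x => s x - u x) @^-1` `[0, +oo[).
    exact: (measurable_funB ms mu').
  by rewrite setTI; apply/seteqP; split => w /=; rewrite in_itv /= andbT.
Qed.

Lemma measurable_reflect (c : R) : measurable_fun setT (fun x : R => c - x).
Proof. by apply: measurable_funB. Qed.

(** Uniqueness of Lebesgue measure: reflection only moves the closed end of a half-open interval to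
    the other side. *)
Lemma lebesgue_reflect (c : R) (A : set R) : measurable A ->
  mu [set x | A (c - x)] = mu A.
Proof.
move=> mA.
have mr : measurable_fun setT ((fun x => c - x) : measurableTypeR R -> measurableTypeR R).
  exact: measurable_reflect.
pose r := MeasurableFun.Pack (MeasurableFun.Class (isMeasurableFun.Build _ _ _ _ _ mr)).
suff h X : ocitv X -> mu X = pushforward mu r X.
  by have := @lebesgue_measure_unique R (pushforward mu r) h A mA => ->.
move=> [[a b] _ <-] /=; rewrite /pushforward.
rewrite (_ : _ @^-1` _ = `[c - b, c - a[%classic); last first.
  by apply/seteqP; split => x /=; rewrite !in_itv /=; lra.
rewrite !lebesgue_measure_itv /= !lte_fin.
have -> : (c - b < c - a) = (a < b) by rewrite ltrD2l ltrN2.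
by case: ifP => // _; rewrite -!EFinB; congr EFin; lra.
Qed.

Lemma ge0_integral_reflect (c : R) (f : R -> \bar R) : measurable_fun setT f ->
  (forall x, 0 <= f x)%E ->
  (\int[mu]_x f (c - x)%R = \int[mu]_x f x)%E.
Proof.
move=> mf f0.
have mr : measurable_fun setT ((fun x => c - x) : measurableTypeR R -> measurableTypeR R).
  exact: measurable_reflect.
have := @ge0_integral_pushforward _ _ _ _ R _ mr mu setT f measurableT mf (fun x _ => f0 x).
rewrite preimage_setT => <-; apply: eq_measure_integral => A mA _.
exact: lebesgue_reflect.
Qed.

Lemma intR_reflect (c : R) f : measurable_fun setT f ->
  intR (fun x => f (c - x)) = intR f.
Proof.
move=> mf; rewrite /intR /Rintegral; congr fine.
have mf' : measurable_fun setT (EFin \o f) by exact/measurable_EFinP.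
rewrite integralE [RHS]integralE; congr (_ - _)%E.
  rewrite -(ge0_integral_reflect c (f := (EFin \o f)^\+%E))//.
    by apply: eq_integral => x _; rewrite !funeposE.
  exact: measurable_funepos.
rewrite -(ge0_integral_reflect c (f := (EFin \o f)^\-%E))//.
  by apply: eq_integral => x _; rewrite !funenegE.
exact: measurable_funeneg.
Qed.

Lemma L1_meas f : L1 f -> measurable_fun setT f.
Proof. by move=> /measurable_int/measurable_EFinP. Qed.

Lemma L1_le f g : measurable_fun setT f -> L1 g -> (forall x, `|f x| <= g x) -> L1 f.
Proof.
move=> mf Lg fg; apply: le_integrable Lg => //; first exact/measurable_EFinP.
by move=> x _ /=; rewrite lee_fin (le_trans (fg x))// ler_norm.
Qed.

Lemma L1D f g : L1 f -> L1 g -> L1 (fun x => f x + g x).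
Proof. by move=> Lf Lg; have := integrableD measurableT Lf Lg. Qed.

Lemma L1B f g : L1 f -> L1 g -> L1 (fun x => f x - g x).
Proof. by move=> Lf Lg; have := integrableB measurableT Lf Lg. Qed.

Lemma L1Z (c : R) f : L1 f -> L1 (fun x => c * f x).
Proof. by move=> Lf; have := integrableZl measurableT c Lf. Qed.

Lemma L1_abs f : L1 f -> L1 (fun x => `|f x|).
Proof. by move=> Lf; have := integrable_abse Lf. Qed.

Lemma intR_EFin f : L1 f -> (\int[mu]_x (f x)%:E)%E = (intR f)%:E.
Proof.
by move=> Lf; rewrite /intR /Rintegral fineK//; exact: (integrable_fin_num measurableT Lf).
Qed.

Lemma intRD f g : L1 f -> L1 g -> intR (fun x => f x + g x) = intR f + intR g.
Proof. by move=> Lf Lg; exact: RintegralD. Qed.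

Lemma intRZ (c : R) f : L1 f -> intR (fun x => c * f x) = c * intR f.
Proof. by move=> Lf; exact: RintegralZl. Qed.

Lemma intRB f g : L1 f -> L1 g -> intR (fun x => f x - g x) = intR f - intR g.
Proof. by move=> Lf Lg; exact: RintegralB. Qed.

Lemma intR_norm_le f : L1 f -> `|intR f| <= intR (fun x => `|f x|).
Proof. by move=> Lf; exact: le_normr_Rintegral. Qed.

Lemma le_intR f g : L1 f -> L1 g -> (forall x, f x <= g x) -> intR f <= intR g.
Proof. by move=> Lf Lg fg; apply: le_Rintegral. Qed.

Lemma eq_intR f g : f =1 g -> intR f = intR g.
Proof. by move=> fg; apply: eq_Rintegral => x _; exact: fg. Qed.

Lemma L1_chi (s : R) : L1 (chi s).
Proof.
have : mu.-integrable `[0, s] (EFin \o cst (1 : R)).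
  apply/integrableP; split; first exact/measurable_EFinP.
  under eq_integral do rewrite /= normr1.
  rewrite integral_cst//= mul1e lebesgue_measure_itv /= lte_fin.
  by case: ifP => _; rewrite ?ltry.
move=> /integrable_chi; rewrite (_ : (fun u => _) = chi s)//.
by apply/funext => u; rewrite mulr1.
Qed.

Lemma intR0 : intR (fun=> 0) = 0.
Proof.
have := intRZ 0 (L1_chi 0); rewrite mul0r => h; rewrite -[RHS]h.
by apply: eq_intR => x; rewrite mul0r.
Qed.

(** A translation is the composite of two reflections. *)
Lemma intR_shift (r : R) (f : R -> R) : measurable_fun setT f ->
  intR (fun x => f (r + x)) = intR f.
Proof.
move=> mf; rewrite -[RHS](intR_reflect r)// -[LHS](intR_reflect 0).
  by apply: eq_intR => x; rewrite sub0r.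
by apply: measurableT_comp => //; exact: measurable_funD.
Qed.

Lemma intR_sum (n : nat) (f : nat -> R -> R) : (forall i, (i < n)%N -> L1 (f i)) ->
  L1 (fun u => \sum_(i < n) f i u) /\
  \sum_(i < n) intR (f i) = intR (fun u => \sum_(i < n) f i u).
Proof.
elim: n => [|n IH] Lf.
  rewrite big_ord0 (_ : (fun u => _) = fun=> 0); last by apply/funext => u; rewrite big_ord0.
  split; last by rewrite intR0.
  by apply: (L1_le _ (L1_chi 0)) => // u; rewrite normr0 chi_ge0.
have [L1s E] := IH (fun i h => Lf i (ltnW h)).
rewrite big_ord_recr /= E -intRD//; last exact: Lf.
rewrite (_ : (fun u => \sum_(i < n.+1) f i u) = fun u => \sum_(i < n) f i u + f n u).
  by split => //; apply: L1D => //; exact: Lf.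
by apply/funext => u; rewrite big_ord_recr.
Qed.

Lemma intR_ae_eq (f g : R -> R) : measurable_fun setT f -> measurable_fun setT g ->
  {ae mu, forall x : R, f x = g x} -> intR f = intR g.
Proof.
move=> mf mg fg; rewrite /intR /Rintegral; congr fine; apply: ae_eq_integral => //.
- exact/measurable_EFinP.
- exact/measurable_EFinP.
- by apply: ae_imp fg => x -> _.
Qed.

Lemma negligible_reflect (t : R) (N : set R) : mu.-negligible N ->
  mu.-negligible [set x | N (t - x)].
Proof.
move=> [B [mB B0 NB]]; exists [set x | B (t - x)]; split.
- rewrite -[[set x | _]]setTI; exact: measurable_reflect.
- by rewrite lebesgue_reflect.
- by move=> x /NB.
Qed.

Lemma measurable_intR_param d (T : measurableType d) (f : T * R -> R) :
  measurable_fun setT f -> measurable_fun setT (fun x => intR (fun y => f (x, y))).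
Proof.
move=> mf; have mf' : measurable_fun setT (EFin \o f) by exact/measurable_EFinP.
rewrite /intR /Rintegral.
apply: (@measurableT_comp _ _ _ _ _ _ (@fine R)) => //.
rewrite (_ : (fun x => _) = (fun x => \int[mu]_y ((EFin \o f)^\+ (x, y)) -
    \int[mu]_y ((EFin \o f)^\- (x, y)))%E); last first.
  apply/funext => x; rewrite integralE; congr (_ - _)%E; apply: eq_integral => y _.
    by rewrite !funeposE.
  by rewrite !funenegE.
apply: emeasurable_funB.
- apply: (@measurable_fun_fubini_tonelli_F _ _ _ _ _ mu ((EFin \o f)^\+)%E) => //.
  exact: measurable_funepos.
- apply: (@measurable_fun_fubini_tonelli_F _ _ _ _ _ mu ((EFin \o f)^\-)%E) => //.
  exact: measurable_funeneg.
Qed.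

Lemma intR_fubini (f : R * R -> R) (F G : R -> R) : measurable_fun setT f ->
  (forall x y, `|f (x, y)| <= F x * G y) -> L1 F -> L1 G ->
  intR (fun x => intR (fun y => f (x, y))) = intR (fun y => intR (fun x => f (x, y))).
Proof.
move=> mf fFG LF LG.
have mf1 x : measurable_fun setT (fun y => f (x, y)).
  by apply: measurableT_comp => //; exact: measurable_pair1.
have mf2 y : measurable_fun setT (fun x => f (x, y)).
  by apply: measurableT_comp => //; exact: measurable_pair2.
have L1x x : L1 (fun y => f (x, y)).
  by apply: (L1_le (mf1 x) (L1Z (F x) LG)) => y; exact: fFG.
have L1y y : L1 (fun x => f (x, y)).
  by apply: (L1_le (mf2 y) (L1Z (G y) LF)) => x; rewrite mulrC; exact: fFG.
have if1 x : (\int[mu]_y (f (x, y))%:E = (intR (fun y => f (x, y)))%:E)%E.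
  exact: intR_EFin.
have if2 y : (\int[mu]_x (f (x, y))%:E = (intR (fun x => f (x, y)))%:E)%E.
  exact: intR_EFin.
have int2 : (mu \x mu)%E.-integrable setT (EFin \o f).
  apply/(integrable12ltyP); first exact/measurable_EFinP.
  apply: (@le_lt_trans _ _ (\int[mu]_x (`|F x| * intR (fun y => `|G y|))%:E)%E).
    apply: ge0_le_integral => //.
    - by move=> x _; apply: integral_ge0.
    - apply: (@measurable_fun_fubini_tonelli_F _ _ _ _ _ mu (fun z => `|(EFin \o f) z|)%E) => //.
      by apply: measurableT_comp => //; exact/measurable_EFinP.
    - apply/measurable_EFinP/measurable_funM => //.
      by apply: measurableT_comp => //; exact: L1_meas.
    - move=> x _; have LGx := L1Z `|F x| (L1_abs LG).
      rewrite -intRZ; last exact: L1_abs.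
      rewrite -intR_EFin//; apply: ge0_le_integral => //.
      + by apply: measurableT_comp => //; apply/measurable_EFinP; exact: mf1.
      + by apply/measurable_EFinP; exact: L1_meas.
      + move=> y _; rewrite lee_fin -normrM (le_trans (fFG x y))//; exact: ler_norm.
  under eq_integral do rewrite mulrC EFinM.
  rewrite ge0_integralZl//.
  - rewrite lte_mul_pinfty// ?lee_fin /intR ?Rintegral_ge0//.
    by move: LF => /integrableP[].
  - by apply/measurable_EFinP; apply: measurableT_comp => //; exact: L1_meas.
  - by rewrite lee_fin /intR Rintegral_ge0.
rewrite {1 3}/intR /Rintegral; congr fine.
under eq_integral do rewrite -if1.
under [RHS]eq_integral do rewrite -if2.
exact: (@Fubini _ _ _ _ _ mu mu (EFin \o f) int2).
Qed.

End lebesgue_tools.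

(** * Convolution on the half-line *)

Section convolution.
Context {R : realType}.
Implicit Types (f g h : R -> R).

Definition locL1 f : Prop := measurable_fun setT f /\ forall s, L1 (fun u => chi s u * f u).
(** Local boundedness of one factor makes the convolution with a locally integrable one defined at
    every point, not just almost everywhere. *)
Definition locB f : Prop := measurable_fun setT f /\
  forall T : R, exists C, forall u, 0 <= u <= T -> `|f u| <= C.
Definition conv f g (s : R) : R := intR (fun u => chi s u * (f u * g (s - u))).

Lemma measurable_fun_reflect f (c : R) : measurable_fun setT f ->
  measurable_fun setT (fun u : R => f (c - u)).
Proof. by move=> mf; apply: measurableT_comp => //; exact: measurable_reflect. Qed.

Lemma conv_measurable_kernel f g s : measurable_fun setT f -> measurable_fun setT g ->
  measurable_fun setT (fun u : R => chi s u * (f u * g (s - u))).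
Proof.
move=> mf mg; apply: measurable_funM; first exact: measurable_chi.
by apply: measurable_funM => //; exact: measurable_fun_reflect.
Qed.

Lemma conv_integrable f g s : locL1 f -> locB g ->
  L1 (fun u => chi s u * (f u * g (s - u))).
Proof.
move=> [mf Lf] [mg Bg]; have [C hC] := Bg s.
apply: (@L1_le _ _ (fun u => C * `|chi s u * f u|)).
- exact: conv_measurable_kernel.
- exact/L1Z/L1_abs.
- move=> u; rewrite mulrA normrM mulrC.
  have [us|us] := boolP (0 <= u <= s); last first.
    by rewrite /chi (negbTE us) !mul0r normr0 !mulr0.
  by rewrite ler_wpM2r// hC//; lra.
Qed.

Lemma locB_locL1 f : locB f -> locL1 f.
Proof.
move=> [mf Bf]; split => // s; have [C hC] := Bf s.
apply: (@L1_le _ _ (fun u => C * chi s u)).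
- by apply: measurable_funM => //; exact: measurable_chi.
- exact/L1Z/L1_chi.
- move=> u; have [us|us] := boolP (0 <= u <= s).
    by rewrite chiE// mul1r mulr1 hC.
  by rewrite /chi (negbTE us) mul0r normr0 mulr0.
Qed.

Lemma conv_comm f g s : measurable_fun setT f -> measurable_fun setT g ->
  conv f g s = conv g f s.
Proof.
move=> mf mg; rewrite /conv -(intR_reflect s); last exact: conv_measurable_kernel.
by apply: eq_intR => u; rewrite chi_reflect subKr [f _ * _]mulrC.
Qed.

Lemma conv_measurable f g : measurable_fun setT f -> measurable_fun setT g ->
  measurable_fun setT (conv f g).
Proof.
move=> mf mg; apply: (@measurable_intR_param R _ _
  (fun z : R * R => chi z.1 z.2 * (f z.2 * g (z.1 - z.2)))).
apply: measurable_funM; first exact: measurable_chi.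
apply: measurable_funM; first exact: measurableT_comp.
by apply: measurableT_comp => //; exact: measurable_funB.
Qed.

Lemma conv_le f g s C : locL1 f -> measurable_fun setT g ->
  (forall u, 0 <= u <= s -> `|g u| <= C) ->
  `|conv f g s| <= C * intR (fun u => `|chi s u * f u|).
Proof.
move=> [mf Lf] mg hC.
have Lc := L1Z C (L1_abs (Lf s)).
have le1 u : `|chi s u * (f u * g (s - u))| <= C * `|chi s u * f u|.
  rewrite mulrA normrM mulrC.
  have [us|us] := boolP (0 <= u <= s); last first.
    by rewrite /chi (negbTE us) !mul0r normr0 !mulr0.
  by rewrite ler_wpM2r// hC//; lra.
have L1c : L1 (fun u => chi s u * (f u * g (s - u))).
  by apply: (L1_le _ Lc) => //; exact: conv_measurable_kernel.
rewrite -intRZ; last exact/L1_abs.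
by rewrite (le_trans (intR_norm_le L1c))// le_intR//; exact: L1_abs.
Qed.

Lemma conv_locB f g : locL1 f -> locB g -> locB (conv f g).
Proof.
move=> Lf [mg Bg]; split; first exact: conv_measurable Lf.1 mg.
move=> T; have [C hC] := Bg T.
exists (`|C| * intR (fun u => `|chi T u * f u|)) => s /andP[s0 sT].
have hC' u : 0 <= u <= s -> `|g u| <= `|C|.
  by move=> us; rewrite (le_trans (hC _ _))// ?ler_norm//; lra.
rewrite (le_trans (conv_le Lf mg hC'))// ler_wpM2l// le_intR//.
- exact/L1_abs/Lf.2.
- exact/L1_abs/Lf.2.
move=> u; rewrite !normrM ler_wpM2r// !ger0_norm ?chi_ge0//.
rewrite /chi; case: (boolP (0 <= u <= s)) => [/andP[u0 us]|_]; last exact: ler0n.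
by rewrite u0 (le_trans us).
Qed.

(* Both sides are the integral of [f x * g y * h (s - x - y)] over the triangle
   [0 <= x, 0 <= y, x + y <= s]. *)
Lemma conv_swap f g h s : locL1 f -> locL1 g -> locB h ->
  conv f (conv g h) s = conv g (conv f h) s.
Proof.
move=> Lf Lg Bh; have [mf Lf'] := Lf; have [mg Lg'] := Lg; have [mh Bh'] := Bh.
pose K (f g : R -> R) (z : R * R) :=
  chi s z.1 * chi (s - z.1) z.2 * (f z.1 * g z.2 * h (s - z.1 - z.2)).
have convE f' g' : locL1 f' -> locL1 g' ->
    conv f' (conv g' h) s = intR (fun x => intR (fun y => K f' g' (x, y))).
  move=> Lf1 Lg1; apply: eq_intR => x; rewrite mulrA /conv -intRZ.
    by apply: eq_intR => y; rewrite /K /=; ring.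
  exact: conv_integrable.
rewrite (convE f g Lf Lg) (convE g f Lg Lf).
have [C hC] := Bh' s.
have mK : measurable_fun setT (K f g).
  apply: measurable_funM.
    apply: measurable_funM; first by apply: measurable_chi => //; exact: measurable_fst.
    apply: measurable_chi; last exact: measurable_snd.
    by apply: measurable_funB => //; exact: measurable_fst.
  apply: measurable_funM.
    by apply: measurable_funM; apply: measurableT_comp.
  apply: measurableT_comp => //; apply: measurable_funB; last exact: measurable_snd.
  by apply: measurable_funB => //; exact: measurable_fst.
transitivity (intR (fun y => intR (fun x => K f g (x, y)))); last first.
  apply: eq_intR => y; apply: eq_intR => x; rewrite /K /=.
  rewrite [s - x - y]addrAC [f x * g y]mulrC; congr (_ * _).
  rewrite /chi -!natrM; congr (_%:R); rewrite !mulnb; congr nat_of_bool.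
  by apply/idP/idP; lra.
apply: (@intR_fubini _ (K f g) (fun x => `|chi s x * f x|) (fun y => C * `|chi s y * g y|)).
- exact: mK.
- move=> x y; rewrite /K /=.
  have [xs|xs] := boolP (0 <= x <= s); last by rewrite /chi (negbTE xs) !mul0r !normr0 mul0r.
  have [ys|ys] := boolP (0 <= y <= s - x); last first.
    rewrite {2}/chi (negbTE ys) mulr0 mul0r normr0 mulr_ge0// mulr_ge0//.
    by rewrite (le_trans _ (hC 0 _))//; lra.
  rewrite !chiE//; last by lra.
  rewrite !mul1r !normrM -!mulrA ler_wpM2l// [C * _]mulrC ler_wpM2l// hC//; lra.
- exact/L1_abs.
- exact/L1Z/L1_abs.
Qed.

Lemma convDr f g h s : locL1 f -> locB g -> locB h ->
  conv f (fun u => g u + h u) s = conv f g s + conv f h s.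
Proof.
move=> Lf Bg Bh; rewrite /conv -intRD; try exact: conv_integrable.
by apply: eq_intR => u; ring.
Qed.

Lemma convZr f g (c : R) s : locL1 f -> locB g ->
  conv f (fun u => c * g u) s = c * conv f g s.
Proof.
move=> Lf Bg; rewrite /conv -intRZ; last exact: conv_integrable.
by apply: eq_intR => u; ring.
Qed.

Lemma locB_cst (c : R) : locB (fun=> c).
Proof. by split => // T; exists `|c| => u _. Qed.

Lemma locBZ (c : R) f : locB f -> locB (fun u => c * f u).
Proof.
move=> [mf Bf]; split; first exact: measurable_funM.
by move=> T; have [C hC] := Bf T; exists (`|c| * C) => u uT; rewrite normrM ler_wpM2l// hC.
Qed.

Lemma locBD f g : locB f -> locB g -> locB (fun u => f u + g u).
Proof.
move=> [mf Bf] [mg Bg]; split; first exact: measurable_funD.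
move=> T; have [C hC] := Bf T; have [D hD] := Bg T; exists (C + D) => u uT.
by rewrite (le_trans (ler_normD _ _))// lerD ?hC ?hD.
Qed.

End convolution.

(** * Absolutely continuous representative of the kernel *)

Section smooth_bump.
Context {R : realType}.
Implicit Types (f g : R -> R).

(** The recursion passes to the derivative as a function, so that closure under sums, products and
    affine substitutions are inductions on [n]. *)
Fixpoint Cn (n : nat) f : Prop :=
  (forall x, derivable f x 1) /\ (if n is m.+1 then Cn m (derive1 f) else True).

Lemma Cn_derivable n f : Cn n f -> forall x, derivable f x 1.
Proof. by case: n => [|n] []. Qed.

Lemma CnW n f : Cn n.+1 f -> Cn n f.
Proof. by elim: n f => [|n IH] f [df h] /=; split => //; exact: IH. Qed.

Lemma smooth_Cn f : (forall n, Cn n f) -> smooth_fun f.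
Proof.
move=> h n; elim: n f h => [|n IH] f h x; first exact: Cn_derivable (h 0%N) x.
rewrite /derive1n iterSr; apply: IH => m; exact: (h m.+1).2.
Qed.

Lemma CnD n f g : Cn n f -> Cn n g -> Cn n (fun x => f x + g x).
Proof.
elim: n f g => [|n IH] f g [df hf] [dg hg].
  by split; last by []; move=> x; exact: (derivableD (df x) (dg x)).
split => [x|]; first by exact: (derivableD (df x) (dg x)).
rewrite (_ : derive1 (fun x => f x + g x) = fun x => derive1 f x + derive1 g x); first exact: IH.
  by apply/funext => x; rewrite !derive1E deriveD.
Qed.

Lemma CnZ n (c : R) f : Cn n f -> Cn n (fun x => c * f x).
Proof.
elim: n f => [|n IH] f [df hf].
  by split => // x; exact: derivableZ.
split => [x|]; first exact: derivableZ.
rewrite (_ : derive1 (fun x => c * f x) = fun x => c * derive1 f x); first exact: IH.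
  by apply/funext => x; rewrite !derive1E; have := deriveZ c (df x); rewrite /GRing.scale.
Qed.

Lemma CnM n f g : Cn n f -> Cn n g -> Cn n (fun x => f x * g x).
Proof.
elim: n f g => [|n IH] f g hf hg.
  by split => // x; apply: derivableM; [exact: Cn_derivable hf x|exact: Cn_derivable hg x].
have [[df hf'] [dg hg']] := (hf, hg).
split => [x|]; first exact: derivableM.
rewrite (_ : derive1 (fun x => f x * g x) = fun x => f x * derive1 g x + g x * derive1 f x).
  by apply: CnD; apply: IH => //; exact: CnW.
by apply/funext => x; rewrite !derive1E; have := deriveM (df x) (dg x); rewrite /GRing.scale.
Qed.

Lemma Cn_affine n (p q : R) f : Cn n f -> Cn n (fun x => f (p * x + q)).
Proof.
have aff (x : R) : is_derive x 1 (fun y : R => p * y + q) p.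
  by apply: is_derive_eq; rewrite /GRing.scale /=; ring.
elim: n f => [|n IH] f [df hf].
  split => // x; have := @is_derive1_comp _ f (fun y => p * y + q) x _ _
    (DeriveDef (df _) erefl) (aff x).
  by case.
have D (x : R) : is_derive x 1 (fun y : R => f (p * y + q)) ('D_1 f (p * x + q) * p).
  exact: (@is_derive1_comp _ f (fun y => p * y + q) x _ _ (DeriveDef (df _) erefl) (aff x)).
split => [x|]; first by case: (D x).
rewrite (_ : derive1 _ = fun x => p * derive1 f (p * x + q)); first by apply: CnZ; exact: IH.
by apply/funext => x; rewrite !derive1E; have [_ ->] := D x; rewrite mulrC.
Qed.

(* [flat k x = x^-k exp (-1/x)] for [x > 0]: the derivatives of [exp (-1/x)] are
   linear combinations of these. *)
Definition flat (k : nat) (x : R) : R := if 0 < x then x^-1 ^+ k * expR (- x^-1) else 0.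

Let pow_exp_le k (y : R) : 0 <= y -> y ^+ k * expR (- y) <= k%:R ^+ k.
Proof.
move=> y0; case: k => [|k].
  by rewrite !expr0 mul1r -[leRHS]expR0 ler_expR oppr_le0.
rewrite expRN ler_pdivrMr ?expR_gt0//.
have -> : expR y = expR (y / k.+1%:R) ^+ k.+1.
  by rewrite -expRM_natl mulrC divfK ?pnatr_eq0.
rewrite -exprMn lerXn2r ?nnegrE ?mulr_ge0 ?expR_ge0//.
have := expR_ge1Dx (y / k.+1%:R); rewrite -(ler_pM2l (ltr0Sn R k)).
rewrite mulrDr mulr1 mulrCA divff ?pnatr_eq0// mulr1.
by apply: le_trans; rewrite lerDr.
Qed.

(** Exponential decay beats every power of [x^-1]. A quadratic bound at the origin is what makes the
    derivative there zero. *)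
Let flat_le k x : `|flat k x| <= k.+2%:R ^+ k.+2 * x ^+ 2.
Proof.
rewrite /flat; case: ifPn => [x0|_]; last by rewrite normr0 mulr_ge0 ?sqr_ge0// exprn_ge0.
have y0 : 0 <= x^-1 by rewrite invr_ge0 ltW.
rewrite ger0_norm ?mulr_ge0 ?exprn_ge0 ?expR_ge0//.
rewrite -ler_pdivrMr ?exprn_gt0// -exprVn mulrAC -exprD addn2.
exact: pow_exp_le.
Qed.

Let flat_derive0 k : is_derive (0 : R) 1 (flat k) 0.
Proof.
have lim0 : (fun h : R => h^-1 *: ((flat k \o shift 0) (h *: 1) - flat k 0)) @ 0^' --> (0 : R).
  apply/cvgrPdist_le => e e0.
  pose C : R := k.+2%:R ^+ k.+2 + 1.
  have C0 : 0 < C by rewrite ltr_wpDl// exprn_ge0.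
  near=> h; rewrite sub0r normrN /= addr0 {2}/flat ltxx subr0 /GRing.scale /= mulr1.
  have h0 : h != 0 by near: h; exact: nbhs_dnbhs_neq.
  rewrite normrM normfV -ler_pdivlMl ?invr_gt0 ?normr_gt0// invrK.
  rewrite (le_trans (flat_le k h))// -[h ^+ 2]real_normK ?num_real// expr2 mulrA mulrC.
  rewrite ler_wpM2l// (@le_trans _ _ (C * `|h|))//; first by rewrite ler_wpM2r// lerDl.
  rewrite -ler_pdivlMl// mulrC; near: h; apply: dnbhs0_le.
  by rewrite divr_gt0.
have dv : derivable (flat k) 0 1 by apply/cvg_ex; exists 0.
by split => //; exact/cvg_lim.
Unshelve. all: by end_near. Qed.

Let flat_derive k (x : R) : is_derive x 1 (flat k) (- k%:R * flat k.+1 x + flat k.+2 x).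
Proof.
have [x0|x0|->] := ltgtP x 0; last first.
- rewrite (_ : - _ * _ + _ = 0); first exact: flat_derive0.
  by rewrite /flat ltxx mulr0 addr0.
- apply: (@near_eq_is_derive R R R (fun y : R => y^-1 ^+ k * expR (- y^-1)) (flat k)).
    near=> y; rewrite /flat; case: ifPn => // /negP; case.
    by near: y; exact: lt_nbhsr.
  rewrite /flat x0.
  have xn0 : x != 0 by rewrite gt_eqF.
  have dV : is_derive x 1 (fun y : R => y^-1) (- (x^-1 ^+ 2)).
    have := @is_deriveV R id x 1 1 xn0 (is_derive_id x 1).
    by rewrite /GRing.scale /= mulr1 -exprVn.
  have dX := is_deriveX k dV.
  have dE : is_derive x 1 (fun y : R => expR (- y^-1)) (expR (- x^-1) * (x^-1 ^+ 2)).
    apply: (@is_derive1_comp R expR (fun y => - y^-1)).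
    by apply: is_derive_eq; rewrite opprK.
  have fE : (fun y : R => y^-1 ^+ k * expR (- y^-1)) =
      ((fun y : R => y^-1) ^+ k) * (fun y : R => expR (- y^-1)).
    by apply/funext => y; rewrite mulrfctE exprfctE.
  rewrite fE; apply: (@is_derive_eq _ _ _ _ _ _ _ _ (is_deriveM dX dE)).
  rewrite /GRing.scale /= exprfctE.
  case: k {dX fE} => [|k] /=; rewrite ?exprS; ring.
- apply: (@near_eq_is_derive R R R (cst 0) (flat k)).
    near=> y; rewrite /flat; case: ifPn => // y0; suff : y < 0 by lra.
    by near: y; exact: lt_nbhsl.
  rewrite /flat (lt_gtF x0) mulr0 addr0; exact: is_derive_cst.
Unshelve. all: by end_near. Qed.

Lemma flat_smooth n k : Cn n (flat k).
Proof.
elim: n k => [|n IH] k.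
  by split => // x; case: (flat_derive k x).
split => [x|]; first by case: (flat_derive k x).
rewrite (_ : derive1 _ = fun x => - k%:R * flat k.+1 x + flat k.+2 x).
  by apply: CnD => //; exact: CnZ.
by apply/funext => x; rewrite derive1E; case: (flat_derive k x).
Qed.

End smooth_bump.

(** * Test functions comparing an interval with its translate *)

Section du_bois_reymond.
Context {R : realType}.
Notation mu := (@lebesgue_measure R).
Implicit Types (f g : R -> R).

Lemma intR_dominated (f_ : nat -> R -> R) f g : (forall n, measurable_fun setT (f_ n)) ->
  measurable_fun setT f -> {ae mu, forall x, f_ ^~ x @ \oo --> f x} ->
  L1 g -> (forall n x, `|f_ n x| <= g x) ->
  (fun n => intR (f_ n)) @ \oo --> intR f.
Proof.
move=> mf_ mf cvf Lg fg.
have [] := @dominated_convergence _ _ R mu setT measurableT (fun n x => (f_ n x)%:E)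
  (EFin \o f) (EFin \o g).
- by move=> n; apply/measurable_EFinP; exact: mf_.
- by apply/measurable_EFinP; exact: mf.
- by apply: ae_imp cvf => x fx _; apply: cvg_EFin; [exact: nearW|exact: fx].
- exact: Lg.
- by apply: aeW => x n _ /=; rewrite lee_fin.
move=> Lf _ cv; rewrite /intR /Rintegral; apply: (fine_cvg (f := fun n => _)).
rewrite fineK; first exact: cv.
exact: (integrable_fin_num measurableT Lf).
Qed.

(** Since [flat 0 y] is [exp (-1/y)], which tends to [1] for large [y], these smooth functions
    converge pointwise to the indicator of []al, be[]. *)
Definition bump (n : nat) (al be x : R) : R :=
  flat 0 (n.+1%:R * x + - (n.+1%:R * al)) * flat 0 (- n.+1%:R * x + n.+1%:R * be).

Lemma bump_Cn n al be k : Cn k (bump n al be).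
Proof. by apply: CnM; apply: Cn_affine; exact: flat_smooth. Qed.

Let flat01 (x : R) : 0 <= flat 0 x <= 1.
Proof.
rewrite /flat; case: ifPn => [x0|_]; last by rewrite lexx ler01.
by rewrite expr0 mul1r expR_ge0 -[leRHS]expR0 ler_expR oppr_le0 invr_ge0 ltW.
Qed.

Lemma bump_ge0 n al be x : 0 <= bump n al be x.
Proof.
by rewrite /bump mulr_ge0//; have /andP[] := flat01 (n.+1%:R * x + - (n.+1%:R * al));
  have /andP[] := flat01 (- n.+1%:R * x + n.+1%:R * be).
Qed.

Lemma bump_le1 n al be x : bump n al be x <= 1.
Proof.
rewrite /bump; have /andP[h1 h2] := flat01 (n.+1%:R * x + - (n.+1%:R * al)).
have /andP[h3 h4] := flat01 (- n.+1%:R * x + n.+1%:R * be).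
by rewrite -[leRHS](mulr1 1) ler_pM.
Qed.

Lemma bump_out n al be x : ~~ (al < x < be) -> bump n al be x = 0.
Proof.
rewrite negb_and -!leNgt => /orP[xa|xb]; rewrite /bump /flat.
  rewrite [X in X * _]ifF ?mul0r//; apply/negbTE; rewrite -leNgt -mulrBr.
  by rewrite pmulr_rle0// subr_le0.
rewrite [X in _ * X]ifF ?mulr0//; apply/negbTE; rewrite -leNgt mulNr addrC -mulrBr.
by rewrite pmulr_rle0// subr_le0.
Qed.

Let flat_cvg1 (x : R) : 0 < x -> (fun n => flat 0 (n.+1%:R * x)) @ \oo --> (1 : R).
Proof.
move=> x0.
rewrite (_ : (fun n => _) = fun n => expR (- (harmonic n * x^-1))); last first.
  by apply/funext => n; rewrite /flat mulr_gt0// expr0 mul1r invfM.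
rewrite -expR0; apply: continuous_cvg; first exact: continuous_expR.
rewrite -oppr0; apply: cvgN; rewrite -(mul0r x^-1).
by apply: cvgM; [exact: cvg_harmonic|exact: cvg_cst].
Qed.

Lemma bump_cvg al be x : al < x < be -> (fun n => bump n al be x) @ \oo --> (1 : R).
Proof.
move=> /andP[ax xb]; rewrite -(mul1r 1) /bump; apply: cvgM.
  under eq_cvg do rewrite -mulrBr.
  by apply: flat_cvg1; rewrite subr_gt0.
under eq_cvg do rewrite mulNr addrC -mulrBr.
by apply: flat_cvg1; rewrite subr_gt0.
Qed.

Lemma Cn_continuous n f : Cn n f -> continuous f.
Proof.
by move=> /Cn_derivable df x; apply/differentiable_continuous/derivable1_diffP.
Qed.

Section test_functions.
Variables (n : nat) (al be s : R).
Hypothesis al0 : 0 < al.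
Hypothesis s0 : 0 < s.
Hypothesis albe : al < be.

Notation g := (bump n al be).

Let g_cont : continuous g. Proof. exact: Cn_continuous (bump_Cn n al be 0). Qed.
Let g_meas : measurable_fun setT g. Proof. exact: continuous_measurable_fun. Qed.

Let L1g x : L1 (fun u => chi x u * g u).
Proof.
apply: (L1_le _ (L1_chi x)) => [|u].
  by apply: measurable_funM => //; exact: measurable_chi.
rewrite normrM ger0_norm ?chi_ge0// ger0_norm ?bump_ge0//.
by rewrite ler_piMr ?chi_ge0// bump_le1.
Qed.

Let G x := Rintegral mu `[0, x] g.

Let G0 x : x < al -> G x = 0.
Proof.
move=> xa; rewrite /G Rintegral_chi -[RHS](@Rintegral_set0 _ _ _ mu g) /intR Rintegral_mkcond.
rewrite [RHS]Rintegral_mkcond; apply: eq_Rintegral => u _; rewrite patch_set0 patchT ?inE//.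
have [us|us] := boolP (0 <= u <= x); last by rewrite /chi (negbTE us) mul0r.
by rewrite bump_out ?mulr0//; lra.
Qed.

Let Gbe x : be <= x -> G x = G be.
Proof.
move=> xb; rewrite /G !Rintegral_chi; apply: eq_intR => u.
have [us|us] := boolP (al < u < be); last by rewrite bump_out// !mulr0.
move: us => /andP[u1 u2]; have u0 : 0 <= u by rewrite ltW// (lt_trans al0).
by rewrite !chiE// u0 ltW// (lt_le_trans u2).
Qed.

Let G_derive (x : R) : is_derive x 1 G (g x).
Proof.
have [xa|xa] := ltP x al.
  rewrite bump_out; last by lra.
  apply: (@near_eq_is_derive R R R (cst 0) G).
  by near=> y; rewrite G0//; near: y; exact: lt_nbhsl.
have x0 : 0 < x by exact: lt_le_trans al0 xa.
have xu : x < x + 1 by lra.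
have [] := @continuous_FTC1_closed R g 0 x (x + 1) xu.
- by apply/integrable_chi.
- exact: x0.
- exact: g_cont.
by move=> d1 d2; split; [exact: d1|rewrite -derive1E; exact: d2].
Unshelve. all: by end_near. Qed.

(** An antiderivative of a bump does not vanish at infinity; subtracting its translate cancels the
    mass and leaves a compactly supported function whose derivative compares the bump with its
    translate. *)
Definition tphi x := G x - G (x - s).
Definition tphi' x := g x - g (x - s).

Lemma tphi_derive (x : R) : is_derive x 1 tphi (tphi' x).
Proof.
have dGs : is_derive x 1 (fun y => G (y - s)) (g (x - s)).
  have dsh : is_derive x 1 (fun y : R => y - s) (1 : R).
    by apply: is_derive_eq; rewrite subr0.
  have := @is_derive1_comp R G (fun y => y - s) x _ _ (G_derive (x - s)) dsh.
  by rewrite mulr1.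
exact: (is_deriveB (G_derive x) dGs).
Qed.

Lemma tphi_derive1 : derive1 tphi = tphi'.
Proof. by apply/funext => x; rewrite derive1E; case: (tphi_derive x). Qed.

Lemma tphi'_Cn k : Cn k tphi'.
Proof.
rewrite /tphi' (_ : (fun x => _) = fun x => g x + (-1) * g (1 * x + - s)).
  by apply: CnD; [exact: bump_Cn|apply/CnZ/Cn_affine/bump_Cn].
by apply/funext => x; rewrite mul1r mulN1r.
Qed.

Lemma tphi_out x : (x < al \/ be + s < x) -> tphi x = 0.
Proof.
move=> [xa|xb]; rewrite /tphi; have := s0.
  by move=> ?; rewrite !G0 ?subrr//; lra.
by move=> ?; rewrite !Gbe ?subrr//; lra.
Qed.

Lemma tphi_test : test_fun_Rplus tphi.
Proof.
split; last by exists al, (be + s); split => //; [have := s0; have := albe; lra|exact: tphi_out].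
have dphi x : derivable tphi x 1 by case: (tphi_derive x).
apply: smooth_Cn => -[|k]; split; [exact: dphi|by []|exact: dphi|].
by rewrite tphi_derive1; exact: tphi'_Cn.
Qed.

Lemma tphi_FTC (u T : R) : u < T ->
  Rintegral mu `[u, T] tphi' = tphi T - tphi u.
Proof.
move=> uT; rewrite /Rintegral (@continuous_FTC2 R tphi' tphi u T uT)//.
- by apply: continuous_subspaceT; exact: Cn_continuous (tphi'_Cn 0).
- have ct : continuous tphi.
    move=> x; apply/differentiable_continuous/derivable1_diffP.
    by case: (tphi_derive x).
  split; first by move=> x _; case: (tphi_derive x).
  + exact/cvg_at_right_filter/ct.
  + exact/cvg_at_left_filter/ct.
- by move=> x _; rewrite tphi_derive1.
Qed.

End test_functions.
End du_bois_reymond.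

(** * A weakly differentiable kernel is almost everywhere a primitive *)

Section W11_representation.
Context {R : realType}.
Notation mu := (@lebesgue_measure R).
Implicit Types (f g : R -> R).

Definition rpos f (x : R) : R := (0 <= x)%R%:R * f x.

Lemma rpos_locL1 f : loc_integrable_Rplus f -> locL1 (rpos f).
Proof.
move=> Lf.
have Lf' (S : R) : 0 < S -> L1 (fun u => chi S u * f u).
  by move=> S0; apply/integrable_chi; exact: Lf.
have mf : measurable_fun setT (rpos f).
  apply: (@measurable_fun_cvg _ _ _ setT (fun n u => chi n.+1%:R u * f u)) => [n|u _].
    by apply: L1_meas; exact: Lf'.
  apply/cvg_seqP => e e0; exists (Num.truncn u).+1 => n hn.
  rewrite /rpos; have [u0|u0] := leP 0 u; last first.
    by rewrite /chi (lt_geF u0) /= !mul0r subrr normr0.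
  rewrite chiE ?mul1r ?subrr ?normr0// u0 ltW// (lt_trans (truncnS_gt _))// ltr_nat ltnS.
  exact: hn.
split => // s.
have S0 : 0 < `|s| + 1 by rewrite ltr_wpDl.
apply: (L1_le _ (L1_abs (Lf' _ S0))).
  by apply: measurable_funM => //; exact: measurable_chi.
move=> u; have [us|us] := boolP (0 <= u <= s); last first.
  by rewrite /chi (negbTE us) mul0r normr0.
have us' : 0 <= u <= `|s| + 1 by have := ler_norm s; lra.
by rewrite (chiE us) (chiE us') !mul1r /rpos (_ : 0 <= u = true) ?mul1r//; lra.
Qed.

Variables (a b : R -> R).
Hypothesis La : loc_integrable_Rplus a.
Hypothesis Lb : loc_integrable_Rplus b.
Hypothesis weak : forall phi, test_fun_Rplus phi ->
  Rintegral mu [set x | 0 < x] (fun x => a x * derive1 phi x) =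
  - Rintegral mu [set x | 0 < x] (fun x => b x * phi x).

Let B : R -> R := conv (rpos b) (fun=> 1).
(** Its weak derivative on the open half-line is zero; the aim is that it is almost everywhere
    constant there. *)
Let f x := rpos a x - B x.

Let LB : locB B. Proof. by apply: conv_locB; [exact: rpos_locL1|exact: locB_cst]. Qed.

Let Lf : locL1 f.
Proof.
have [ma La'] := rpos_locL1 La; have [mB LB'] := locB_locL1 LB.
split=> [|s]; first exact: measurable_funB.
rewrite (_ : (fun u => _) = fun u => chi s u * rpos a u + (-1) * (chi s u * B u)).
  by apply: L1D => //; exact: L1Z.
by apply/funext => u; rewrite /f; ring.
Qed.

Let BE (x : R) : B x = intR (fun u => chi x u * rpos b u).
Proof. by apply: eq_intR => u; rewrite mulr1. Qed.

Let Rintegral_gt0 g : (forall x, x <= 0 -> g x = 0) ->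
  Rintegral mu [set x | 0 < x] g = intR g.
Proof.
move=> g0; rewrite Rintegral_mkcond; apply: eq_intR => x; rewrite patchE.
case: ifPn => // /negP xn; rewrite g0// leNgt; apply/negP => x0; apply: xn.
by rewrite inE.
Qed.

Section fixed_test_function.
Variables (n : nat) (al be s : R).
Hypothesis al0 : 0 < al.
Hypothesis s0 : 0 < s.
Hypothesis albe : al < be.
Notation phi := (tphi n al be s).
Notation phi' := (tphi' n al be s).

Let phi'_out x : ~~ (al < x < be + s) -> phi' x = 0.
Proof.
have s0' := s0; have albe' := albe; have al0' := al0.
by move=> xo; rewrite /tphi' !bump_out ?subrr//; move: xo; lra.
Qed.

Let phi'_le1 x : `|phi' x| <= 1.
Proof.
rewrite /tphi'; have := bump_ge0 n al be x; have := bump_ge0 n al be (x - s).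
have := bump_le1 n al be x; have := bump_le1 n al be (x - s).
by rewrite ler_norml; lra.
Qed.

Let phi'_meas : measurable_fun setT phi'.
Proof. by apply: continuous_measurable_fun; exact: Cn_continuous (tphi'_Cn n al be s 0). Qed.

Let L1phi' g : locL1 g -> L1 (fun x => g x * phi' x).
Proof.
move=> [mg Lg]; apply: (L1_le _ (L1_abs (Lg (be + s)))).
  exact: measurable_funM.
move=> x; have [xs|xs] := boolP (al < x < be + s); last first.
  by rewrite (phi'_out xs) mulr0 normr0.
have xs' : 0 <= x <= be + s by have := al0; lra.
by rewrite (chiE xs') mul1r normrM ler_piMr// phi'_le1.
Qed.

Let ftc_tail (u : R) : 0 <= u <= be + s + 1 ->
  intR (fun v => chi (be + s + 1) v * (u <= v)%R%:R * phi' v) = - phi u.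
Proof.
move=> /andP[u0 uT]; set T := be + s + 1.
have phiT : phi T = 0 by apply: tphi_out => //; right; rewrite /T ltrDl.
have -> : intR (fun v => chi T v * (u <= v)%R%:R * phi' v) = Rintegral mu `[u, T] phi'.
  rewrite Rintegral_mkcond; apply: eq_intR => v; rewrite patchE mem_setE in_itv /=.
  rewrite /chi; have [uv|uv] := leP u v; last by rewrite mulr0 mul0r.
  by rewrite (le_trans u0 uv) mulr1 /=; case: ifP; rewrite ?mul1r ?mul0r.
move: uT; rewrite le_eqVlt => /predU1P[->|uT]; last first.
  by rewrite (tphi_FTC n be s al0)// phiT sub0r.
by rewrite phiT oppr0 set_itv1 Rintegral_set1.
Qed.

(** Fubini on the triangle [u <= v], where the inner integral of [phi'] from [u] to [T] is
    [- phi u]. The [+ 1] in [T] places it strictly beyond the support of [phi]. *)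
Let by_parts : intR (fun x => B x * phi' x) = - intR (fun x => rpos b x * phi x).
Proof.
have s0' := s0; have albe' := albe; have al0' := al0.
set T := be + s + 1.
have [mb Lb'] := rpos_locL1 Lb.
pose K (z : R * R) := (chi T z.1 * rpos b z.1) * (chi T z.2 * (z.1 <= z.2)%R%:R * phi' z.2).
have mle : measurable_fun setT (fun z : R * R => ((z.1 <= z.2)%R%:R : R)).
  rewrite (_ : (fun z => _) = \1_[set z : R * R | 0 <= z.2 - z.1]); last first.
    apply/funext => z; rewrite indicE; congr (nat_of_bool _)%:R.
    by apply/idP/idP; rewrite inE /= subr_ge0.
  apply: measurable_indic.
  rewrite (_ : [set _ | _] = setT `&` (fun z : R * R => z.2 - z.1) @^-1` `[0, +oo[).
    by apply: (measurable_funB measurable_snd measurable_fst).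
  by rewrite setTI; apply/seteqP; split => w /=; rewrite in_itv /= andbT.
have mK : measurable_fun setT K.
  apply: measurable_funM.
    apply: measurable_funM; first by apply: measurable_chi => //; exact: measurable_fst.
    by apply: measurableT_comp => //; exact: measurable_fst.
  apply: measurable_funM.
    apply: measurable_funM => //.
    by apply: measurable_chi => //; exact: measurable_snd.
  by apply: measurableT_comp => //; exact: measurable_snd.
have Kle x y : `|K (x, y)| <= `|chi T x * rpos b x| * chi T y.
  rewrite /K /= [leLHS]normrM ler_wpM2l// 2!normrM ger0_norm ?chi_ge0// -mulrA.
  rewrite ler_piMr ?chi_ge0// -[leRHS](mulr1 1) ler_pM ?phi'_le1//.
  by case: (x <= y); rewrite ?normr1 ?normr0.
have E1 : intR (fun x => intR (fun y => K (x, y))) = - intR (fun x => rpos b x * phi x).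
  have mphi : measurable_fun setT phi.
    apply: continuous_measurable_fun => x.
    apply/differentiable_continuous/derivable1_diffP.
    by case: (tphi_derive n be s al0 x).
  have L1p u : L1 (fun v => chi T v * (u <= v)%R%:R * phi' v).
    apply: (L1_le _ (L1_chi T)) => [|v].
      apply: measurable_funM => //; apply: measurable_funM; first exact: measurable_chi.
      exact: (measurableT_comp mle (measurable_pair1 u)).
    rewrite 2!normrM ger0_norm ?chi_ge0// -mulrA ler_piMr ?chi_ge0//.
    rewrite -[leRHS](mulr1 1) ler_pM ?phi'_le1//.
    by case: (u <= v); rewrite ?normr1 ?normr0.
  have out u : ~~ (0 <= u <= T) -> rpos b u * phi u = 0.
    move=> uT; have [u0|u0] := leP 0 u; last by rewrite /rpos (lt_geF u0) !mul0r.
    by rewrite tphi_out ?mulr0//; right; move: uT; rewrite u0 /= -ltNge /T; lra.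
  have pE u : intR (fun v => K (u, v)) = -1 * (rpos b u * phi u).
    have [uT|uT] := boolP (0 <= u <= T); last first.
      rewrite (out u uT) mulr0 -intR0; apply: eq_intR => v.
      by rewrite /K /= [chi T u]/chi (negbTE uT) !mul0r.
    rewrite /K /= intRZ// (ftc_tail uT) (chiE uT); ring.
  rewrite -mulN1r -intRZ; first by apply: eq_intR => u; exact: pE.
  apply: (L1_le _ (L1Z (intR (chi T)) (L1_abs (Lb' T)))); first exact: measurable_funM.
  move=> u; have [uT|uT] := boolP (0 <= u <= T); last first.
    rewrite (out u uT) normr0 mulr_ge0// /intR Rintegral_ge0// => x _; exact: chi_ge0.
  rewrite (chiE uT) mul1r normrM mulrC ler_wpM2r// -normrN -(ftc_tail uT).
  rewrite (le_trans (intR_norm_le (L1p u)))// le_intR//; [exact: L1_abs|exact: L1_chi|].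
  move=> v; rewrite 2!normrM ger0_norm ?chi_ge0// -mulrA ler_piMr ?chi_ge0//.
  rewrite -[leRHS](mulr1 1) ler_pM ?phi'_le1//.
  by case: (u <= v); rewrite ?normr1 ?normr0.
rewrite -E1 (intR_fubini mK Kle (L1_abs (Lb' T)) (L1_chi T)).
apply: eq_intR => v; rewrite /K /=.
have [vT|vT] := boolP (0 <= v <= T); last first.
  rewrite phi'_out; last by move: vT; rewrite /T; lra.
  by rewrite mulr0 -[LHS]intR0; apply: eq_intR => u; rewrite !mulr0.
rewrite BE mulrC -intRZ; last exact: Lb'.
apply: eq_intR => u.
have cE : chi v u = chi T u * (u <= v)%R%:R.
  rewrite /chi -natrM mulnb; congr (nat_of_bool _)%:R.
  by apply/idP/idP; lra.
by rewrite (chiE vT) cE; move: (rpos b u) (phi' v) (chi T u) => *; ring.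
Qed.

(** Testing the weak derivative with [tphi], the terms in [b] cancel by [by_parts]; what remains is
    that [f] integrates to zero against the bump minus its translate. *)
Lemma weak_shift : intR (fun x => f x * bump n al be x) =
                   intR (fun x => f x * bump n al be (x - s)).
Proof.
have s0' := s0; have albe' := albe; have al0' := al0.
have := weak (tphi_test n al0 s0 albe).
rewrite (tphi_derive1 n be s al0) !Rintegral_gt0; first last.
- by move=> x x0; rewrite phi'_out ?mulr0//; lra.
- by move=> x x0; rewrite tphi_out ?mulr0//; left; lra.
have -> : intR (fun x => a x * phi' x) = intR (fun x => rpos a x * phi' x).
  apply: eq_intR => x; have [x0|x0] := leP 0 x.
    by rewrite /rpos x0 mul1r.
  by rewrite phi'_out ?mulr0//; lra.
have -> : intR (fun x => b x * phi x) = intR (fun x => rpos b x * phi x).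
  apply: eq_intR => x; have [x0|x0] := leP 0 x.
    by rewrite /rpos x0 mul1r.
  by rewrite tphi_out ?mulr0//; left; lra.
rewrite -by_parts => h.
have LfB (g : R -> R) : measurable_fun setT g -> (forall x, 0 <= g x <= 1) ->
    (forall x, ~~ (0 <= x <= be + s) -> g x = 0) -> L1 (fun x => f x * g x).
  move=> mg g01 gout; apply: (L1_le _ (L1_abs (Lf.2 (be + s)))).
    by apply: measurable_funM => //; exact: Lf.1.
  move=> x; have [xs|xs] := boolP (0 <= x <= be + s); last by rewrite gout// mulr0 normr0.
  rewrite (chiE xs) mul1r normrM ler_piMr// ger0_norm; by have := g01 x; lra.
have mb : measurable_fun setT (bump n al be).
  by apply: continuous_measurable_fun; exact: Cn_continuous (bump_Cn n al be 0).
have b01 x : 0 <= bump n al be x <= 1 by rewrite bump_ge0 bump_le1.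
have L1a : L1 (fun x => f x * bump n al be x).
  by apply: LfB => // x xs; rewrite bump_out//; lra.
have L1b : L1 (fun x => f x * bump n al be (x - s)).
  apply: LfB => [|x|x xs]; [|exact: b01|by rewrite bump_out//; lra].
  by apply: measurableT_comp => //; exact: measurable_funB.
apply/eqP; rewrite -subr_eq0 -intRB//.
rewrite (_ : intR _ = intR (fun x => rpos a x * phi' x - B x * phi' x)).
  rewrite intRB ?h ?subrr//; apply: L1phi'; first exact: rpos_locL1.
  exact: locB_locL1.
by apply: eq_intR => x; rewrite /f /tphi'; ring.
Qed.

End fixed_test_function.

Let F x := Rintegral mu `[0, x] f.

Let FE x : F x = intR (fun u => f u * chi x u).
Proof. by rewrite /F Rintegral_chi; apply: eq_intR => u; rewrite mulrC. Qed.

Let L1fchi x : L1 (fun u => f u * chi x u).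
Proof.
rewrite (_ : (fun u => _) = fun u => chi x u * f u); first exact: Lf.2.
by apply/funext => u; rewrite mulrC.
Qed.

Let F_diff (al be : R) : 0 < al -> al < be ->
  (fun n => intR (fun x => f x * bump n al be x)) @ \oo --> F be - F al.
Proof.
move=> al0 albe; rewrite !FE -intRB//.
have mb n : measurable_fun setT (bump n al be).
  by apply: continuous_measurable_fun; exact: Cn_continuous (bump_Cn n al be 0).
apply: (@intR_dominated _ _ _ (fun u => `|chi be u * f u|)).
- by move=> n; apply: measurable_funM => //; exact: Lf.1.
- by apply: measurable_funB; apply: L1_meas.
(* At [be] the bumps vanish while the limit has the value [1]; this single point is discarded. *)
- have : mu.-negligible [set be] by apply/negligibleP => //; exact: lebesgue_measure_set1.
  apply: negligibleS => x /= h; apply: contrapT => xb; apply: h.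
  rewrite -mulrBr; apply: cvgM; first exact: cvg_cst.
  have [ax|ax] := ltP al x; last first.
    rewrite (_ : chi be x - chi al x = 0).
      under eq_cvg do rewrite bump_out ?(le_gtF ax)//.
      exact: cvg_cst.
    rewrite /chi ax (le_trans ax (ltW albe)) !andbT subrr//.
  rewrite [chi al x]/chi (lt_geF ax) andbF subr0.
  have x0 : 0 <= x by rewrite ltW// (lt_trans al0).
  have [xbe|xbe] := ltP x be.
    by rewrite chiE ?x0 ?(ltW xbe)//; apply: bump_cvg; rewrite ax.
  have xbe' : be < x by rewrite lt_neqAle xbe andbT; apply/eqP => /esym.
  rewrite /chi (lt_geF xbe') andbF.
  under eq_cvg do rewrite bump_out ?(le_gtF xbe) ?andbF//.
  exact: cvg_cst.
- exact/L1_abs/Lf.2.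
- move=> n x; have [xs|xs] := boolP (al < x < be); last by rewrite bump_out// mulr0 normr0.
  have xs' : 0 <= x <= be by lra.
  rewrite (chiE xs') mul1r normrM ler_piMr// ger0_norm ?bump_ge0//; exact: bump_le1.
Qed.

Let F_diff_shift (al be s : R) : 0 < al -> al < be -> 0 < s ->
  (fun n => intR (fun x => f x * bump n al be (x - s))) @ \oo --> F (be + s) - F (al + s).
Proof.
move=> al0 albe s0.
have := @F_diff (al + s) (be + s).
rewrite (_ : (fun n => intR (fun x => f x * bump n (al + s) (be + s) x)) =
  fun n => intR (fun x => f x * bump n al be (x - s))); last first.
  apply/funext => n; apply: eq_intR => x; congr (_ * _); rewrite /bump.
  by congr (flat _ _ * flat _ _); ring.
by apply; lra.
Qed.

Let F_shift (al be s : R) : 0 < al -> al < be -> 0 < s ->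
  F be - F al = F (be + s) - F (al + s).
Proof.
move=> al0 albe s0.
have eq_int : (fun n => intR (fun x => f x * bump n al be x)) =
    (fun n => intR (fun x => f x * bump n al be (x - s))).
  by apply/funext => n; exact: weak_shift.
have h1 := F_diff al0 albe; rewrite eq_int in h1.
exact: (cvg_unique (@Rhausdorff R) h1 (F_diff_shift al0 albe s0)).
Qed.

Let f_neg x : x < 0 -> f x = 0.
Proof.
move=> x0; rewrite /f /rpos (lt_geF x0) mul0r BE -[RHS](subrr 0); congr (_ - _).
rewrite -[RHS]intR0; apply: eq_intR => u; rewrite /chi.
by have [u0|u0] := leP 0 u; rewrite ?mul0r//= (lt_geF (lt_le_trans x0 u0)) mul0r.
Qed.

Let F_ae_derivable : {ae mu, forall x : R, 0 < x -> is_derive x 1 F (f x)}.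
Proof.
have := @FTC1 R f (BLeft 0).
move=> /(_ (fun y => (integrable_chi y f).2 (Lf.2 y))).
have locf : locally_integrable setT f.
  split; [exact: Lf.1|exact: openT|].
  move=> K _ cK; have [M [_ hM]] := compact_bounded cK.
  pose S : R := `|M| + 1.
  have hK x : K x -> `|x| <= S.
    by move=> Kx; apply: (hM S); rewrite /S ?(le_lt_trans (ler_norm M)) ?ltrDl.
  have mS : measurable_fun setT (fun x : R => `|chi S x * f x|%:E).
    by apply/measurable_EFinP/measurableT_comp => //; exact: L1_meas (Lf.2 S).
  have := Lf.2 S => /integrableP[_]; apply: le_lt_trans.
  apply: (@le_trans _ _ (\int[mu]_(x in K) `|chi S x * f x|%:E)%E); last first.
    by apply: ge0_subset_integral => //; exact: compact_measurable.
  rewrite le_eqVlt; apply/orP; left; apply/eqP; apply: eq_integral.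
  move=> x; rewrite inE => /hK; rewrite ler_norml => /andP[_ xS].
  have [x0|x0] := leP 0 x; first by rewrite chiE ?x0// mul1r.
  by rewrite f_neg// mulr0.
move=> /(_ locf); apply: ae_imp => x h x0.
have [|d1 d2] := h; first by rewrite lte_fin.
by split; [exact: d1|rewrite -derive1E; exact: d2].
Qed.

(** By [F_shift] the increments of [F] are translation invariant, so [F] has one and the same
    derivative wherever it is differentiable with derivative [f], which is almost everywhere by
    Lebesgue differentiation. *)
Lemma W11_ae_rep : exists c : R, {ae mu, forall x : R, 0 < x -> rpos a x = c + B x}.
Proof.
have const (x1 x2 : R) : 0 < x1 -> x1 < x2 -> is_derive x1 1 F (f x1) -> is_derive x2 1 F (f x2) ->
    f x1 = f x2.
  move=> x10 x12 d1 d2; pose s := x2 - x1.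
  have s0 : 0 < s by rewrite subr_gt0.
  have dsh : is_derive x1 1 (fun y : R => y + s) (1 : R).
    by apply: is_derive_eq; rewrite addr0.
  have x2E : x2 = x1 + s by rewrite /s subrKC.
  have d2' : is_derive (x1 + s) 1 F (f x2) by rewrite -x2E.
  have d3 : is_derive x1 1 (F \o (fun y : R => y + s)) (f x2 * 1).
    exact: (@is_derive1_comp R F (fun y => y + s) x1 _ _ d2' dsh).
  have d4 : is_derive x1 1 (fun y => F y + (F (x1 + s) - F x1)) (f x1 + 0).
    exact: (is_deriveD d1 (is_derive_cst (F (x1 + s) - F x1) x1 1)).
  have : is_derive x1 1 (F \o (fun y : R => y + s)) (f x1 + 0).
    apply: near_eq_is_derive d4; near=> y.
    have y0 : 0 < y by near: y; exact: lt_nbhsr.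
    rewrite /=; have [yx|xy|->] := ltgtP y x1; last by rewrite subrKC.
      by have := F_shift y0 yx s0; lra.
    by have := F_shift x10 xy s0; lra.
  by case=> _; case: d3 => _ -> /esym; rewrite mulr1 addr0.
have [x0 x00 dx0] : exists2 x0 : R, 0 < x0 & is_derive x0 1 F (f x0).
  apply: contrapT => h.
  have : mu.-negligible (`]0, 1[%classic : set R).
    apply: negligibleS F_ae_derivable => x /=; rewrite in_itv /= => /andP[x0 _] hx.
    by apply: h; exists x => //; exact: hx.
  have m01 : mu (`]0, 1[%classic : set R) = 1%E.
    by rewrite lebesgue_measure_itv /= lte_fin ltr01 oppr0 adde0.
  move=> neg; have : mu (`]0, 1[%classic : set R) = 0%E.
    exact: (negligibleP mu (measurable_itv `]0, 1[)).1 neg.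
  by rewrite m01 => /eqP; rewrite onee_eq0.
exists (f x0); apply: ae_imp F_ae_derivable => x hx xp; have dx := hx xp.
have -> : f x0 = f x.
  by have [xx0|x0x|->//] := ltgtP x x0; [apply/esym; exact: const|exact: const].
by rewrite /f subrK.
Unshelve. all: by end_near. Qed.

End W11_representation.

(** * Resolvent and weak solution *)

Section resolvent_calculus.
Variables (R : realType) (H : completeNormedModType R) (ip : H -> H -> R).
Notation mu := (@lebesgue_measure R).
Hypothesis ipP : is_inner_product ip.
Let sip := ip_semi ipP.
Variables (DA : set H) (A : H -> H) (a : R -> R) (Rs : R -> H -> H).
Hypothesis clA : closed_densely_defined DA A.
Hypothesis La : loc_integrable_Rplus a.
Hypothesis rP : resolvent_family ip DA A a Rs.
Variables (c : R) (b : R -> R).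
Hypothesis Lb : locL1 b.

Definition ker_rep (s : R) : R := c + conv b (fun=> 1) s.

Hypothesis aE : {ae mu, forall x : R, 0 < x -> rpos a x = ker_rep x}.

Lemma ker_rep_locB : locB ker_rep.
Proof. by apply: locBD; [exact: locB_cst|apply: conv_locB => //; exact: locB_cst]. Qed.

(** The kernels differ on a null set and reflection preserves null sets. The point [u = t] is
    removed as well, since [aE] speaks only of positive arguments. *)
Lemma ker_replace (t : R) (phi : R -> R) : measurable_fun setT (fun u => chi t u * phi u) ->
  Rintegral mu `[0, t] (fun u => a (t - u) * phi u) =
  intR (fun u => chi t u * (ker_rep (t - u) * phi u)).
Proof.
move=> mphi; rewrite Rintegral_chi.
rewrite (_ : intR _ = intR (fun u => rpos a (t - u) * (chi t u * phi u))); last first.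
  apply: eq_intR => u; rewrite mulrCA [RHS]mulrCA /rpos.
  have [us|us] := boolP (0 <= u <= t); last by rewrite /chi (negbTE us) !mul0r !mulr0.
  by rewrite (_ : 0 <= t - u = true) ?mul1r//; lra.
rewrite [RHS](_ : _ = intR (fun u => ker_rep (t - u) * (chi t u * phi u))); last first.
  by apply: eq_intR => u; rewrite mulrCA.
apply: intR_ae_eq.
- apply: measurable_funM => //; apply: measurable_fun_reflect; exact: (rpos_locL1 La).1.
- apply: measurable_funM => //; apply: measurable_fun_reflect; exact: ker_rep_locB.1.
- have := negligible_reflect t aE; have : mu.-negligible [set t].
    by apply/negligibleP => //; exact: lebesgue_measure_set1.
  move=> n1 n2; apply: negligibleS (negligibleU n1 n2) => u /= hu.
  have [ut|ut] := eqVneq u t; [by left|right => h; apply: hu].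
  have [us|us] := boolP (0 <= u <= t); last by rewrite /chi (negbTE us) !mul0r !mulr0.
  rewrite h//; move: ut; rewrite neq_lt; lra.
Qed.

Lemma additive_limit_zero (f : H -> R) (C : R) x :
  (forall x y, f (x + y) = f x + f y) -> (forall x, `|f x| <= C * `|x|) ->
  (forall e : R, 0 < e -> exists2 y, `|x - y| < e & f y = 0) -> f x = 0.
Proof.
move=> fD fC f0; apply/eqP; rewrite -normr_le0 leNgt; apply/negP => fx.
have C1 : 0 < `|C| + 1 by rewrite ltr_wpDl.
have [y] := f0 (`|f x| / (`|C| + 1)) (divr_gt0 fx C1).
rewrite ltr_pdivlMr// => h fy.
have fxy : f x = f (x - y) by have := fD (x - y) y; rewrite subrK fy addr0.
have := fC (x - y); rewrite -fxy => h2.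
have : C * `|x - y| <= `|x - y| * (`|C| + 1).
  by rewrite mulrC ler_wpM2l// (le_trans (ler_norm _))// lerDl.
lra.
Qed.

(** Cut off at negative times, where the resolvent is neither bounded nor continuous by
    hypothesis. *)
Definition res_fun (x h : H) (u : R) : R := rpos (fun u => ip (Rs u x) h) u.

Lemma res_funE x h u : 0 <= u -> res_fun x h u = ip (Rs u x) h.
Proof. by rewrite /res_fun /rpos => ->; rewrite mul1r. Qed.

Lemma res_fun_neg x h u : u < 0 -> res_fun x h u = 0.
Proof. by rewrite /res_fun /rpos leNgt => ->; rewrite mul0r. Qed.

Lemma res_fun_le (T : R) : exists2 M : R, 0 <= M &
  forall x h u, u <= T -> `|res_fun x h u| <= M * `|x| * `|h|.
Proof.
have [_ [_ /(_ T)[M hM]] _ _] := rP; exists `|M| => // x h u uT.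
have [u0|u0] := leP 0 u; last by rewrite res_fun_neg// normr0 !mulr_ge0.
rewrite res_funE// (le_trans (ip_CS ipP _ _))// ler_wpM2r//.
rewrite (le_trans (hM _ _ _)) ?u0//; exact: ler_wpM2r (ler_norm _).
Qed.

Lemma res_fun_measurable x h : measurable_fun setT (res_fun x h).
Proof.
have [_ _ [/(_ x) cR _] _] := rP.
rewrite (_ : res_fun x h = (fun u => ip (Rs u x) h) \_ `[0, +oo[%classic); last first.
  apply/funext => u; rewrite patchE /res_fun /rpos mem_setE in_itv /= andbT.
  by case: ifP; rewrite ?mul1r ?mul0r.
apply: (measurable_restrictT _ _).1 => //; apply: subspace_continuous_measurable_fun => //.
by move=> u; apply: (@cvg_comp _ _ _ (Rs^~ x) (fun y => ip y h)); [exact: cR|exact: ipl_continuous].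
Qed.

Lemma res_fun_locB x h : locB (res_fun x h).
Proof.
split; first exact: res_fun_measurable.
move=> T; have [M M0 hM] := res_fun_le T; exists (M * `|x| * `|h|) => u /andP[_ uT].
exact: hM.
Qed.

Lemma res_funDl x y h u : res_fun (x + y) h u = res_fun x h u + res_fun y h u.
Proof. by have [RD _ _ _] := rP; rewrite /res_fun /rpos RD (sipDl sip) mulrDr. Qed.

Lemma res_funZl (k : R) x h u : res_fun (k *: x) h u = k * res_fun x h u.
Proof. by have [_ [RZ _] _ _] := rP; rewrite /res_fun /rpos RZ (sipZl sip) mulrCA. Qed.

Lemma res_funDr x h k u : res_fun x (h + k) u = res_fun x h u + res_fun x k u.
Proof. by rewrite /res_fun /rpos (sipDr sip) mulrDr. Qed.

(** For [x] in [DA] this is the resolvent equation with [A] moved onto [xi]; both sides are bounded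
    in [x] and [DA] is dense. *)
Lemma res_eq_adjoint xi eta x s : adjoint_pair ip DA A xi eta -> 0 <= s ->
  res_fun x xi s = ip x xi + conv ker_rep (res_fun x eta) s.
Proof.
move=> adj s0; apply/eqP; rewrite -subr_eq0; apply/eqP.
pose f x := res_fun x xi s - (ip x xi + conv ker_rep (res_fun x eta) s).
have LK := locB_locL1 ker_rep_locB.
have [M M0 hM] := res_fun_le s.
pose I := intR (fun u => `|chi s u * ker_rep u|).
have [_ _ _ _ dDA] := clA.
apply: (@additive_limit_zero f (M * `|xi| + (`|xi| + M * `|eta| * I))).
- move=> {}x y; rewrite /f res_funDl (sipDl sip).
  rewrite (_ : res_fun (x + y) eta = fun u => res_fun x eta u + res_fun y eta u); last first.
    by apply/funext => u; rewrite res_funDl.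
  by rewrite convDr//; [ring|exact: res_fun_locB|exact: res_fun_locB].
- move=> {}x; rewrite /f !mulrDl (le_trans (ler_normB _ _))// lerD//.
    by rewrite mulrAC hM.
  rewrite (le_trans (ler_normD _ _))// lerD//; first by rewrite mulrC; exact: ip_CS.
  rewrite (le_trans (@conv_le _ _ _ _ (M * `|x| * `|eta|) LK (res_fun_measurable _ _) _))//.
    by move=> u us; apply: hM; lra.
  by rewrite -/I le_eqVlt; apply/orP; left; apply/eqP; ring.
- move=> e e0; have [y [Dy xy]] := dDA x e e0; exists y => // {xy}; move: y Dy => {}x Dx.
  apply/eqP; rewrite /f subr_eq0; apply/eqP.
  have [_ _ [_ [_ RA]] Req] := rP.
  rewrite res_funE// (Req _ _ _ s0 Dx); congr (_ + _).
  rewrite (_ : Rintegral _ _ _ = Rintegral mu `[0, s] (fun u => a (s - u) * res_fun x eta u)).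
    rewrite ker_replace; last first.
      by apply: measurable_funM; [exact: measurable_chi|exact: res_fun_measurable].
    rewrite conv_comm; [|exact: ker_rep_locB.1|exact: res_fun_measurable].
    by apply: eq_intR => u; congr (_ * _); rewrite mulrC.
  apply: eq_Rintegral => u; rewrite mem_setE in_itv /= => /andP[u0 us].
  have [DR ->] := RA _ _ u0 Dx.
  by rewrite (sipZl sip) -(RA _ _ u0 Dx).2 (adj _ DR) res_funE.
Qed.

(** The derivative in [s] of [conv ker_rep (res_fun x h)], written without differentiating the
    resolvent: [c] is the boundary term and [b] the derivative of the kernel. [ker_rep_conv] is the
    integrated form. *)
Definition res_conv (x h : H) (s : R) : R := c * res_fun x h s + conv b (res_fun x h) s.

Lemma res_conv_locB x h : locB (res_conv x h).
Proof.
by apply: locBD; [apply: locBZ; exact: res_fun_locB|apply: conv_locB => //; exact: res_fun_locB].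
Qed.

Lemma res_convDl x y h s : res_conv (x + y) h s = res_conv x h s + res_conv y h s.
Proof.
rewrite /res_conv res_funDl.
rewrite (_ : res_fun (x + y) h = fun u => res_fun x h u + res_fun y h u); last first.
  by apply/funext => u; rewrite res_funDl.
by rewrite convDr//; [ring|exact: res_fun_locB|exact: res_fun_locB].
Qed.

Lemma res_convZl (k : R) x h s : res_conv (k *: x) h s = k * res_conv x h s.
Proof.
rewrite /res_conv res_funZl.
rewrite (_ : res_fun (k *: x) h = fun u => k * res_fun x h u); last first.
  by apply/funext => u; rewrite res_funZl.
by rewrite convZr//; [ring|exact: res_fun_locB].
Qed.

Lemma res_convDr x h k s : res_conv x (h + k) s = res_conv x h s + res_conv x k s.
Proof.
rewrite /res_conv res_funDr.
rewrite (_ : res_fun x (h + k) = fun u => res_fun x h u + res_fun x k u); last first.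
  by apply/funext => u; rewrite res_funDr.
by rewrite convDr//; [ring|exact: res_fun_locB|exact: res_fun_locB].
Qed.

Lemma res_conv_le (T : R) : exists2 C : R, 0 <= C &
  forall x h s, s <= T -> `|res_conv x h s| <= C * `|x| * `|h|.
Proof.
have [M M0 hM] := res_fun_le T.
pose I := intR (fun u => `|chi T u * b u|).
have I0 : 0 <= I by rewrite /I /intR Rintegral_ge0.
exists (`|c| * M + M * I) => [|x h s sT]; first by rewrite addr_ge0// mulr_ge0.
rewrite !mulrDl (le_trans (ler_normD _ _))// lerD//.
  by rewrite normrM -!mulrA ler_wpM2l// mulrA hM.
have hM' u : 0 <= u <= s -> `|res_fun x h u| <= M * `|x| * `|h|.
  by move=> us; apply: hM; lra.
rewrite (le_trans (conv_le Lb (res_fun_measurable x h) hM'))//.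
rewrite (mulrAC M I) (mulrAC (M * _) I) ler_wpM2l ?mulr_ge0// le_intR//.
- exact/L1_abs/Lb.2.
- exact/L1_abs/Lb.2.
move=> u; rewrite !normrM ler_wpM2r// !ger0_norm ?chi_ge0//.
rewrite /chi; case: (boolP (0 <= u <= s)) => [/andP[u0 us]|_]; last exact: ler0n.
by rewrite u0 (le_trans us).
Qed.

(** As [ker_rep] is a primitive, its integration can be performed last. Associativity of convolution
    enters as [conv_swap] together with commutativity. *)
Lemma ker_rep_conv (f : R -> R) s : locB f ->
  conv ker_rep f s = conv (fun u => c * f u + conv b f u) (fun=> 1) s.
Proof.
move=> Bf; have Lf := locB_locL1 Bf; have B1 := locB_cst (1 : R); have LB1 := locB_locL1 B1.
have Bbf := conv_locB Lb Bf; have mf := Bf.1.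
have m1 := B1.1.
have Bb1 := conv_locB Lb B1.
have E1 : conv ker_rep f s = conv f (fun=> c) s + conv f (conv b (fun=> 1)) s.
  rewrite (conv_comm s ker_rep_locB.1 mf); exact: convDr (locB_cst c) Bb1.
have E2 : conv (fun u => c * f u + conv b f u) (fun=> 1) s =
    conv (fun=> 1) (fun u => c * f u) s + conv (fun=> 1) (conv b f) s.
  have mg := (locBD (locBZ c Bf) Bbf).1.
  rewrite (conv_comm s mg m1); exact: convDr (locBZ c Bf) Bbf.
have F1 : conv f (fun=> c) s = c * conv (fun=> 1) f s.
  rewrite (_ : (fun=> c) = fun=> c * 1); last by apply/funext => u; rewrite mulr1.
  by rewrite (convZr c s Lf B1) (conv_comm s mf m1).
have F2 : conv b (conv f (fun=> 1)) s = conv b (conv (fun=> 1) f) s.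
  by apply: eq_intR => u; rewrite (conv_comm _ mf m1).
rewrite E1 F1 (conv_swap s Lf Lb B1) F2 E2 (convZr c s LB1 Bf) (conv_swap s LB1 Lb Bf).
reflexivity.
Qed.

Lemma res_eq_int xi eta x s : adjoint_pair ip DA A xi eta -> 0 <= s ->
  ip (Rs s x) xi = ip x xi + intR (fun u => chi s u * res_conv x eta u).
Proof.
move=> adj s0; rewrite -res_funE// (res_eq_adjoint x adj s0); congr (_ + _).
rewrite ker_rep_conv; last exact: res_fun_locB.
by apply: eq_intR => u; rewrite mulr1.
Qed.

(** [conv_swap] brings [ker_rep] directly onto [res_fun x eta], where [res_eq_adjoint] gives
    [res_fun x xi] minus the constant [ip x xi]; that constant collects the factor [c + conv b 1],
    which is [ker_rep] again. *)
Lemma ker_rep_conv_res_conv xi eta x s : adjoint_pair ip DA A xi eta -> 0 <= s ->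
  conv ker_rep (res_conv x eta) s = res_conv x xi s - ker_rep s * ip x xi.
Proof.
move=> adj s0; have LK := locB_locL1 ker_rep_locB; have Br := res_fun_locB x eta.
have B1 := locB_cst (1 : R); have Bxi := res_fun_locB x xi.
rewrite /res_conv convDr//; [|exact: locBZ|exact: conv_locB].
rewrite convZr// conv_swap//.
have E1 u : 0 <= u -> conv ker_rep (res_fun x eta) u = res_fun x xi u + (- ip x xi) * 1.
  by move=> u0; rewrite (res_eq_adjoint x adj u0) mulr1 addrAC subrr add0r.
rewrite E1//.
have -> : conv b (conv ker_rep (res_fun x eta)) s =
    conv b (fun u => res_fun x xi u + (- ip x xi) * 1) s.
  apply: eq_intR => u; have [us|us] := boolP (0 <= u <= s); last first.
    by rewrite /chi (negbTE us) !mul0r.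
  by rewrite E1//; lra.
rewrite convDr//; last exact: locBZ.
by rewrite convZr// /ker_rep; ring.
Qed.

Lemma res_conv_adjoint xi eta x s : adjoint_pair ip DA A xi eta -> DA x ->
  res_conv (A x) xi s = res_conv x eta s.
Proof.
move=> adj Dx; rewrite /res_conv.
suff -> : res_fun (A x) xi = res_fun x eta by [].
apply/funext => u; have [u0|u0] := leP 0 u; last by rewrite !res_fun_neg.
have [_ _ [_ [_ RA]] _] := rP; have [DR ARE] := RA _ _ u0 Dx.
by rewrite !res_funE// -ARE adj.
Qed.

(** Riesz supplies the vectors; they form an adjoint pair because the resolvent commutes with [A].
    This makes them admissible in the weak equation. *)
Lemma res_conv_riesz xi eta s : adjoint_pair ip DA A xi eta -> exists xi' eta',
  [/\ adjoint_pair ip DA A xi' eta', (forall x, res_conv x xi s = ip x xi') &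
      (forall x, res_conv x eta s = ip x eta')].
Proof.
move=> adj; have [C C0 hC] := res_conv_le s.
have rz h : exists y, forall x, res_conv x h s = ip x y.
  apply: (riesz ipP (C := C * `|h|)) => [x y|k x|x].
  - exact: res_convDl.
  - exact: res_convZl.
  - by rewrite mulrAC hC.
have [xi' hxi] := rz xi; have [eta' heta] := rz eta; exists xi', eta'; split => //.
by move=> x Dx; rewrite -hxi -heta; exact: res_conv_adjoint.
Qed.

End resolvent_calculus.

(** * Measurability in time and chance jointly *)

Section joint_measurability.
Variables (R : realType) (H : completeNormedModType R) (ip : H -> H -> R).
Notation mu := (@lebesgue_measure R).
Hypothesis ipP : is_inner_product ip.
Let sip := ip_semi ipP.
Context d (Omega : measurableType d) (P : probability Omega R).

Lemma wmeas_comp d1 d2 (T1 : measurableType d1) (T2 : measurableType d2) (f : T2 -> H)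
    (g : T1 -> T2) : measurable_fun setT g -> wmeas ip setT f ->
  wmeas ip setT (fun w => f (g w)).
Proof.
by move=> mg mf h; exact: (measurableT_comp (mf h) mg).
Qed.

(** Time is rounded up to a grid of mesh [n.+1%:R^-1], so that right continuity alone gives the
    limit of the finite sums. *)
Lemma cadlag_joint_wmeas (Z : R -> Omega -> H) (T : R) :
  (forall w, cadlag (Z^~ w)) -> (forall t, 0 <= t -> wmeas ip setT (Z t)) ->
  wmeas ip setT (fun p : R * Omega => chi T p.1 *: Z p.1 p.2).
Proof.
move=> cZ mZ h.
pose ind (k n : nat) (x : R) : R := \1_(`[k%:R, k.+1%:R[%classic) (x * n.+1%:R).
have indE k n x : 0 <= x -> ind k n x = (k == Num.truncn (x * n.+1%:R))%:R.
  move=> x0; rewrite /ind indicE mem_setE in_itv /=; congr (nat_of_bool _)%:R.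
  by rewrite eq_sym truncn_eq// mulr_ge0.
pose f n (p : R * Omega) := chi T p.1 *
  \sum_(k < (Num.truncn (T * n.+1%:R)).+1) ind k n p.1 * ip (Z (k.+1%:R / n.+1%:R) p.2) h.
apply: (@measurable_fun_cvg _ _ _ setT f) => [n|[s w] _].
  apply: measurable_funM; first by apply: measurable_chi => //; exact: measurable_fst.
  apply: measurable_sum => k; apply: measurable_funM.
    apply: (@measurableT_comp _ _ _ _ _ _ (\1_(`[(k : nat)%:R, k.+1%:R[%classic) : R -> R)).
      exact: measurable_indic.
    by apply: measurable_funM => //; exact: measurable_fst.
  apply: (@measurableT_comp _ _ _ _ _ _ (fun w => ip (Z (k.+1%:R / n.+1%:R) w) h)).
    by apply: mZ; rewrite divr_ge0.
  exact: measurable_snd.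
rewrite /f /= (sipZl sip).
have [sT|sT] := boolP (0 <= s <= T); last first.
  rewrite /chi (negbTE sT) mul0r; under eq_cvg do rewrite mul0r; exact: cvg_cst.
have /andP[s0 sT'] := sT.
have fE n : \sum_(k < (Num.truncn (T * n.+1%:R)).+1) ind k n s * ip (Z (k.+1%:R / n.+1%:R) w) h =
    ip (Z ((Num.truncn (s * n.+1%:R)).+1%:R / n.+1%:R) w) h.
  have lt : (Num.truncn (s * n.+1%:R) < (Num.truncn (T * n.+1%:R)).+1)%N.
    by rewrite ltnS; apply: le_truncn; rewrite ler_wpM2r.
  rewrite (bigD1 (Ordinal lt))//= indE// eqxx mul1r big1 ?addr0// => k hk.
  rewrite indE// (_ : (k : nat) == _ = false) ?mul0r//.
  by apply: contra_neqF hk => /eqP hk; apply/val_inj.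
apply/cvg_seqP => e e0.
have h1 : 0 < `|h| + 1 by rewrite ltr_wpDl.
have [/(_ _ (divr_gt0 e0 h1))[del del0 hdel] _] := cZ w _ s0.
exists (Num.truncn del^-1) => n nN.
rewrite (chiE sT) !mul1r fE -(sipBl sip) (le_lt_trans (ip_CS ipP _ _))//.
have n0 : 0 < n.+1%:R :> R by [].
have /hdel : s <= (Num.truncn (s * n.+1%:R)).+1%:R / n.+1%:R < s + del.
  have s1 : 0 <= s * n.+1%:R by rewrite mulr_ge0.
  rewrite ler_pdivlMr// ltr_pdivrMr//.
  have /andP[+ +] := truncn_itv s1.
  rewrite -natr1 mulrDl => h2 /ltW -> /=.
  have : 1 < del * n.+1%:R.
    rewrite -ltr_pdivrMl// mulr1 (lt_le_trans (truncnS_gt _))// ler_nat ltnS//.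
  lra.
rewrite ltr_pdivlMr// => /(le_lt_trans _); apply.
by rewrite ler_wpM2l// lerDl.
Qed.

Lemma predictable_sets_measurable (F : R -> set (set Omega)) (T : R) :
  filtration F -> predictable_sets F T `<=` measurable.
Proof.
move=> [Fm _] C; apply; split.
  split.
  - exact: measurable0.
  - by move=> B mB; apply: measurableD => //; exact: measurableX.
  - by move=> B mB; exact: bigcupT_measurable.
move=> B [[E [FE ->]]|[s [u [E [_ _ _ FE ->]]]]].
- by apply: measurableX => //; exact: (Fm 0).2.
- by apply: measurableX => //; exact: (Fm s).2.
Qed.

Lemma predictable_joint_wmeas (F : R -> set (set Omega)) (T : R) (X : R -> Omega -> H) :
  filtration F -> predictable F T X ->
  wmeas ip setT (fun p : R * Omega => chi T p.1 *: X p.1 p.2).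
Proof.
move=> Ff pX h.
have mD : measurable (`[0, T]%classic `*` [set: Omega]) by exact: measurableX.
rewrite (_ : (fun w => _) =
    (fun p : R * Omega => ip (X p.1 p.2) h) \_ (`[0, T]%classic `*` setT)); last first.
  apply/funext => p; rewrite patchE (sipZl sip) /chi.
  have -> : (p \in `[0, T]%classic `*` [set: Omega]) = (0 <= p.1 <= T).
    by apply/idP/idP; rewrite inE /= in_itv /= => // -[].
  by case: ifP; rewrite ?mul1r ?mul0r.
apply: (measurable_restrictT _ _).1 => //.
apply: (measurability _ (RGenOInfty.measurableE R)) => _ [_ [a ->] <-].
have := pX [set x | a < ip x h] _.
rewrite (_ : _ `&` _ = [set p | p.1 \in `[0, T] /\ [set x | a < ip x h] (X p.1 p.2)]).
  move=> h'; apply: (predictable_sets_measurable Ff); apply: h'; apply: open_borelH.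
  apply: (@open_comp _ _ (fun x => ip x h) [set y | a < y]); last exact: open_gt.
  by move=> x _; exact: ipl_continuous.
by apply/seteqP; split => p /=; rewrite !in_itv /= ?andbT; [move=> [[? _] ?]|move=> [? ?]].
Qed.

(** The null set may vary with [s]. By Tonelli the double integral of the absolute value is zero, so
    almost every path vanishes for almost every [s]. *)
Lemma ae_swap_intR0 (f : R * Omega -> R) : measurable_fun setT f ->
  (forall s, {ae P, forall w, f (s, w) = 0}) -> {ae P, forall w, intR (fun s => f (s, w)) = 0}.
Proof.
move=> mf f0.
have maf : measurable_fun setT (fun p => `|f p|%:E).
  by apply/measurable_EFinP; exact: measurableT_comp.
have I0 : (\int[P]_w \int[mu]_s `|f (s, w)|%:E = 0)%E.
  rewrite -(@fubini_tonelli _ _ _ _ R mu P (fun p => `|f p|%:E))//.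
  apply: integral0_eq => s _.
  have : (\int[P]_w `|(EFin \o (fun w => f (s, w))) w| = 0)%E.
    apply/(ae_eq_integral_abs P measurableT).
      by apply/measurable_EFinP; apply: measurableT_comp => //; exact: measurable_pair1.
    by apply: ae_imp (f0 s) => w /= ->.
  by [].
have : {ae P, forall w, (\int[mu]_s `|f (s, w)|%:E = 0)%E}.
  have mG : measurable_fun setT (fun w => \int[mu]_s `|f (s, w)|%:E)%E.
    exact: (@measurable_fun_fubini_tonelli_G _ _ _ _ _ mu (fun p => `|f p|%:E)).
  have /(ae_eq_integral_abs P measurableT mG) :
      (\int[P]_w `|\int[mu]_s `|f (s, w)|%:E| = 0)%E.
    rewrite -[RHS]I0; apply: eq_integral => w _; rewrite gee0_abs//.
    by apply: integral_ge0 => s _; rewrite lee_fin.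
  by apply: ae_imp => w; apply.
apply: ae_imp => w hw.
have mfw : measurable_fun setT (fun s => f (s, w)).
  by apply: measurableT_comp => //; exact: measurable_pair2.
rewrite (@intR_ae_eq R _ (fun=> 0))// ?intR0//.
have /(ae_eq_integral_abs mu measurableT) : (\int[mu]_s `|(EFin \o (fun s => f (s, w))) s| = 0)%E.
  by rewrite -[RHS]hw.
move=> /(_ (ltac:(exact/measurable_EFinP))); apply: ae_imp => s /(_ I) /= [].
by [].
Qed.

End joint_measurability.

(** * The weak equation tested with a moving adjoint pair *)

Section weak_solution.
Variables (R : realType) (H : completeNormedModType R) (ip : H -> H -> R).
Notation mu := (@lebesgue_measure R).
Hypothesis ipP : is_inner_product ip.
Let sip := ip_semi ipP.
Variables (DA : set H) (A : H -> H) (a : R -> R) (Rs : R -> H -> H).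
Hypothesis clA : closed_densely_defined DA A.
Hypothesis La : loc_integrable_Rplus a.
Hypothesis rP : resolvent_family ip DA A a Rs.
Variables (c : R) (b : R -> R).
Hypothesis Lb : locL1 b.
Hypothesis aE : {ae mu, forall x : R, 0 < x -> rpos a x = ker_rep c b x}.
Variables (D0 : set H) (e : nat -> H).
Hypothesis eP : basis_in ip D0 e.
Context d (Omega : measurableType d) (P : probability Omega R).
Variables (X Z : R -> Omega -> H) (T : R).
Hypothesis cZ : forall w, cadlag (Z^~ w).
Hypothesis mX : wmeas ip setT (fun p : R * Omega => chi T p.1 *: X p.1 p.2).
Hypothesis mZ : wmeas ip setT (fun p : R * Omega => chi T p.1 *: Z p.1 p.2).
Hypothesis LX : forall w, mu.-integrable `[0, T] (fun s => (`|X s w|)%:E).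
Hypothesis weak : forall t xi eta, 0 <= t <= T -> adjoint_pair ip DA A xi eta ->
  {ae P, forall w, ip (X t w) xi =
    Rintegral mu `[0, t] (fun s => ip (a (t - s) *: X s w) eta) + ip (Z t w) xi}.

Local Notation g := (res_conv ip Rs c b).
Local Notation K := (ker_rep c b).
Let XX (p : R * Omega) : H := chi T p.1 *: X p.1 p.2.
Let ZZ (p : R * Omega) : H := chi T p.1 *: Z p.1 p.2.

Lemma res_conv_wmeas d' (S : measurableType d') (s : S -> R) (f : S -> H) h :
  measurable_fun setT s -> wmeas ip setT f ->
  measurable_fun setT (fun w => g (f w) h (s w)).
Proof.
move=> ms mf.
apply: (@wmeas_kernel _ _ _ D0 e eP _ _ setT (fun w x => g x h (s w))) => //.
- by move=> w x y _; exact: (res_convDl ipP rP c Lb).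
- by move=> w k x _; exact: (res_convZl ipP rP c Lb).
- move=> w _; have [C C0 hC] := res_conv_le ipP rP c Lb (s w).
  by exists (C * `|h|) => x; rewrite mulrAC hC.
- move=> x; apply: (measurableT_comp _ ms).
  exact: (res_conv_locB ipP rP c Lb x h).1.
Qed.

Let mXw w : wmeas ip setT (fun s : R => XX (s, w)).
Proof. by apply: (wmeas_comp _ mX); exact: measurable_pair2. Qed.

Let LXX w : L1 (fun s => `|XX (s, w)|).
Proof.
have := (integrable_chi T (fun s => `|X s w|)).1 (LX w).
rewrite (_ : (fun u => _) = fun s => `|XX (s, w)|)//.
by apply/funext => s; rewrite /XX normrZ ger0_norm// chi_ge0.
Qed.

Let ZZ_bounded w : 0 <= T -> exists2 C, 0 <= C & forall s, `|ZZ (s, w)| <= C.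
Proof.
move=> T0; have [C hC] := cadlag_bounded (cZ w) T0; exists `|C| => // s.
rewrite /ZZ normrZ /=; have [sT|sT] := boolP (0 <= s <= T); last first.
  by rewrite /chi (negbTE sT) normr0 mul0r.
by rewrite chiE// normr1 mul1r (le_trans (hC _ sT))// ler_norm.
Qed.

Section fixed_time.
Variable t : R.
Hypothesis tT : 0 <= t <= T.

Let chiT s : 0 <= s <= t -> chi T s = 1.
Proof. by move=> st; rewrite chiE//; have := tT; lra. Qed.

(** [E1], [E2] and [E3] are the solution, integral and noise terms of the weak equation at time
    [p.1], tested with the vectors representing [g] at [t - p.1] and set to zero outside
    [[0, t]]. *)
Let E1 xi (p : R * Omega) := chi t p.1 * g (XX p) xi (t - p.1).
Let KK eta w (p : R * R) :=
  chi t p.1 * (chi p.1 p.2 * (K (p.1 - p.2) * g (XX (p.2, w)) eta (t - p.1))).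
Let E2 eta (p : R * Omega) := intR (fun r => KK eta p.2 (p.1, r)).
Let E3 xi (p : R * Omega) := chi t p.1 * g (ZZ p) xi (t - p.1).

Let mE1 xi : measurable_fun setT (E1 xi).
Proof.
apply: measurable_funM; first by apply: measurable_chi => //; exact: measurable_fst.
by apply: res_conv_wmeas => //; apply: measurable_funB => //; exact: measurable_fst.
Qed.

Let mE3 xi : measurable_fun setT (E3 xi).
Proof.
apply: measurable_funM; first by apply: measurable_chi => //; exact: measurable_fst.
by apply: res_conv_wmeas => //; apply: measurable_funB => //; exact: measurable_fst.
Qed.

Let mE2 eta : measurable_fun setT (E2 eta).
Proof.
apply: (@measurable_intR_param R _ _
  (fun z : (R * Omega) * R => KK eta z.1.2 (z.1.1, z.2))).
have m11 : measurable_fun setT (fun z : (R * Omega) * R => z.1.1).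
  by apply: (measurableT_comp measurable_fst); exact: measurable_fst.
have m12 : measurable_fun setT (fun z : (R * Omega) * R => z.1.2).
  by apply: (measurableT_comp measurable_snd); exact: measurable_fst.
have m2 : measurable_fun setT (fun z : (R * Omega) * R => z.2) by exact: measurable_snd.
apply: measurable_funM; first exact: measurable_chi.
apply: measurable_funM; first exact: measurable_chi.
apply: measurable_funM.
  apply: (measurableT_comp (ker_rep_locB c Lb).1); exact: measurable_funB.
have ms : measurable_fun setT (fun z : (R * Omega) * R => t - z.1.1) by exact: measurable_funB.
have mXX : wmeas ip setT (fun z : (R * Omega) * R => XX (z.2, z.1.2)).
  by apply: (wmeas_comp _ mX); exact: measurable_fun_pair.
exact: (res_conv_wmeas eta ms mXX).
Qed.

Let weak_pointwise xi eta s : adjoint_pair ip DA A xi eta ->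
  {ae P, forall w, E1 xi (s, w) - E2 eta (s, w) - E3 xi (s, w) = 0}.
Proof.
move=> adj; have [st|st] := boolP (0 <= s <= t); last first.
  apply: aeW => w; rewrite /E1 /E2 /E3 /KK /= /chi (negbTE st) !mul0r.
  rewrite (_ : intR _ = 0) ?subrr//; rewrite -[RHS]intR0; apply: eq_intR => r.
  by rewrite mul0r.
have [xi' [eta' [adj' hxi heta]]] := res_conv_riesz ipP rP c Lb (t - s) adj.
have sT : 0 <= s <= T by have := tT; lra.
apply: ae_imp (weak sT adj') => w hw.
rewrite /E1 /E2 /E3 /KK /= (chiE st) !mul1r !hxi /XX /ZZ /= (chiT st) !scale1r hw.
rewrite (_ : intR _ = Rintegral mu `[0, s] (fun r => ip (a (s - r) *: X r w) eta')).
  by rewrite addrAC addrK subrr.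
rewrite [RHS](_ : _ = Rintegral mu `[0, s] (fun r => a (s - r) * ip (XX (r, w)) eta')).
  rewrite (ker_replace La Lb aE).
    by apply: eq_intR => r; rewrite mul1r heta.
  apply: measurable_funM; first exact: measurable_chi.
  exact: mXw.
apply: eq_Rintegral => r; rewrite mem_setE in_itv /= => rs.
rewrite (sipZl sip) /XX /= chiT ?scale1r//; lra.
Qed.

Let KK_bound eta w : exists2 C, 0 <= C &
  forall s r, `|KK eta w (s, r)| <= (C * chi t s) * `|XX (r, w)|.
Proof.
have [C1 C10 hC1] := res_conv_le ipP rP c Lb t.
have [C2 hC2] := (ker_rep_locB c Lb).2 t.
exists (`|C2| * (C1 * `|eta|)) => [|s r]; first by rewrite !mulr_ge0.
rewrite /KK /=; have [st|st] := boolP (0 <= s <= t); last first.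
  by rewrite /chi (negbTE st) mul0r normr0 mulr0 mul0r.
have [rs|rs] := boolP (0 <= r <= s); last first.
  by rewrite [chi s r]/chi (negbTE rs) mul0r mulr0 normr0 !mulr_ge0// chi_ge0.
rewrite !chiE// !mul1r mulr1 normrM -mulrA ler_pM//.
  by rewrite (le_trans (hC2 _ _)) ?ler_norm//; lra.
by rewrite mulrAC hC1//; lra.
Qed.

Let mKK eta w : measurable_fun setT (KK eta w).
Proof.
have m1 : measurable_fun setT (fun z : R * R => z.1) by exact: measurable_fst.
have m2 : measurable_fun setT (fun z : R * R => z.2) by exact: measurable_snd.
apply: measurable_funM; first exact: measurable_chi.
apply: measurable_funM; first exact: measurable_chi.
apply: measurable_funM.
  apply: (measurableT_comp (ker_rep_locB c Lb).1); exact: measurable_funB.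
have ms : measurable_fun setT (fun z : R * R => t - z.1) by exact: measurable_funB.
exact: (res_conv_wmeas eta ms (wmeas_comp m2 (mXw w))).
Qed.

Let L1E1 xi w : L1 (fun s => E1 xi (s, w)).
Proof.
have [C C0 hC] := res_conv_le ipP rP c Lb t.
apply: (L1_le _ (L1Z (C * `|xi|) (LXX w))).
  by apply: (measurableT_comp (mE1 xi)); exact: measurable_pair2.
move=> s; rewrite /E1 /=; have [st|st] := boolP (0 <= s <= t); last first.
  by rewrite /chi (negbTE st) mul0r normr0 !mulr_ge0.
by rewrite chiE// mul1r mulrAC hC//; lra.
Qed.

Let L1E3 xi w : L1 (fun s => E3 xi (s, w)).
Proof.
have [C C0 hC] := res_conv_le ipP rP c Lb t.
have [|B B0 hB] := ZZ_bounded w; first by have := tT; lra.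
apply: (L1_le _ (L1Z (C * B * `|xi|) (L1_chi t))).
  by apply: (measurableT_comp (mE3 xi)); exact: measurable_pair2.
move=> s; rewrite /E3 /=; have [st|st] := boolP (0 <= s <= t); last first.
  by rewrite /chi (negbTE st) mul0r normr0 mulr0.
rewrite chiE// mul1r mulr1 (le_trans (hC _ _ _ _))//; first by lra.
by rewrite ler_wpM2r// ler_wpM2l.
Qed.

Let L1E2 eta w : L1 (fun s => E2 eta (s, w)).
Proof.
have [C C0 hC] := KK_bound eta w.
apply: (L1_le _ (L1Z (C * intR (fun r => `|XX (r, w)|)) (L1_chi t))).
  by apply: (measurableT_comp (mE2 eta)); exact: measurable_pair2.
move=> s; rewrite /E2 /= mulrAC -intRZ//.
have L1K : L1 (fun r => KK eta w (s, r)).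
  apply: (L1_le _ (L1Z (C * chi t s) (LXX w))) => [|r]; last exact: hC.
  by apply: (measurableT_comp (mKK eta w)); exact: measurable_pair1.
by rewrite (le_trans (intR_norm_le L1K))// le_intR//; [exact: L1_abs|exact: L1Z].
Qed.

(** Exchange the integrals and shift the inner variable by [r]: it becomes the convolution of the
    kernel with [g (X r, eta)] at [t - r], which [ker_rep_conv_res_conv] evaluates. The first
    resulting term is what later cancels [E1]. *)
Let intR_E2 xi eta w : adjoint_pair ip DA A xi eta ->
  intR (fun s => E2 eta (s, w)) =
  intR (fun r => E1 xi (r, w) - chi t r * (K (t - r) * ip (XX (r, w)) xi)).
Proof.
move=> adj; have [C C0 hC] := KK_bound eta w.
rewrite /E2 /= (intR_fubini (mKK eta w) hC (L1Z C (L1_chi t)) (LXX w)).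
apply: eq_intR => r; rewrite /E1 /= -mulrBr.
have [rt|rt] := boolP (0 <= r <= t); last first.
  rewrite [in RHS]/chi (negbTE rt) mul0r -[RHS]intR0; apply: eq_intR => s; rewrite /KK /=.
  have [st|st] := boolP (0 <= s <= t); last by rewrite /chi (negbTE st) mul0r.
  by rewrite [chi s r]/chi (_ : _ && _ = false) ?mul0r ?mulr0//; apply/negbTE; lra.
rewrite chiE// mul1r -(ker_rep_conv_res_conv ipP clA La rP Lb aE _ adj); last by lra.
rewrite -(intR_shift r); last first.
  by apply: (measurableT_comp (mKK eta w)); exact: measurable_pair2.
apply: eq_intR => v; rewrite /KK /= mulrA; congr (_ * _); last first.
  by congr (K _ * g _ _ _); lra.
by rewrite /chi -natrM mulnb; congr (nat_of_bool _)%:R; apply/idP/idP; lra.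
Qed.

Let L1K xi w : L1 (fun r => chi t r * (K (t - r) * ip (XX (r, w)) xi)).
Proof.
have [C2 hC2] := (ker_rep_locB c Lb).2 t.
apply: (L1_le _ (L1Z (`|C2| * `|xi|) (LXX w))).
  apply: measurable_funM; first exact: measurable_chi.
  by apply: measurable_funM; [exact: measurable_fun_reflect (ker_rep_locB c Lb).1|exact: mXw].
move=> s; have [st|st] := boolP (0 <= s <= t); last first.
  by rewrite /chi (negbTE st) mul0r normr0 !mulr_ge0.
rewrite chiE// mul1r normrM -mulrA ler_pM//; last by rewrite mulrC; exact: ip_CS.
by rewrite (le_trans (hC2 _ _)) ?ler_norm//; lra.
Qed.

Let weak_conv_adj xi eta : adjoint_pair ip DA A xi eta -> {ae P, forall w,
  intR (fun r => chi t r * (K (t - r) * ip (XX (r, w)) xi)) =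
  intR (fun s => chi t s * g (ZZ (s, w)) xi (t - s))}.
Proof.
move=> adj.
have : {ae P, forall w, intR (fun s => E1 xi (s, w) - E2 eta (s, w) - E3 xi (s, w)) = 0}.
  apply: (@ae_swap_intR0 _ _ _ P (fun p => E1 xi p - E2 eta p - E3 xi p)).
    by apply: measurable_funB => //; exact: measurable_funB.
  by move=> s; exact: weak_pointwise.
apply: ae_imp => w; rewrite intRB//; last exact: L1B.
rewrite intRB// (intR_E2 w adj) intRB// subKr => /eqP; rewrite subr_eq0 => /eqP.
by [].
Qed.

(* Test the weak equation at each time [s] against the vector representing
   [g (., xi)] at [t - s] and integrate over [s]: after exchanging the integrals the
   terms [g (X s, xi)] cancel. Density of [D(A^* )] extends the identity from [xi] to [h]. *)
Lemma weak_conv h : {ae P, forall w,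
  Rintegral mu `[0, t] (fun s => ip (a (t - s) *: X s w) h) =
  intR (fun s => chi t s * g (ZZ (s, w)) h (t - s))}.
Proof.
pose Df w h := intR (fun r => chi t r * (K (t - r) * ip (XX (r, w)) h)) -
  intR (fun s => chi t s * g (ZZ (s, w)) h (t - s)).
have DfE w : Rintegral mu `[0, t] (fun s => ip (a (t - s) *: X s w) h) =
    intR (fun r => chi t r * (K (t - r) * ip (XX (r, w)) h)).
  rewrite -(ker_replace La Lb aE).
    apply: eq_Rintegral => r; rewrite mem_setE in_itv /= => rs.
    by rewrite (sipZl sip) /XX /= chiT ?scale1r.
  by apply: measurable_funM; [exact: measurable_chi|exact: mXw].
have DfD w x y : Df w (x + y) = Df w x + Df w y.
  rewrite /Df addrACA -intRD// -opprD -intRD; try exact: (L1E3 _ w).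
  congr (_ - _); apply: eq_intR => s; first by rewrite (sipDr sip) !mulrDr.
  by rewrite (res_convDr ipP rP c Lb)// mulrDr.
have Dfle w : exists C, forall h, `|Df w h| <= C * `|h|.
  have [C2 hC2] := (ker_rep_locB c Lb).2 t.
  have [C C0 hC] := res_conv_le ipP rP c Lb t.
  have [|B B0 hB] := ZZ_bounded w; first by have := tT; lra.
  exists (`|C2| * intR (fun r => `|XX (r, w)|) + C * B * intR (chi t)) => k.
  rewrite mulrDl (le_trans (ler_normB _ _))// lerD//.
    rewrite mulrAC -intRZ// (le_trans (intR_norm_le (L1K k w)))// le_intR//.
    - exact/L1_abs/L1K.
    - exact: L1Z.
    move=> s; have [st|st] := boolP (0 <= s <= t); last first.
      by rewrite /chi (negbTE st) mul0r normr0 !mulr_ge0.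
    rewrite chiE// mul1r normrM -mulrA ler_pM//; last by rewrite mulrC; exact: ip_CS.
    by rewrite (le_trans (hC2 _ _)) ?ler_norm//; lra.
  rewrite mulrAC -intRZ; last exact: L1_chi.
  rewrite (le_trans (intR_norm_le (L1E3 k w)))// le_intR//.
  - exact/L1_abs/L1E3.
  - exact/L1Z/L1_chi.
  move=> s; rewrite /E3 /=; have [st|st] := boolP (0 <= s <= t); last first.
    by rewrite /chi (negbTE st) mul0r normr0 mulr0.
  rewrite chiE// mul1r mulr1 (le_trans (hC _ _ _ _))//; first by lra.
  by rewrite ler_wpM2r// ler_wpM2l.
(* Countably many approximants of [h], one for each [n], so their null sets can be united. *)
have : {ae P, forall w, forall n : nat, exists2 k, `|h - k| < n.+1%:R^-1 & Df w k = 0}.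
  apply: ae_foralln => n.
  have [k [eta adj] hk] := dom_adjoint_dense ipP clA h (ltac:(by []) : 0 < (n.+1%:R^-1 : R)).
  by apply: ae_imp (weak_conv_adj adj) => w hw; exists k => //; rewrite /Df hw subrr.
apply: ae_imp => w hw; rewrite DfE; apply/eqP; rewrite -subr_eq0 -/(Df w h); apply/eqP.
have [C hC] := Dfle w.
apply: (additive_limit_zero (DfD w) hC) => del del0.
have [k hk Dk] := hw (Num.truncn del^-1); exists k => //.
rewrite (lt_trans hk)// -[ltRHS]invrK ltf_pV2 ?posrE ?invr_gt0//.
exact: truncnS_gt.
Qed.

End fixed_time.
End weak_solution.

(** * Convergence of the Riemann sums *)

Section path_convergence.
Variables (R : realType) (H : completeNormedModType R) (ip : H -> H -> R).
Notation mu := (@lebesgue_measure R).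
Hypothesis ipP : is_inner_product ip.
Let sip := ip_semi ipP.
Variables (DA : set H) (A : H -> H) (a : R -> R) (Rs : R -> H -> H).
Hypothesis clA : closed_densely_defined DA A.
Hypothesis La : loc_integrable_Rplus a.
Hypothesis rP : resolvent_family ip DA A a Rs.
Variables (c : R) (b : R -> R).
Hypothesis Lb : locL1 b.
Hypothesis aE : {ae mu, forall x : R, 0 < x -> rpos a x = ker_rep c b x}.
Variables (D0 : set H) (e : nat -> H).
Hypothesis eP : basis_in ip D0 e.
Variables (z : R -> H) (T t : R).
Hypothesis cz : cadlag z.
Hypothesis z0 : z 0 = 0.
Hypothesis mz : wmeas ip setT (fun s : R => chi T s *: z s).
Hypothesis t0 : 0 < t.
Hypothesis tT : t <= T.

Local Notation g := (res_conv ip Rs c b).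

Section one_partition.
Variables (n : nat) (p s : nat -> R) (del : R).
Hypothesis part : tagged_partition t n p s del.

Let Dl i : H := z (t - p i) - z (t - p i.+1).
Let V (u : R) : H := \sum_(i < n) chi (s i) u *: Dl i.

Let p_mono i j : (i <= j)%N -> (j <= n)%N -> p i <= p j.
Proof.
have [_ _ pS _ _] := part; move=> ij; elim: j ij => [|j IH].
  by rewrite leqn0 => /eqP ->.
rewrite leq_eqVlt => /predU1P[->//|]; rewrite ltnS => ij jn.
by rewrite (le_trans (IH ij (ltnW jn)))// ltW// pS.
Qed.

Let p_itv i : (i <= n)%N -> 0 <= p i <= t.
Proof.
by have [p0 pn _ _ _] := part; move=> i_n; rewrite -{1}p0 -pn !p_mono.
Qed.

Let s_itv i : (i < n)%N -> 0 <= s i <= t.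
Proof.
have [_ _ _ ps _] := part; move=> i_n; have := ps i i_n.
have := p_itv (ltnW i_n); have := p_itv i_n; lra.
Qed.

Lemma part_telescope m : \sum_(i < m) Dl i = z (t - p 0) - z (t - p m).
Proof.
elim: m => [|m IH]; first by rewrite big_ord0 subrr.
by rewrite big_ord_recr /= IH /Dl addrA subrK.
Qed.

(** The tags increase with the index, so those at least [u] form a final segment starting at some
    [j]. The sum telescopes to [z (t - p j)] because [z 0 = 0], and [s j.-1 < u <= s j] places [p j]
    within the mesh of [u]; [j = n] when all tags lie below [u]. *)
Lemma part_sum_step (u : R) : 0 <= u <= t -> exists th,
  [/\ 0 <= th <= t, `|th - u| < del & V u = z (t - th)].
Proof.
have [p0 pn pS ps pd] := part; move=> ut.
have n0 : (0 < n)%N.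
  by rewrite lt0n; apply/eqP => n0; have := t0; rewrite -pn n0 p0 ltxx.
have step m : (m <= n)%N -> exists j, [/\ (j <= m)%N,
    \sum_(i < m) chi (s i) u *: Dl i = z (t - p j) - z (t - p m),
    (forall i, (i < j)%N -> s i < u) & (j < m)%N -> u <= s j].
  elim: m => [_|m IH mn].
    by exists 0%N; split => //; rewrite big_ord0 subrr.
  have [j [jm E hj uj]] := IH (ltnW mn).
  have [um|um] := leP u (s m); last first.
    move: jm; rewrite leq_eqVlt => /predU1P[jm|jm].
      exists m.+1; split => //.
      - rewrite big_ord_recr /= E jm subrr /chi (lt_geF um) andbF scale0r.
        by rewrite addr0 subrr.
      - move=> i; rewrite ltnS leq_eqVlt => /predU1P[->//|]; rewrite -jm; exact: hj.
      - by rewrite ltnn.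
    exfalso; have := uj jm; have := ps j (ltn_trans jm mn); have := ps m mn.
    have := p_mono jm (ltnW mn); lra.
  exists j; split => //; first exact: leqW.
    rewrite big_ord_recr /= E chiE; last by lra.
    by rewrite scale1r /Dl addrA subrK.
  by rewrite ltnS leq_eqVlt => /predU1P[->|/uj].
have [j [jn E hj uj]] := step n (leqnn n).
exists (p j); split; first exact: p_itv.
- rewrite ltr_norml; apply/andP; split.
    move: jn; rewrite leq_eqVlt => /predU1P[->|jn].
      by rewrite pn; have := pd 0%N n0; have := pS 0%N n0; lra.
    by have := uj jn; have := ps j jn; have := pd j jn; lra.
  case: j hj {jn uj E} (jn) => [|j] hj jn.
    by rewrite p0; have := pd 0%N n0; have := pS 0%N n0; rewrite p0; lra.
  by have := hj j (ltnSn j); have := ps j jn; have := pd j jn; lra.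
- by rewrite /V E pn subrr z0 subr0.
Qed.

Let gD x y h u := res_convDl ipP rP c Lb x y h u.
Let gZ k x h u := res_convZl ipP rP c Lb k x h u.

Lemma part_sum_measurable h : measurable_fun setT (fun u => chi t u * g (V u) h u).
Proof.
apply: measurable_funM; first exact: measurable_chi.
apply: (res_conv_wmeas ipP rP c Lb eP h (@measurable_id _ _ _)).
apply: wmeas_sum => // i.
apply: (@wmeasZ _ _ _ ipP _ _ setT (chi (s i)) (fun=> Dl i)); last exact: wmeas_cst.
exact: measurable_chi.
Qed.

(* Summation by parts: each term is [Dl i + int_0^(s i) g_u (Dl i) du], and at a fixed
   [u] the increments with [s i >= u] telescope. *)
Lemma part_sum_ip xi eta : adjoint_pair ip DA A xi eta ->
  ip (\sum_(i < n) Rs (s i) (Dl i)) xi = ip (z t) xi + intR (fun u => chi t u * g (V u) eta u).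
Proof.
move=> adj; have [p0 pn _ _ _] := part.
rewrite (sip_suml sip).
have -> : \sum_(i < n) ip (Rs (s i) (Dl i)) xi =
    \sum_(i < n) (ip (Dl i) xi + intR (fun u => chi (s i) u * g (Dl i) eta u)).
  apply: eq_bigr => i _.
  by apply: (res_eq_int ipP clA La rP Lb aE _ adj); case/andP: (s_itv (ltn_ord i)).
rewrite big_split /= -(sip_suml sip) part_telescope p0 subr0 pn subrr z0 subr0; congr (_ + _).
have [i|_ ->] := @intR_sum _ n (fun i u => chi (s i) u * g (Dl i) eta u).
  by move=> _; apply: (locB_locL1 (res_conv_locB ipP rP c Lb _ _)).2.
apply: eq_intR => u; rewrite /V.
have -> : g (\sum_(i < n) chi (s i) u *: Dl i) eta u =
    \sum_(i < n) chi (s i) u * g (Dl i) eta u.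
  elim/big_rec2 : _ => [|i y x _ <-]; last by rewrite gD gZ.
  by rewrite -[X in g X](scale0r (0 : H)) gZ mul0r.
rewrite mulr_sumr; apply: eq_bigr => i _; rewrite mulrA; congr (_ * _).
rewrite /chi -natrM mulnb; congr (nat_of_bool _)%:R.
by have si := s_itv (ltn_ord i); apply/idP/idP; lra.
Qed.

End one_partition.

(** The sums see [z] at [t - th] with [th] close to [u] on either side, so the integrands converge
    where [z] is continuous at [t - u]. The exceptional [u] form a reflected countable set, and
    boundedness of the path gives the dominating function. *)
Lemma conv_sum_ip_cvg (n : nat -> nat) (p s : nat -> nat -> R) xi eta :
  (forall k, tagged_partition t (n k) (p k) (s k) k.+1%:R^-1) ->
  adjoint_pair ip DA A xi eta ->
  (fun k => ip (\sum_(i < n k) Rs (s k i) (z (t - p k i) - z (t - p k i.+1))) xi) @ \oo -->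
  ip (z t) xi + intR (fun u => chi t u * g (chi T u *: z u) eta (t - u)).
Proof.
move=> part adj.
under eq_cvg do rewrite (part_sum_ip (part _) adj).
apply: cvgD; first exact: cvg_cst.
pose W (u : R) : H := chi T (t - u) *: z (t - u).
have mW : measurable_fun setT (fun u => chi t u * g (W u) eta u).
  apply: measurable_funM; first exact: measurable_chi.
  apply: (res_conv_wmeas ipP rP c Lb eP eta (@measurable_id _ _ _)).
  exact: (wmeas_comp (measurable_reflect t) mz).
rewrite -(intR_reflect t); last first.
  apply: measurable_funM; first exact: measurable_chi.
  exact: (res_conv_wmeas ipP rP c Lb eP eta (measurable_reflect t) mz).
rewrite (_ : intR _ = intR (fun u => chi t u * g (W u) eta u)); last first.
  by apply: eq_intR => u; rewrite chi_reflect subKr.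
have [Cz hCz] := cadlag_bounded cz (ltW t0).
have [C C0 hC] := res_conv_le ipP rP c Lb t.
apply: (@intR_dominated _ _ _ (fun u => C * `|Cz| * `|eta| * chi t u)).
- by move=> k; exact: part_sum_measurable.
- exact: mW.
- have nd : mu.-negligible [set u | [set r | 0 <= r <= t /\ ~ continuous_at_pt z r] (t - u)].
    apply: negligible_reflect; have cD := cadlag_countable_disc cz (ltW t0).
    apply/negligibleP; last exact: countable_lebesgue_measure0.
    exact: countable_measurable.
  apply: negligibleS nd => u /= hu.
  have [ut|ut] := boolP (0 <= u <= t); last first.
    case: hu; rewrite /chi (negbTE ut) mul0r; under eq_cvg do rewrite mul0r.
    exact: cvg_cst.
  split; first by lra.
  move=> cu; apply: hu; apply: cvgM; first exact: cvg_cst.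
  rewrite /W chiE ?scale1r; last by have := tT; lra.
  apply/cvg_seqP => ep ep0.
  have K0 : 0 < C * `|eta| + 1 by rewrite ltr_wpDl// mulr_ge0.
  have [del del0 hdel] := cu _ (divr_gt0 ep0 K0).
  exists (Num.truncn del^-1) => k hk.
  have [th [tht thu ->]] := part_sum_step (part k) ut.
  rewrite -[- g _ _ _]mulN1r -(res_convZl ipP rP c Lb) -(res_convDl ipP rP c Lb) scaleN1r.
  rewrite (le_lt_trans (hC _ _ _ _))//; first by lra.
  have : `|z (t - th) - z (t - u)| < ep / (C * `|eta| + 1).
    apply: hdel; first by lra.
    rewrite (_ : t - th - (t - u) = - (th - u)); last by lra.
    rewrite normrN (lt_trans thu)// -[ltRHS]invrK ltf_pV2 ?posrE ?invr_gt0//.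
    by rewrite (lt_le_trans (truncnS_gt _))// ler_nat ltnS.
  rewrite ltr_pdivlMr// => /(le_lt_trans _); apply.
  by rewrite mulrAC mulrC ler_wpM2l// lerDl.
- exact/L1Z/L1_chi.
- move=> k u; have [ut|ut] := boolP (0 <= u <= t); last first.
    by rewrite /chi (negbTE ut) mul0r normr0 mulr0.
  rewrite chiE// mul1r mulr1.
  have [th [tht thu ->]] := part_sum_step (part k) ut.
  rewrite (le_trans (hC _ _ _ _))//; first by lra.
  rewrite ler_wpM2r// ler_wpM2l// (le_trans (hCz _ _)) ?ler_norm//; lra.
Qed.

End path_convergence.

(** * From coordinates to the norm, and conclusion *)

Section convergence_in_probability.
Variables (R : realType) (H : completeNormedModType R) (ip : H -> H -> R).
Hypothesis ipP : is_inner_product ip.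
Let sip := ip_semi ipP.
Variables (D0 : set H) (e : nat -> H).
Hypothesis eP : basis_in ip D0 e.
Context d (Omega : measurableType d) (P : probability Omega R).

Lemma pr_eventually_ae (S : nat -> set Omega) : (forall n, measurable (S n)) ->
  {ae P, forall w, exists N, forall n, (N <= n)%N -> ~ S n w} ->
  forall eta, 0 < eta -> exists N, forall n, (N <= n)%N -> pr P (S n) <= eta.
Proof.
move=> mS [B [mB PB hB]] eta eta0.
have [n||N hN] := @pr_eventually _ _ _ P (fun n => S n `\` B) _ _ _ eta0.
- exact: measurableD.
- move=> w; have [Bw|Bw] := pselect (B w); first by exists 0%N => n _ [].
  apply: contrapT => h; apply: Bw; apply: hB => /= -[N hN].
  by apply: h; exists N => n /hN ? [].
exists N => n /hN; apply: le_trans.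
have prB : pr P B = 0 by rewrite /pr PB.
have mD : measurable (S n `\` B) by exact: measurableD.
rewrite (@le_trans _ _ (pr P ((S n `\` B) `|` B)))//.
  apply: le_pr => //; first exact: measurableU.
  by move=> w Sw; have [Bw|Bw] := pselect (B w); [right|left].
by rewrite (le_trans (prU P mD mB))// prB addr0.
Qed.

(** Fix [N] first, making the tails of all [S k] and of [Y] small at once; only then is [k] taken
    large, for the finitely many coordinates left. *)
Lemma weak_tight_cvg (S : nat -> Omega -> H) (Y : Omega -> H) :
  (forall k, wmeas ip setT (S k)) -> wmeas ip setT Y ->
  (forall i, {ae P, forall w, (fun k => ip (S k w) (e i)) @ \oo --> ip (Y w) (e i)}) ->
  (forall e0 eta : R, 0 < e0 -> 0 < eta -> exists N0, forall N, (N0 <= N)%N ->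
     forall k, pr P [set w | e0 < `|coproj ip e N (S k w)|] <= eta) ->
  forall e0 eta : R, 0 < e0 -> 0 < eta -> exists K, forall k, (K <= k)%N ->
    pr P [set w | e0 < `|S k w - Y w|] <= eta.
Proof.
move=> mS mY cv tight e0 eta e00 eta0.
have e3 : 0 < e0 / 3 by rewrite divr_gt0.
have eta3 : 0 < eta / 3 by rewrite divr_gt0.
have [N1 hN1] := tight _ _ e3 eta3.
have mQ n f : wmeas ip setT f -> measurable [set w : Omega | e0 / 3 < `|coproj ip e n (f w)|].
  by move=> mf; apply/measurable_gt/(wmeas_norm ipP eP)/(wmeas_coproj ipP eP).
have [n|w|N2 hN2] := @pr_eventually _ _ _ P
    (fun n => [set w | e0 / 3 < `|coproj ip e n (Y w)|]) _ _ _ eta3.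
- exact: mQ.
- have [_ _ _ /(_ (Y w) _ e3)[N hN]] := eP.
  by exists N => n /hN /ltW; rewrite leNgt => /negP.
pose N := maxn N1 N2.
pose G k w := \sum_(i < N) `|ip (S k w) (e i) - ip (Y w) (e i)| * `|e i|.
have mG k : measurable_fun setT (G k).
  apply: measurable_sum => i; apply: measurable_funM => //.
  apply: measurableT_comp => //; apply: measurable_funB; [exact: mS|exact: mY].
have [k||K hK] := @pr_eventually_ae (fun k => [set w | e0 / 3 < G k w]) _ _ _ eta3.
- exact: measurable_gt.
- have := ae_foralln cv; apply: ae_imp => w cw.
  have : (fun k => G k w) @ \oo --> \sum_(i < N) `|ip (Y w) (e i) - ip (Y w) (e i)| * `|e i|.
    apply: (@cvg_big _ _ +%R) => [|i _]; first exact: add_continuous.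
    apply: cvgM; last exact: cvg_cst.
    by apply: cvg_norm; apply: cvgB; [exact: cw|exact: cvg_cst].
  rewrite big1 => [|i _]; last by rewrite subrr normr0 mul0r.
  move=> /cvg_seqP /(_ _ e3)[K hK]; exists K => n /hK; rewrite subr0 => /ltW.
  by move=> /(le_trans (ler_norm _)) h; apply/negP; rewrite -leNgt.
exists K => k Kk.
have mA : measurable [set w | e0 / 3 < G k w] by exact: measurable_gt.
have mB := mQ N _ (mS k); have mC := mQ N _ mY.
have mBC := measurableU _ _ mB mC.
rewrite (@le_trans _ _ (pr P ([set w | e0 / 3 < G k w] `|`
  ([set w | e0 / 3 < `|coproj ip e N (S k w)|] `|` [set w | e0 / 3 < `|coproj ip e N (Y w)|]))))//.
  apply: le_pr.
  - by apply/measurable_gt/(wmeas_norm ipP eP)/wmeasB.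
  - exact: measurableU.
  move=> w /= hw; apply: contrapT => /not_orP[/negP + /not_orP[/negP + /negP]].
  rewrite -!leNgt => h1 h2 h3; move: hw; apply/negP; rewrite -leNgt.
  have -> : S k w - Y w = \sum_(i < N) (ip (S k w) (e i) - ip (Y w) (e i)) *: e i +
      coproj ip e N (S k w) - coproj ip e N (Y w).
    rewrite /coproj; under eq_bigr do rewrite scalerBl.
    rewrite sumrB; set x := \sum_(i < N) _; set y := \sum_(i < N) _.
    by rewrite opprB [x - y + _]addrAC [x + _]addrC subrK addrA subrK.
  rewrite (le_trans (ler_normB _ _))// (_ : e0 = e0 / 3 + e0 / 3 + e0 / 3); last by field.
  rewrite lerD// (le_trans (ler_normD _ _))// lerD// (le_trans _ h1)//.
  rewrite (le_trans (ler_norm_sum _ _ _))// /G le_eqVlt; apply/orP; left; apply/eqP.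
  by apply: eq_bigr => i _; rewrite normrZ.
have := prU P mA mBC; have := prU P mB mC; have := hK k Kk.
have := hN1 N (leq_maxl _ _) k; have := hN2 N (leq_maxr _ _); lra.
Qed.

End convergence_in_probability.

(** Lets [cadlag_uniform] be applied to the orbits of the resolvent. *)
Lemma within_continuous_cadlag (R : realType) (V : normedModType R) (f : R -> V) :
  {within `[0, +oo[, continuous f} -> cadlag f.
Proof.
move=> cf t t0.
have loc (ep : R) : 0 < ep -> exists2 del : R, 0 < del &
    forall s, 0 <= s -> `|t - s| < del -> `|f s - f t| < ep.
  move=> ep0; have A0 : `[0, +oo[%classic t by rewrite /= in_itv /= t0.
  have /subspace_continuousP/(_ t A0)/cvgrPdist_lt/(_ _ ep0) := cf.
  move=> /nbhs_ballP[del /= del0 hdel].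
  exists del => // s s0 ts; rewrite distrC; apply: hdel => //=.
  by rewrite in_itv /= s0.
split=> [ep /loc[del del0 h]|tp].
  by exists del => // s hs; apply: h; [lra|rewrite ltr_norml; lra].
exists (f t) => ep /loc[del del0 h]; exists (Num.min del t) => [|s]; first by rewrite lt_min del0.
move=> /andP[+ st]; rewrite ltrBlDr -ltrBlDl lt_min => /andP[h1 h2].
by apply: h; [lra|rewrite ltr_norml; lra].
Qed.

Theorem theorem6 (R : realType) (H : completeNormedModType R)
  (ip : H -> H -> R) (DA : set H) (A : H -> H) (a : R -> R)
  (Rs : R -> H -> H)
  (d : measure_display) (Omega : measurableType d) (P : probability Omega R)
  (F : R -> set (set Omega)) (Z : R -> Omega -> H)
  (T : R) (X : R -> Omega -> H) :
  is_inner_product ip ->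
  separable_space H ->
  closed_densely_defined DA A ->
  loc_integrable_Rplus a ->
  resolvent_family ip DA A a Rs ->
  filtration F ->
  levy_process P Z ->
  W11_loc_Rplus a ->
  0 < T ->
  predictable F T X ->
  (forall w, (@lebesgue_measure R).-integrable
      `[0, T] (fun tau => (`|X tau w|)%:E)) ->
  (forall t xi eta, 0 <= t <= T -> adjoint_pair ip DA A xi eta ->
     {ae P, forall w,
        ip (X t w) xi =
        Rintegral lebesgue_measure `[0, t]
          (fun tau => ip (a (t - tau) *: X tau w) eta) + ip (Z t w) xi}) ->
  forall t, 0 <= t <= T -> is_stoch_conv P Rs Z t (X t).
Proof.
move=> ipP sepH clA La rP Ff lZ [_ [b [Lb weakb]]] _ pX LX weak t tT.
have [c aE] := W11_ae_rep La Lb weakb; have Lb' := rpos_locL1 Lb.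
(* The coordinates must be directions in which the weak equation can be tested. *)
have [e eP] : exists e, basis_in ip (dom_adjoint ip DA A) e.
  apply: (basis_in_exists ipP sepH).
  - by exists 0 => x _; rewrite !(sip0r (ip_semi ipP)).
  - exact: dom_adjointD.
  - exact: dom_adjointZ.
  - exact: dom_adjoint_dense.
have edom i : dom_adjoint ip DA A (e i) by have [] := eP.
have mX := predictable_joint_wmeas ipP Ff pX.
have mZ := cadlag_joint_wmeas ipP T (levy_cadlag lZ) (fun t => @levy_wmeas _ _ _ ipP _ _ _ _ lZ t).
have [[Z0 _] _ _ _ _] := lZ.
have [RD [RZ RM] [RC _] _] := rP.
have [M0 hM0] := RM T; pose M := `|M0| + 1.
have M_gt0 : 0 < M by rewrite ltr_wpDl.
have hM s x : 0 <= s <= t -> `|Rs s x| <= M * `|x|.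
  move=> st; rewrite (le_trans (hM0 _ _ _))//; first by lra.
  by rewrite ler_wpM2r// (le_trans (ler_norm _))// lerDl.
have mXt : wmeas ip setT (X t).
  have := wmeas_comp (measurable_pair1 t) mX; rewrite (_ : (fun w => _) = X t)//.
  by apply/funext => w /=; rewrite chiE// scale1r.
have mS n p s del : tagged_partition t n p s del ->
    wmeas ip setT (conv_riemann_sum Rs Z t n p s).
  exact: (conv_sum_wmeas ipP eP lZ RD RZ hM).
move=> e0 eta e00 eta0; apply: contrapT => hneg.
have eta2 : 0 < eta / 2 by rewrite divr_gt0.
(* If convergence fails, every mesh bound [k.+1%:R^-1] admits an offending partition, so it is
   enough to treat sequences of partitions. *)
have bad k : exists nps : nat * (nat -> R) * (nat -> R),
    tagged_partition t nps.1.1 nps.1.2 nps.2 k.+1%:R^-1 /\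
    ~ (P [set w | (e0 < `|conv_riemann_sum Rs Z t nps.1.1 nps.1.2 nps.2 w - X t w|)%R] < eta%:E)%E.
  apply: contrapT => h; apply: hneg; exists k.+1%:R^-1 => // n p s part.
  by apply: contrapT => hn; apply: h; exists (n, p, s).
have [f hf] := choice bad.
pose S k := conv_riemann_sum Rs Z t (f k).1.1 (f k).1.2 (f k).2.
have part k := (hf k).1.
have mSk k : wmeas ip setT (S k) by exact: mS (part k).
suff [K hK] : exists K, forall k, (K <= k)%N -> pr P [set w | e0 < `|S k w - X t w|] <= eta / 2.
  apply: (hf K).2; rewrite prE.
    by rewrite lte_fin (le_lt_trans (hK K (leqnn K)))//; lra.
  by apply: measurable_gt; apply: (wmeas_norm ipP eP); apply: wmeasB => //; exact: mSk.
(* At time zero a strictly increasing partition has no interval, so every sum is zero, and the weak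
   equation makes each coordinate of [X 0] vanish almost surely. *)
have [t0|t0] := ltP 0 t; last first.
  have tE : t = 0 by lra.
  have n0 k : (f k).1.1 = 0%N.
    have [p0 pn pS _ _] := part k; rewrite tE in pn; case: (_.1.1) pn pS => // n pn pS.
    have : forall m, (m < n.+1)%N -> 0 < (f k).1.2 m.+1.
      elim=> [|m IH] mn; first by rewrite -p0 pS.
      by rewrite (lt_trans (IH _)) ?pS// ltnW.
    by move=> /(_ n (ltnSn n)); rewrite pn ltxx.
  have S0 k w : S k w = 0 by rewrite /S /conv_riemann_sum n0 big_ord0.
  apply: (weak_tight_cvg ipP eP mSk mXt) => //.
  - move=> i; have [h adj] := edom i; apply: ae_imp (weak t _ _ tT adj) => w.
    rewrite tE set_itv1 Rintegral_set1 Z0 (sip0l (ip_semi ipP)) addr0 => ->.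
    under eq_cvg do rewrite S0 (sip0l (ip_semi ipP)).
    exact: cvg_cst.
  - move=> r r' r0 r0'; exists 0%N => N _ k.
    rewrite (_ : [set w | _] = set0) ?pr0 ?ltW//.
    rewrite -subset0 => w /=; rewrite S0 => h.
    have [_ _ /(_ N 0) + _] := eP; rewrite normr0 => h'.
    by have := lt_le_trans (lt_trans r0 h) h'; rewrite ltxx.
have [u uP] := sepH.
apply: (weak_tight_cvg ipP eP mSk mXt) => //; last first.
  move=> r r' r0 r0'.
  have [N0 hN0] := conv_sum_tight ipP eP lZ sepH uP t0 RD RZ M_gt0 hM
    (fun x => within_continuous_cadlag (RC x)) r0 r0'.
  by exists N0 => N NN k; exact: hN0 (part k).
move=> i; have [h adj] := edom i.
have := weak_conv ipP clA La rP Lb' aE eP (levy_cadlag lZ) mX mZ LX weak tT h.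
have := weak t _ _ tT adj => w1 w2.
have : {ae P, forall w, ip (X t w) (e i) = ip (Z t w) (e i) +
    intR (fun s => chi t s * res_conv ip Rs c (rpos b) (chi T s *: Z s w) h (t - s))}.
  apply: negligibleS (negligibleU w1 w2) => w /= hw; apply: contrapT => /not_orP[].
  by move=> /contrapT h1 /contrapT h2; apply: hw; rewrite h1 addrC h2.
apply: ae_imp => w ->.
apply: (conv_sum_ip_cvg ipP clA La rP Lb' aE eP (levy_cadlag lZ w) (Z0 w) _ t0 _ part adj).
  exact: (wmeas_comp (measurable_pair2 w) mZ).
by lra.
Qed.
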